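(* Let $G$ be a non-discrete compact Abelian group and let $\mu\in M_{0}(G)$ be a Parreau measure. Then for some $c\in[0,1]$ we have $\sigma(\mu)=[-c,1]\cup S$ or $\sigma(\mu)=[-1,c]\cup S$, where $S$ is a finite subset of $\mathbb{R}$.
   Context: $M(G)$ is the commutative unital Banach algebra of complex regular Borel measures on $G$ with convolution product and total variation norm. For $\mu\in M(G)$, $\sigma(\mu)$ is the spectrum of $\mu$ in $M(G)$. $M_0(G)$ is the closed ideal of measures whose Fourier--Stieltjes transform vanishes at infinity on the dual group $\widehat{G}$. A Parreau measure on a locally compact Abelian group $G$ is a probability measure $\mu\in M(G)$ with real spectrum ($\sigma(\mu)\subset\mathbb{R}$) and all of whose convolution powers $\mu^{\ast n}$, $n\geq 1$, are singular with respect to the Haar measure on $G$. *)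

(* Defs.v *)
From HB Require Import structures.
From mathcomp Require Import all_boot all_order all_algebra.
From mathcomp Require Import complex.
From mathcomp Require Import all_classical all_reals all_analysis.

Set Implicit Arguments.
Unset Strict Implicit.
Unset Printing Implicit Defensive.

Import Order.TTheory GRing.Theory Num.Theory.
Import numFieldNormedType.Exports.

Local Open Scope classical_set_scope.
Local Open Scope ring_scope.
Local Open Scope complex_scope.

(* [topologicalZmodType] carries no [pointedType] structure, whence this alias
   of [G], pointed at [0], instead of [g_sigma_algebraType]. *)
Definition borel (G : topologicalZmodType) : Type := G.

HB.instance Definition _ (G : topologicalZmodType) :=
  Choice.copy (borel G) G.
HB.instance Definition _ (G : topologicalZmodType) :=
  isPointed.Build (borel G) (0 : G).
HB.instance Definition _ (G : topologicalZmodType) :=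
  @isMeasurable.Build (sigma_display (@open G)) (borel G)
    <<s (@open G) >> (@sigma_algebra0 _ setT (@open G))
    (@sigma_algebraC (borel G) (@open G))
    (@sigma_algebra_bigcup _ setT (@open G)).

Section charge_integral.
Context d (T : measurableType d) (R : realType).
Variable nu : {charge set T -> \bar R}.

Definition hahn_pos : set T := sval (cid (Hahn_decomposition nu)).
Definition hahn_neg : set T := sval (cid (svalP (cid (Hahn_decomposition nu)))).

Definition hahnP : hahn_decomposition nu hahn_pos hahn_neg :=
  svalP (cid (svalP (cid (Hahn_decomposition nu)))).

Definition charge_integral (f : T -> R) : R :=
  \int[jordan_pos hahnP]_x f x - \int[jordan_neg hahnP]_x f x.

End charge_integral.

(* Library charges are finite on measurable sets, so that [cre] and [cim] are
   finite signed measures; like library measures, their values on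
   non-measurable sets are meaningless. *)
Record cmeasure (R : realType) (G : topologicalZmodType) := CMeasure {
  cre : {charge set (borel G) -> \bar R} ;
  cim : {charge set (borel G) -> \bar R} }.

Definition cmeasure_fun (R : realType) (G : topologicalZmodType)
    (mu : cmeasure R G) : set (borel G) -> R[i] :=
  fun A => fine (cre mu A) +i* fine (cim mu A).

Coercion cmeasure_fun : cmeasure >-> Funclass.

Section measure_algebra.
Context (R : realType) (G : topologicalZmodType).
Implicit Types (mu nu : cmeasure R G) (f : set (borel G) -> R[i]).
Implicit Types (A : set (borel G)).

(* The modulus on [R[i]] is [R[i]]-valued, hence [complex.Re]. *)
Definition total_variation f A : \bar R :=
  ereal_sup [set (\sum_(0 <= n <oo) (complex.Re `|f (F n)|)%:E)%E |
    F in [set F : (set (borel G))^nat |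
      [/\ forall n, measurable (F n), trivIset setT F & \bigcup_n F n = A]]].

Definition MG : set (cmeasure R G) :=
  [set mu | forall A, measurable A -> forall e : R, 0 < e ->
    exists K U : set G, [/\ compact K, open U, K `<=` A, A `<=` U &
      (total_variation mu (U `\` K) < e%:E)%E]].

Definition cintegral mu (h : borel G -> R[i]) : R[i] :=
  (charge_integral (cre mu) (fun x => complex.Re (h x))
   - charge_integral (cim mu) (fun x => complex.Im (h x)))
  +i* (charge_integral (cre mu) (fun x => complex.Im (h x))
       + charge_integral (cim mu) (fun x => complex.Re (h x))).

(* [(mu * f)(A) = \int f(A - x) dmu(x)]. If [G] is not second countable,
   addition need not be measurable for the product of the Borel sigma-algebras,
   so convolution is not the image of a product measure; for [f] regular,
   [x |-> f(A - x)] is nevertheless a Borel function. *)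
Definition conv mu f : set (borel G) -> R[i] :=
  fun A => cintegral mu (fun x => f [set y : G | A ((x : G) + y)]).

Definition delta0 : set (borel G) -> R[i] :=
  fun A => (fine (\d_((0 : G) : borel G) A : \bar R))%:C.

Definition convpow mu (n : nat) : set (borel G) -> R[i] :=
  iter n (conv mu) delta0.

(* Convolution is commutative on [MG], so a one-sided inverse is an inverse;
   measures are compared on Borel sets only. *)
Definition spectrum mu : set R[i] :=
  [set z | ~ exists2 nu, MG nu & forall A, measurable A ->
    conv nu (fun B => z * delta0 B - mu B) A = delta0 A].

Definition dual_group : set {compact-open, G -> R[i]^o} :=
  [set g : G -> R[i]^o | [/\ continuous g,
    forall x y, g (x + y) = g x * g y & forall x, `|g x| = 1]].

Definition fourier_stieltjes mu (g : G -> R[i]^o) : R[i] :=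
  cintegral mu (fun x => g (- (x : G))).

Definition M0G : set (cmeasure R G) :=
  [set mu | MG mu /\ forall e : R, 0 < e ->
    exists K : set {compact-open, G -> R[i]^o},
      [/\ compact K, K `<=` dual_group &
        forall g, dual_group g -> ~ K g -> `|fourier_stieltjes mu g| < e%:C]].

Definition haar_measure (lambda : {measure set (borel G) -> \bar R}) : Prop :=
  [/\ lambda setT != 0%E,
      forall K : set G, compact K -> (lambda K < +oo)%E,
      forall A, measurable A ->
        lambda A = ereal_inf [set lambda U | U in [set U : set G |
          open U /\ A `<=` U]],
      forall U : set G, open U ->
        lambda U = ereal_sup [set lambda K | K in [set K : set G |
          compact K /\ K `<=` U]] &
      forall (x : G) A, measurable A ->
        lambda [set y : G | A (x + y)] = lambda A].

Definition singular f (lambda : {measure set (borel G) -> \bar R}) : Prop :=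
  exists N : set (borel G), [/\ measurable N, lambda N = 0%E &
    forall A, measurable A -> A `<=` ~` N -> f A = 0].

Definition is_probability mu : Prop :=
  exists P : probability (borel G) R, forall A, measurable A ->
    mu A = (fine (P A))%:C.

Definition parreau (lambda : {measure set (borel G) -> \bar R}) mu : Prop :=
  [/\ MG mu, is_probability mu,
      forall z, spectrum mu z -> complex.Im z = 0 &
      forall n, (1 <= n)%N -> singular (convpow mu n) lambda].

End measure_algebra.

(* Main.v *)
Require Import Defs.
From HB Require Import structures.
From mathcomp Require Import all_boot all_order all_algebra.
From mathcomp Require Import complex.
From mathcomp Require Import all_classical all_reals all_analysis.
From mathcomp Require Import measurable_realfun.
From mathcomp Require Import ring lra.
Set Implicit Arguments.
Unset Strict Implicit.
Unset Printing Implicit Defensive.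
Import Order.TTheory GRing.Theory Num.Theory.
Import numFieldNormedType.Exports.
Local Open Scope classical_set_scope.
Local Open Scope ring_scope.
Local Open Scope complex_scope.

(** The spectrum of the measure is an interval [a, 1] with -1 <= a <= 0.  The
    argument takes place on continuous functions on the compact group, where
    the measure acts by the operator T that averages over translates, and
    polynomials in the measure act as polynomials in T.  The operator norm of
    such a polynomial is the total variation of the measure, by regularity.

    Call z regular if z - T has approximate inverses among the polynomials in
    T.  Regular points lie outside the spectrum: the partial sums of a Neumann
    series are complex measures that converge uniformly on sets, and their
    limit is an inverse of z - mu ([regular_spectrum]).  Conversely, an inverse
    measure bounds z - T below, and lower bounds propagate regularity along a
    path of points outside the spectrum; as the spectrum is real, a vertical
    half-line is such a path ([spectrum_regular]).

    The main step is [spectral_gap]: if a circle with real centre consists of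
    regular points and zero lies outside it, then the real points of the disc
    are regular.  The Fourier-Stieltjes transform vanishes at infinity and the
    dual of a compact group is discrete, so only finitely many characters have
    their eigenvalue in the disc.  On trigonometric polynomials without these
    characters, the resolvent is a rational function of z with poles outside the
    circle, so bounds on the circle extend inside ([rational_max]); and
    trigonometric polynomials are dense ([trigpoly_dense]).  The remaining
    finitely many characters correspond to a measure with a continuous density.
    All convolution powers are singular, so subtracting such a measure cannot
    decrease the total variation ([mpow_separated]).  Hence approximate inverses
    at non-real points near a real point of the disc are uniformly bounded,
    which makes the real point regular.

    The trivial character makes 1 a point of the spectrum.  A gap between 0 and
    1, or between the least point of the spectrum and 0, would be the end of a
    diameter of a circle of regular points around 1, respectively around the
    least point, with zero outside: [nonregular_interval].

    Density of trigonometric polynomials is the Peter-Weyl theorem.  Its proof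
    finds a character in each eigenspace of the square of a hermitian
    convolution operator: eigenspaces are finite-dimensional, and translations
    act on a minimal invariant subspace by scalars ([eigenspace_character]).
    Integration enters it through [quadrature], approximation by finite convex
    combinations of point evaluations.  The measure theory rests on [conv_inner],
    that convolutions of regular measures are regular, and on the layer cake
    argument of [comb_int_le], which carries identities and bounds between
    combinations of measures from sets to functions. *)

(** * The modulus of a complex number, as a real number *)

(** The norm of [R[i]] takes values in [R[i]]; estimates need it in [R]. *)
Definition nm (R : realType) (z : R[i]) : R := Normc.normc z.

Definition cj (R : realType) (z : R[i]) : R[i] := conjc z.

Section Modulus.
Variable R : realType.
Implicit Types (z w : R[i]) (e : R).

Lemma nmE z : `|z| = (nm z)%:C. Proof. by []. Qed.

Lemma nm_ge0 z : 0 <= nm z.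
Proof. by case: z => a b; rewrite /nm /= sqrtr_ge0. Qed.

Lemma nm0 : nm (0 : R[i]) = 0. Proof. exact: Normc.normc0. Qed.

Lemma nm1 : nm (1 : R[i]) = 1. Proof. exact: Normc.normc1. Qed.

Lemma nmM z w : nm (z * w) = nm z * nm w. Proof. exact: Normc.normcM. Qed.

Lemma nmV z : nm z^-1 = (nm z)^-1. Proof. exact: Normc.normcV. Qed.

Lemma nmX z n : nm (z ^+ n) = nm z ^+ n.
Proof. by elim: n => [|n IH]; rewrite ?nm1 // !exprS nmM IH. Qed.

Lemma nm_eq0 z : nm z = 0 -> z = 0. Proof. exact: Normc.eq0_normc. Qed.

Lemma nmD z w : nm (z + w) <= nm z + nm w. Proof. exact: le_normcD. Qed.

Lemma nmN z : nm (- z) = nm z. Proof. exact: normcN. Qed.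

Lemma nmB z w : nm (z - w) <= nm z + nm w.
Proof. by rewrite -(nmN w) nmD. Qed.

Lemma nm_distC z w : nm (z - w) = nm (w - z).
Proof. by rewrite -nmN opprB. Qed.

Lemma nm_dist_tri w z u : nm (z - u) <= nm (z - w) + nm (w - u).
Proof. by rewrite (_ : z - u = (z - w) + (w - u)); [exact: nmD|ring]. Qed.

Lemma nmM_le (c e : R) z w : 0 < c -> nm z <= e / c -> nm w <= c ->
  nm (z * w) <= e.
Proof.
move=> c0 hz hw; rewrite nmM -(divfK (lt0r_neq0 c0) e).
by apply: ler_pM; rewrite ?nm_ge0.
Qed.

Lemma nmM_le2 (a b : R) z w : nm z <= a -> nm w <= b -> nm (z * w) <= a * b.
Proof. by move=> hz hw; rewrite nmM; apply: ler_pM; rewrite ?nm_ge0. Qed.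

Lemma nm_real (x : R) : nm (x%:C) = `|x|.
Proof. by rewrite /nm /= expr0n addr0 sqrtr_sqr. Qed.

Lemma nm_nat n : nm (n%:R : R[i]) = n%:R.
Proof.
have -> : n%:R = (n%:R : R)%:C by rewrite rmorph_nat.
by rewrite nm_real ger0_norm.
Qed.

Lemma nm_Re z : `|complex.Re z| <= nm z.
Proof.
by case: z => a b; rewrite /nm /= -sqrtr_sqr ler_wsqrtr ?lerDl ?sqr_ge0.
Qed.

Lemma nm_Im z : `|complex.Im z| <= nm z.
Proof.
by case: z => a b; rewrite /nm /= -sqrtr_sqr ler_wsqrtr ?lerDr ?sqr_ge0.
Qed.

Lemma nm_le_ReIm z : nm z <= `|complex.Re z| + `|complex.Im z|.
Proof.
have := nmD (complex.Re z)%:C ('i%C * (complex.Im z)%:C).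
by rewrite -complexE nmM !nm_real /nm /= expr0n expr1n add0r sqrtr1 mul1r.
Qed.

Lemma nm_cj z : nm (cj z) = nm z.
Proof. by case: z => a b; rewrite /nm /= sqrrN. Qed.

Lemma cjM z w : cj (z * w) = cj z * cj w.
Proof. exact: (rmorphM (@conjc R)). Qed.

Lemma cjB z w : cj (z - w) = cj z - cj w.
Proof. exact: (rmorphB (@conjc R)). Qed.

Lemma cj_real (x : R) : cj x%:C = x%:C.
Proof. exact: conjc_real. Qed.

Lemma cjK : involutive (@cj R).
Proof. exact: conjcK. Qed.

Lemma cj_sum (I : Type) (s : seq I) (F : I -> R[i]) :
  cj (\sum_(i <- s) F i) = \sum_(i <- s) cj (F i).
Proof. exact: (rmorph_sum (@conjc R)). Qed.

Lemma Re_cj z : complex.Re (cj z) = complex.Re z.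
Proof. by case: z. Qed.

Lemma mul_cj z : z * cj z = (nm z ^+ 2)%:C.
Proof. by rewrite -sqr_normc nmE -rmorphXn. Qed.

Lemma mul_cj_ge0 z : 0 <= z * cj z.
Proof. exact: mulcJ_ge0. Qed.

Lemma nm_sum (I : Type) (s : seq I) (P : pred I) (F : I -> R[i]) :
  nm (\sum_(i <- s | P i) F i) <= \sum_(i <- s | P i) nm (F i).
Proof.
elim/big_rec2 : _ => [|i y x _ le]; first by rewrite nm0.
by apply: (le_trans (nmD _ _)); rewrite lerD2l.
Qed.

Lemma nm_small0 z : (forall e, 0 < e -> nm z <= e) -> z = 0.
Proof.
move=> h; apply: nm_eq0; apply/eqP; rewrite eq_le nm_ge0 andbT.
by apply/ler_addgt0Pr => e e0; rewrite add0r h.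
Qed.

Lemma nm_small_eq z w : (forall e, 0 < e -> nm (z - w) <= e) -> z = w.
Proof. by move=> /nm_small0 /eqP; rewrite subr_eq0 => /eqP. Qed.

Lemma ReD z w : complex.Re (z + w) = complex.Re z + complex.Re w.
Proof. by case: z w => [a b] [c d]. Qed.

Lemma ImD z w : complex.Im (z + w) = complex.Im z + complex.Im w.
Proof. by case: z w => [a b] [c d]. Qed.

Lemma ReB z w : complex.Re (z - w) = complex.Re z - complex.Re w.
Proof. by case: z w => [a b] [c d]. Qed.

Lemma ImB z w : complex.Im (z - w) = complex.Im z - complex.Im w.
Proof. by case: z w => [a b] [c d]. Qed.

Lemma ReM z w :
  complex.Re (z * w) = complex.Re z * complex.Re w - complex.Im z * complex.Im w.
Proof. by case: z w => [a b] [c d]. Qed.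

Lemma ImM z w :
  complex.Im (z * w) = complex.Re z * complex.Im w + complex.Im z * complex.Re w.
Proof. by case: z w => [a b] [c d]. Qed.

Lemma ReZ (x : R) z : complex.Re (x%:C * z) = x * complex.Re z.
Proof. by rewrite ReM /= mul0r subr0. Qed.

Lemma complexEE z : z = complex.Re z +i* complex.Im z.
Proof. by case: z. Qed.

End Modulus.

(** * Uniformly continuous functions on a compact group *)

(** A topological abelian group carries no canonical uniform structure here, so
    uniform continuity is spelled out with neighbourhoods of zero. *)
Definition ucont (R : realType) (G : topologicalZmodType) (f : G -> R[i]) :=
  forall e : R, 0 < e ->
    \forall u \near nbhs (0 : G), forall x, nm (f (x + u) - f x) <= e.

Section Ucont.
Variables (R : realType) (G : topologicalZmodType).
Hypothesis compactG : compact [set: G].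
Implicit Types (f g : G -> R[i]) (x y u : G).

Lemma shift_continuous (a : G) : continuous (fun x : G => a + x).
Proof.
move=> x; apply: (@continuous_comp _ _ _ (fun x => (a, x))
  (fun x : G * G => x.1 + x.2)); last exact: add_continuous.
by apply: cvg_pair => /=; [exact: cvg_cst|exact: cvg_id].
Qed.

Lemma shift0_nbhs (x : G) (U : set G) :
  nbhs x U <-> nbhs (0 : G) [set u | U (x + u)].
Proof.
split => [xU|oU].
  have := @shift_continuous x 0; rewrite /continuous_at addr0 => h.
  exact: (h _ xU).
have := @shift_continuous (- x) x; rewrite /continuous_at addNr => h.
have := h _ oU; rewrite nbhs_simpl /=; apply: filterS => y /=.
by rewrite addrA subrr add0r.
Qed.

Lemma opp_nbhs0 (U : set G) : nbhs (0 : G) U -> nbhs (0 : G) [set u | U (- u)].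
Proof.
move=> oU; have := @opp_continuous G 0; rewrite /continuous_at oppr0 => h.
exact: (h _ oU).
Qed.

(** Total boundedness of a compact group. *)
Lemma fin_translates (U : set G) : nbhs (0 : G) U ->
  exists s : seq G, forall x, exists2 y, y \in s & U (x - y).
Proof.
move=> oU.
have /compact_near_coveringP/(_ (seq G)
   (filter_from [set: seq G] (fun s : seq G => [set t : seq G | {subset s <= t}]))
   (fun t x => exists2 y, y \in t & U (x - y))) := compactG.
case.
- apply: filter_from_filter; first by exists [::].
  move=> s t _ _; exists (s ++ t) => // r sr; split => y ys;
  by apply: sr; rewrite mem_cat ys ?orbT.
- move=> x _; exists ([set y | U (y - x)], [set t : seq G | {subset [:: x] <= t}]).
    split; last by exists [:: x].
    apply/shift0_nbhs; apply: filterS oU => u /=.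
    by rewrite addrAC subrr add0r.
  case=> y t /= [Uyx xt]; exists x => //; apply: xt; exact: mem_head.
- by move=> s _ h; exists s => x; exact: (h s _ x).
Qed.

Lemma ucont_cst (c : R[i]) : ucont (fun _ : G => c).
Proof. by move=> e e0; near=> u => x; rewrite subrr nm0 ltW. Unshelve. all: by end_near. Qed.

Lemma ucont_bounded f : ucont f -> exists2 B, 0 < B & forall x, nm (f x) <= B.
Proof.
move=> /(_ 1 ltr01)/fin_translates[s hs].
exists (1 + \sum_(y <- s) nm (f y)).
  by rewrite ltr_wpDr // sumr_ge0 // => i _; exact: nm_ge0.
move=> x; have [y ys Uy] := hs x; have := Uy y; rewrite (addrC y) subrK => h.
have -> : f x = (f x - f y) + f y by rewrite subrK.
apply: (le_trans (nmD _ _)); apply: lerD => //.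
rewrite (big_rem y) //= lerDl sumr_ge0 // => i _; exact: nm_ge0.
Qed.

Lemma ucontD f g : ucont f -> ucont g -> ucont (fun x => f x + g x).
Proof.
move=> cf cg e e0; have e20 : 0 < e / 2 by rewrite divr_gt0.
near=> u => x.
have -> : f (x + u) + g (x + u) - (f x + g x)
  = (f (x + u) - f x) + (g (x + u) - g x) by ring.
apply: (le_trans (nmD _ _)); rewrite [leRHS]splitr; apply: lerD.
  by move: x; near: u; exact: cf.
by move: x; near: u; exact: cg.
Unshelve. all: by end_near. Qed.

Lemma ucontZ (c : R[i]) f : ucont f -> ucont (fun x => c * f x).
Proof.
move=> cf e e0; have n0 : 0 < nm c + 1 by rewrite ltr_wpDl // nm_ge0.
near=> u => x; rewrite -mulrBr nmM.
apply: (@le_trans _ _ ((nm c + 1) * (e / (nm c + 1)))); last first.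
  by rewrite mulrCA divff ?mulr1 ?gt_eqF.
apply: ler_pM; [exact: nm_ge0|exact: nm_ge0|by rewrite lerDl|].
by move: x; near: u; apply: cf; rewrite divr_gt0.
Unshelve. all: by end_near. Qed.

Lemma ucontN f : ucont f -> ucont (fun x => - f x).
Proof.
move=> cf; have := @ucontZ (-1) f cf; congr (ucont _).
by apply/funext => x; rewrite mulN1r.
Qed.

Lemma ucontB f g : ucont f -> ucont g -> ucont (fun x => f x - g x).
Proof. by move=> cf cg; apply: ucontD => //; exact: ucontN. Qed.

Lemma ucontM f g : ucont f -> ucont g -> ucont (fun x => f x * g x).
Proof.
move=> cf cg e e0; have [B B0 hB] := ucont_bounded cf.
have [C C0 hC] := ucont_bounded cg.
near=> u => x.
have -> : f (x + u) * g (x + u) - f x * g x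
  = f (x + u) * (g (x + u) - g x) + (f (x + u) - f x) * g x by ring.
apply: (le_trans (nmD _ _)); rewrite !nmM [leRHS]splitr; apply: lerD.
  apply: (@le_trans _ _ (B * (e / 2 / B))); last first.
    by rewrite mulrCA divff ?mulr1 ?gt_eqF.
  apply: ler_pM => //; try exact: nm_ge0.
  by move: x; near: u; apply: cg; rewrite !divr_gt0.
apply: (@le_trans _ _ ((e / 2 / C) * C)); last first.
  by rewrite -mulrA mulVf ?mulr1 ?gt_eqF.
apply: ler_pM => //; try exact: nm_ge0.
by move: x; near: u; apply: cf; rewrite !divr_gt0.
Unshelve. all: by end_near. Qed.

Lemma ucont_shift f (a : G) : ucont f -> ucont (fun x => f (a + x)).
Proof.
move=> cf e e0; near=> u => x; rewrite addrA.
by move: (a + x); near: u; exact: cf.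
Unshelve. all: by end_near. Qed.

Lemma ucont_refl f (a : G) : ucont f -> ucont (fun x => f (a - x)).
Proof.
move=> cf e e0; near=> u => x; rewrite nm_distC.
have -> : a - x = (a - (x + u)) + u by rewrite opprD addrA subrK.
by move: (a - (x + u)); near: u; exact: cf.
Unshelve. all: by end_near. Qed.

Lemma ucont_cj f : ucont f -> ucont (fun x => cj (f x)).
Proof.
move=> cf e e0; near=> u => x; rewrite -cjB nm_cj.
by move: x; near: u; exact: cf.
Unshelve. all: by end_near. Qed.

Lemma ucont_sum (I : Type) (s : seq I) (F : I -> G -> R[i]) :
  (forall i, ucont (F i)) -> ucont (fun x => \sum_(i <- s) F i x).
Proof.
move=> cF; elim: s => [|i s IH].
  have := @ucont_cst 0; congr (ucont _).
  by apply/funext => x; rewrite big_nil.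
have := ucontD (cF i) IH; congr (ucont _).
by apply/funext => x; rewrite big_cons.
Qed.

(** Heine's theorem. *)
Lemma near_ucont f : (forall x (e : R), 0 < e ->
  \forall y \near x, nm (f y - f x) <= e) -> ucont f.
Proof.
move=> cf e e0.
have /compact_near_coveringP/(_ G (nbhs (0 : G))
   (fun u x => nm (f (x + u) - f x) <= e)) hc := compactG.
apply: filterS (hc _ _) => [u + x|x _]; first by move=> /(_ x); exact.
have e2 : 0 < e / 2 by rewrite divr_gt0.
have h1 := cf x _ e2.
have h2 : \forall z \near (x, (0 : G)), nm (f (z.1 + z.2) - f x) <= e / 2.
  have := @add_continuous G (x, 0); rewrite /continuous_at /= addr0.
  by move=> /(_ _ h1).
have h3 : \forall z \near (x, (0 : G)), nm (f z.1 - f x) <= e / 2.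
  have : (fun z : G * G => z.1) z @[z --> (x, (0 : G))] --> x by exact: cvg_fst.
  by move=> /(_ _ h1).
have [[A B] [/= nA nB] hAB] := h2.
have [[A' B'] [/= nA' nB'] hAB'] := h3.
exists (A `&` A', B `&` B'); first by split; exact: filterI.
case=> y u /= [[Ay A'y] [Bu B'u]].
have h5 := hAB (y, u) (conj Ay Bu); have h6 := hAB' (y, u) (conj A'y B'u).
apply: (le_trans (nm_dist_tri (f x) _ _)).
by rewrite [leRHS]splitr lerD // nm_distC.
Qed.

Lemma continuous_ucont f : continuous (f : G -> R[i]^o) -> ucont f.
Proof.
move=> cf; apply: near_ucont => x e e0.
have /cvgrPdist_le/(_ e%:C) := cf x.
rewrite ltcR => /(_ e0); rewrite near_simpl; apply: filterS => y.
by rewrite nmE lecR nm_distC.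
Qed.

Lemma ucont_near f x (e : R) : ucont f -> 0 < e ->
  \forall y \near x, nm (f y - f x) <= e.
Proof.
move=> cf e0; apply/shift0_nbhs; apply: filterS (cf _ e0) => u /=; exact.
Qed.

Lemma ucont_continuous f : ucont f -> continuous (f : G -> R[i]^o).
Proof.
move=> cf x; apply/cvgrPdist_le => /= -[e b]; rewrite ltcE /= => /andP[/eqP -> e0].
apply: filterS (ucont_near x cf e0) => y; rewrite nm_distC.
by rewrite nmE -[X in _ -> X <= _]/((nm (f x - f y))%:C) lecE /= eqxx.
Qed.

Lemma ucont_Re f : ucont f -> continuous (fun x => complex.Re (f x)).
Proof.
move=> cf x; apply/cvgrPdist_le => e e0.
apply: filterS (ucont_near x cf e0) => y; rewrite nm_distC.
by apply: le_trans; rewrite -ReB; exact: nm_Re.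
Qed.

Lemma ucont_Im f : ucont f -> continuous (fun x => complex.Im (f x)).
Proof.
move=> cf x; apply/cvgrPdist_le => e e0.
apply: filterS (ucont_near x cf e0) => y; rewrite nm_distC.
by apply: le_trans; rewrite -ImB; exact: nm_Im.
Qed.

Lemma ucont_real (h : G -> R) : continuous h -> ucont (fun x => (h x)%:C).
Proof.
move=> ch; apply: near_ucont => x e e0.
have /cvgrPdist_le/(_ e e0) := ch x; rewrite near_simpl; apply: filterS => y.
by rewrite -rmorphB nm_real distrC.
Qed.

Hypothesis hausdorffG : hausdorff_space G.

(** Urysohn's lemma, in the form used to approximate indicator functions. *)
Lemma cutoff (K U : set G) : compact K -> open U -> K `<=` U ->
  exists h : G -> R, [/\ continuous h, forall x, 0 <= h x <= 1,
    forall x, K x -> h x = 1 & forall x, ~ U x -> h x = 0].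
Proof.
move=> cK oU KU.
have nG : normal_space G by exact: compact_normal.
have : uniform_separator (~` U) K.
  apply: (proj1 (@normal_separatorP R G)) => //.
  - exact: open_closedC.
  - exact: compact_closed.
  - by rewrite -subset0 => x [] nU /KU.
move=> /(@uniform_separatorP _ R)[h [ch h01 h0 h1]].
exists h; split => // x.
- by have /= := h01 (h x) (ex_intro2 _ _ x Logic.I erefl); rewrite in_itv.
- by move=> Kx; apply: h1; exists x.
- by move=> Ux; apply: h0; exists x.
Qed.

End Ucont.

(** * Integration functionals and finite quadrature *)

Section Quadrature.
Variables (R : realType) (G : topologicalZmodType).
Implicit Types (f g : G -> R[i]) (x y u : G) (s : seq (R * G)).
Implicit Types (L : (G -> R[i]) -> R[i]).

Definition qsum s f : R[i] := \sum_(p <- s) p.1%:C * f p.2.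

Definition weights s := all (fun p => 0 <= p.1) s && (\sum_(p <- s) p.1 == 1).

(** Integrals against a probability measure have this property.  On continuous
    functions it gives linearity, bounds and Fubini's theorem for kernels by
    reduction to finite convex combinations of point evaluations. *)
Definition quadrature L := forall U : set G, nbhs (0 : G) U ->
  exists2 s, weights s & forall f (e : R), ucont f ->
    (forall u, U u -> forall x, nm (f (x + u) - f x) <= e) ->
    nm (L f - qsum s f) <= e.

Lemma qsumD s f g : qsum s (fun x => f x + g x) = qsum s f + qsum s g.
Proof. by rewrite /qsum -big_split /=; apply: eq_bigr => p _; rewrite mulrDr. Qed.

Lemma qsumZ s c f : qsum s (fun x => c * f x) = c * qsum s f.
Proof. by rewrite /qsum mulr_sumr; apply: eq_bigr => p _; rewrite mulrCA. Qed.

Lemma qsum_cj s f : qsum s (fun x => cj (f x)) = cj (qsum s f).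
Proof.
rewrite /qsum cj_sum; apply: eq_bigr => p _.
by rewrite cjM cj_real.
Qed.

Lemma qsum_cst s (c : R[i]) : weights s -> qsum s (fun=> c) = c.
Proof.
case/andP => _ /eqP s1; rewrite /qsum -mulr_suml -rmorph_sum.
by rewrite s1 mul1r.
Qed.

Lemma qsum_le s f (b : R) : weights s -> (forall x, nm (f x) <= b) ->
  nm (qsum s f) <= b.
Proof.
case/andP => /allP s0 /eqP s1 fb; apply: (le_trans (nm_sum _ _ _)).
rewrite -[leRHS]mul1r -s1 mulr_suml big_seq [leRHS]big_seq.
apply: ler_sum => p ps; rewrite nmM nm_real ger0_norm ?s0 //.
by rewrite ler_wpM2l ?s0.
Qed.

Lemma qsum_pos s f : weights s -> (forall x, 0 <= f x) -> 0 <= qsum s f.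
Proof.
case/andP => /allP s0 _ f0; rewrite /qsum big_seq sumr_ge0 // => p ps.
by rewrite mulr_ge0 // ler0c s0.
Qed.

Section Functional.
Variable L : (G -> R[i]) -> R[i].
Hypothesis qL : quadrature L.

Lemma quad_lin a f g : ucont f -> ucont g ->
  L (fun x => a * f x + g x) = a * L f + L g.
Proof.
move=> cf cg; have ca := ucontZ a cf; have cs := ucontD ca cg.
apply: nm_small_eq => e e0.
have e4 : 0 < e / 4 by rewrite divr_gt0.
have na : 0 < nm a + 1 by rewrite ltr_wpDl // nm_ge0.
have ea : 0 < e / 4 / (nm a + 1) by rewrite divr_gt0.
have [s ws hs] := qL (filterI (cs _ e4) (filterI (cf _ ea) (cg _ e4))).
have h1 := hs _ _ cs (fun u h => h.1).
have h2 := hs _ _ cf (fun u h => h.2.1).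
have h3 := hs _ _ cg (fun u h => h.2.2).
move: h1; rewrite qsumD qsumZ.
set t1 := L _; set t2 := L f in h2 *; set t3 := L g in h3 *.
set q2 := qsum s f in h2 *; set q3 := qsum s g in h3 *; move=> h1.
have -> : t1 - (a * t2 + t3)
  = (t1 - (a * q2 + q3)) - a * (t2 - q2) - (t3 - q3) by ring.
have h4 : nm (a * (t2 - q2)) <= e / 4.
  rewrite nmM; apply: (@le_trans _ _ ((nm a + 1) * (e / 4 / (nm a + 1)))).
    by apply: ler_pM => //; rewrite ?nm_ge0 ?lerDl.
  by rewrite mulrCA divff ?mulr1 ?gt_eqF.
have h5 := nmB (t1 - (a * q2 + q3) - a * (t2 - q2)) (t3 - q3).
have h6 := nmB (t1 - (a * q2 + q3)) (a * (t2 - q2)).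
lra.
Qed.

Lemma quad_cst c : L (fun=> c) = c.
Proof.
apply: nm_small_eq => e e0; have [s ws hs] := qL (@filterT _ (nbhs (0 : G)) _).
have := hs (fun=> c) e (@ucont_cst R G c); rewrite qsum_cst //; apply.
by move=> u _ x; rewrite subrr nm0 ltW.
Qed.

Lemma quadD f g : ucont f -> ucont g -> L (fun x => f x + g x) = L f + L g.
Proof.
move=> cf cg; have := quad_lin 1 cf cg; rewrite mul1r => <-.
by congr L; apply/funext => x; rewrite mul1r.
Qed.

Lemma quadZ a f : ucont f -> L (fun x => a * f x) = a * L f.
Proof.
move=> cf; have := quad_lin a cf (@ucont_cst R G 0); rewrite quad_cst addr0.
by move=> <-; congr L; apply/funext => x; rewrite addr0.
Qed.

Lemma quadB f g : ucont f -> ucont g -> L (fun x => f x - g x) = L f - L g.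
Proof.
move=> cf cg; have := quad_lin (-1) cg cf.
rewrite mulN1r addrC => <-; congr L; apply/funext => x.
by rewrite mulN1r addrC.
Qed.

Lemma quad_sum (I : Type) (s : seq I) (F : I -> G -> R[i]) :
  (forall i, ucont (F i)) ->
  L (fun x => \sum_(i <- s) F i x) = \sum_(i <- s) L (F i).
Proof.
move=> cF; elim: s => [|i s IH].
  rewrite big_nil -[RHS]quad_cst; congr L.
  by apply/funext => x; rewrite big_nil.
rewrite big_cons -IH -quadD //; last exact: ucont_sum.
by congr L; apply/funext => x; rewrite big_cons.
Qed.

Lemma quad_le f (b : R) : ucont f -> (forall x, nm (f x) <= b) -> nm (L f) <= b.
Proof.
move=> cf fb; apply/ler_addgt0Pr => e e0.
have [s ws hs] := qL (cf _ e0).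
have h1 := hs _ _ cf (fun u h => h); have h2 := qsum_le ws fb.
rewrite -(subrK (qsum s f) (L f)).
by apply: (le_trans (nmD _ _)); rewrite addrC lerD.
Qed.

(** Domination by a real function, pointwise under the integral; [quad_le] is
    the case of a constant. *)
Lemma quad_dom f (b : G -> R) : ucont f -> ucont (fun x => (b x)%:C) ->
  (forall x, nm (f x) <= b x) -> nm (L f) <= complex.Re (L (fun x => (b x)%:C)).
Proof.
move=> cf cb fb; apply/ler_addgt0Pr => e e0.
have e2 : 0 < e / 2 by rewrite divr_gt0.
have [s ws hs] := qL (filterI (cf _ e2) (cb _ e2)).
have h1 := hs _ _ cf (fun u h => h.1); have h2 := hs _ _ cb (fun u h => h.2).
have h3 : nm (qsum s f) <= complex.Re (qsum s (fun x => (b x)%:C)).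
  case/andP : ws => /allP s0 _.
  have -> : complex.Re (qsum s (fun x => (b x)%:C)) = \sum_(p <- s) p.1 * b p.2.
    by rewrite /qsum; under eq_bigr do rewrite -rmorphM; rewrite -rmorph_sum.
  apply: (le_trans (nm_sum _ _ _)); rewrite big_seq [leRHS]big_seq.
  apply: ler_sum => p ps; rewrite nmM nm_real ger0_norm ?s0 //.
  by rewrite ler_wpM2l ?s0.
have h4 := le_trans (nm_Re _) h2; rewrite ReB ler_norml in h4.
have /andP[h5 _] := h4; have h6 := nmD (L f - qsum s f) (qsum s f).
rewrite subrK in h6; lra.
Qed.

Lemma quad_cj f : ucont f -> L (fun x => cj (f x)) = cj (L f).
Proof.
move=> cf; apply: nm_small_eq => e e0.
have e2 : 0 < e / 2 by rewrite divr_gt0.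
have [s ws hs] := qL (cf _ e2).
have h1 := hs _ _ cf (fun u h => h).
have h2 : nm (L (fun x => cj (f x)) - qsum s (fun x => cj (f x))) <= e / 2.
  apply: hs => [|u hu x]; first exact: ucont_cj.
  by rewrite -cjB nm_cj; exact: hu.
rewrite qsum_cj in h2; rewrite -nm_cj cjB in h1.
apply: (le_trans (nm_dist_tri (cj (qsum s f)) _ _)).
by rewrite [leRHS]splitr lerD // nm_distC.
Qed.

Lemma quad_ge0 f : ucont f -> (forall x, 0 <= f x) -> 0 <= L f.
Proof.
move=> cf f0.
have Im0 z : 0 <= z -> complex.Im z = 0 :> R.
  by rewrite lecE /= => /andP[/eqP].
have h e : 0 < e -> exists2 q : R[i], 0 <= q & nm (L f - q) <= e.
  move=> e0; have [s ws hs] := qL (cf _ e0).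
  by exists (qsum s f); [exact: qsum_pos|exact: hs].
rewrite lecE /=; apply/andP; split.
  rewrite -normr_le0; apply/ler_addgt0Pr => e e0; rewrite add0r.
  have [q q0 hq] := h e e0.
  by apply: le_trans hq; apply: le_trans (nm_Im _); rewrite ImB (Im0 q) // subr0.
apply/ler_addgt0Pr => e e0.
have [q + hq] := h e e0; rewrite lecE /= => /andP[_ q0].
have := le_trans (nm_Re _) hq; rewrite ReB ler_norml => /andP[+ _].
by move: q0; lra.
Qed.

(** Convolution with the reflected measure of [L]; the operator whose powers
    represent the convolution powers of that measure. *)
Definition cvl f : G -> R[i] := fun x => L (fun y => f (x + y)).

Lemma cvl_ucont f : ucont f -> ucont (cvl f).
Proof.
move=> cf e e0; apply: filterS (cf e e0) => u hu x; rewrite /cvl.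
rewrite -quadB; [|exact: ucont_shift|exact: ucont_shift].
apply: quad_le => [|y]; first by apply: ucontB; exact: ucont_shift.
by rewrite addrAC; exact: hu.
Qed.

Lemma cvl_le f (b : R) : ucont f -> (forall x, nm (f x) <= b) ->
  forall x, nm (cvl f x) <= b.
Proof. by move=> cf fb x; apply: quad_le => //; exact: ucont_shift. Qed.

Lemma cvl_lin a f g : ucont f -> ucont g ->
  cvl (fun x => a * f x + g x) = fun x => a * cvl f x + cvl g x.
Proof.
by move=> cf cg; apply/funext => x; apply: quad_lin; exact: ucont_shift.
Qed.

End Functional.

(** Fubini's theorem for a kernel that is uniformly continuous in each
    variable, uniformly in the other one. *)
Lemma quad_fubini (L1 L2 : (G -> R[i]) -> R[i]) (H : G -> G -> R[i]) :
  quadrature L1 -> quadrature L2 ->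
  (forall e : R, 0 < e -> \forall u \near nbhs (0 : G), forall x y,
     nm (H (x + u) y - H x y) <= e) ->
  (forall e : R, 0 < e -> \forall u \near nbhs (0 : G), forall x y,
     nm (H x (y + u) - H x y) <= e) ->
  L1 (fun x => L2 (H x)) = L2 (fun y => L1 (fun x => H x y)).
Proof.
move=> q1 q2 c1 c2.
have cx x : ucont (H x).
  by move=> e e0; apply: filterS (c2 e e0) => u hu y; exact: hu.
have cy y : ucont (fun x => H x y).
  by move=> e e0; apply: filterS (c1 e e0) => u hu x; exact: hu.
have cL2 : ucont (fun x => L2 (H x)).
  move=> e e0; apply: filterS (c1 e e0) => u hu x; rewrite -(quadB q2) //.
  apply: (quad_le q2) => [|y]; [exact: ucontB|exact: hu].
have L1e u (e : R) : (forall x y, nm (H x (y + u) - H x y) <= e) ->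
    forall y, nm (L1 (H^~ (y + u)) - L1 (H^~ y)) <= e.
  move=> hu y; rewrite -(quadB q1) //.
  apply: (quad_le q1) => [|x]; [exact: ucontB|exact: hu].
have cL1 : ucont (fun y => L1 (H^~ y)).
  by move=> e e0; apply: filterS (c2 e e0) => u /L1e hu.
apply: nm_small_eq => e e0.
have e2 : 0 < e / 2 by rewrite divr_gt0.
have [s ws hs] := q2 _ (c2 _ e2).
have h2 := hs _ _ cL1 (fun u h => L1e _ _ h).
have h1 : nm (L1 (fun x => L2 (H x)) - L1 (fun x => qsum s (H x))) <= e / 2.
  have cq : ucont (fun x => qsum s (H x)).
    by apply: ucont_sum => p; exact: ucontZ.
  rewrite -(quadB q1) //; apply: (quad_le q1) => [|x]; first exact: ucontB.
  by apply: hs => // u hu y; exact: hu.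
have h3 : L1 (fun x => qsum s (H x)) = qsum s (fun y => L1 (H^~ y)).
  rewrite /qsum quad_sum // => [|p]; last exact: ucontZ.
  by apply: eq_bigr => p _; rewrite quadZ.
apply: (le_trans (nm_dist_tri (qsum s (fun y => L1 (H^~ y))) _ _)).
by rewrite [leRHS]splitr lerD // ?(nm_distC (qsum _ _)) // -h3.
Qed.

End Quadrature.

(** * Compactness of equicontinuous sequences *)

Section Ascoli.
Variables (R : realType) (G : topologicalZmodType).
Hypothesis compactG : compact [set: G].

Lemma ultra_lim_real (U : set_system nat) (a : nat -> R) (B : R) :
  UltraFilter U -> (forall n, `|a n| <= B) ->
  exists z, forall e : R, 0 < e -> U [set n | `|a n - z| <= e].
Proof.
move=> uU aB; have PF : ProperFilter (fmap a U).
  exact: fmap_proper_filter.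
have [|z [_ zc]] := @segment_compact R (- B) B (fmap a U) PF.
  rewrite /fmap /=; apply: (@filterS _ U _ setT) => [n _|]; last exact: filterT.
  by rewrite /= in_itv /= -ler_norml.
exists z => e e0.
have [//|nU] := in_ultra_setVsetC [set n | `|a n - z| <= e] uU.
have [] := zc (a @` ~` [set n | `|a n - z| <= e]) (ball z e).
- by rewrite /fmap /=; apply: filterS nU => n hn; exists n.
- exact: nbhsx_ballx.
- by move=> w [[n /= hn <-]]; rewrite -ball_normE /= distrC => /ltW /hn.
Qed.

Lemma ultra_lim (U : set_system nat) (a : nat -> R[i]) (B : R) :
  UltraFilter U -> (forall n, nm (a n) <= B) ->
  exists z, forall e : R, 0 < e -> U [set n | nm (a n - z) <= e].
Proof.
move=> uU aB.
have [x hx] := @ultra_lim_real U (fun n => complex.Re (a n)) B uU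
  (fun n => le_trans (nm_Re _) (aB n)).
have [y hy] := @ultra_lim_real U (fun n => complex.Im (a n)) B uU
  (fun n => le_trans (nm_Im _) (aB n)).
exists (x +i* y) => e e0; have e2 : 0 < e / 2 by rewrite divr_gt0.
apply: filterS (filterI (hx _ e2) (hy _ e2)) => n /= [h1 h2].
apply: (le_trans (nm_le_ReIm _)); rewrite ReB ImB /= [leRHS]splitr.
exact: lerD.
Qed.

(** Limits along one ultrafilter exist at every point simultaneously, and
    equicontinuity makes them uniform. *)
Lemma ascoli (f : nat -> G -> R[i]) (B : R) :
  (forall n x, nm (f n x) <= B) ->
  (forall e : R, 0 < e -> \forall u \near nbhs (0 : G), forall n x,
     nm (f n (x + u) - f n x) <= e) ->
  exists2 g, ucont g & forall (e : R) (N : nat), 0 < e ->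
    exists2 n, (N <= n)%N & forall x, nm (f n x - g x) <= e.
Proof.
move=> fB ef; have [U [uU oU]] := ultraFilterLemma eventually_filter.
have PU : ProperFilter U := ultra_proper.
have /choice[g hg] : forall x, exists z, forall e : R, 0 < e ->
    U [set n | nm (f n x - z) <= e].
  by move=> x; exact: (@ultra_lim U (fun n => f n x) B uU (fun n => fB n x)).
have gu (e : R) u : 0 < e -> (forall n x, nm (f n (x + u) - f n x) <= e) ->
    forall x, nm (g (x + u) - g x) <= e.
  move=> e0 hu x; apply/ler_addgt0Pr => d d0.
  have d2 : 0 < d / 2 by rewrite divr_gt0.
  have [n [/= h1 h2]] := filter_ex (filterI (hg (x + u) _ d2) (hg x _ d2)).
  have h3 := hu n x; rewrite nm_distC in h1.
  have h4 := nm_dist_tri (f n (x + u)) (g (x + u)) (g x).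
  have h5 := nm_dist_tri (f n x) (f n (x + u)) (g x).
  lra.
exists g.
  by move=> e e0; apply: filterS (ef e e0) => u hu; exact: gu.
move=> e N e0; have e3 : 0 < e / 3 by rewrite divr_gt0.
have [s hs] := fin_translates compactG (ef _ e3).
have hU : U [set n | (N <= n)%N /\ forall y, y \in s -> nm (f n y - g y) <= e / 3].
  have : U [set n | (N <= n)%N] by apply: oU; exists N.
  elim: s {hs} => [|y s IH] hN.
    by apply: filterS hN => n /= hn; split.
  apply: filterS (filterI (IH hN) (hg y _ e3)) => n /= [[Nn h] h'].
  by split=> // z; rewrite inE => /orP[/eqP ->|/h].
have [n [Nn hn]] := filter_ex hU.
exists n => // x; have [y ys hy] := hs x.
have h1 := hn y ys.
have h2 := hy n y; have h3 := gu _ _ e3 hy y.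
rewrite (addrC y) subrK in h2; rewrite (addrC y) subrK in h3.
rewrite nm_distC in h3.
have h4 := nm_dist_tri (f n y) (f n x) (g x).
have h5 := nm_dist_tri (g y) (f n y) (g x).
lra.
Qed.

End Ascoli.

(** * The inner product given by an invariant mean *)

Section InnerProduct.
Variables (R : realType) (G : topologicalZmodType).
Hypothesis compactG : compact [set: G].
Variable L : (G -> R[i]) -> R[i].
Hypothesis qL : quadrature L.
Implicit Types (f g h : G -> R[i]) (c : R[i]).

Definition ip f g := L (fun x => f x * cj (g x)).

Definition sqnorm f : R := complex.Re (ip f f).

Let cip f g : ucont f -> ucont g -> ucont (fun x => f x * cj (g x)).
Proof. by move=> cf cg; apply: ucontM => //; exact: ucont_cj. Qed.

Lemma ip_cj f g : ucont f -> ucont g -> ip g f = cj (ip f g).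
Proof.
move=> cf cg; rewrite /ip -(quad_cj qL); last exact: cip.
by congr L; apply/funext => x; rewrite cjM cjK mulrC.
Qed.

Lemma ipZ c f g : ucont f -> ucont g -> ip (fun x => c * f x) g = c * ip f g.
Proof.
move=> cf cg; rewrite /ip -(quadZ qL); last exact: cip.
by congr L; apply/funext => x; rewrite mulrA.
Qed.

Lemma ipB f g h : ucont f -> ucont g -> ucont h ->
  ip (fun x => f x - g x) h = ip f h - ip g h.
Proof.
move=> cf cg ch; rewrite /ip -(quadB qL); [|exact: cip|exact: cip].
by congr L; apply/funext => x; rewrite mulrBl.
Qed.

Lemma ipBr f g h : ucont f -> ucont g -> ucont h ->
  ip h (fun x => f x - g x) = ip h f - ip h g.
Proof.
move=> cf cg ch; rewrite ip_cj ?ipB //; last exact: ucontB.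
by rewrite cjB -!ip_cj.
Qed.

Lemma ipZr c f g : ucont f -> ucont g -> ip f (fun x => c * g x) = cj c * ip f g.
Proof.
move=> cf cg; rewrite ip_cj ?ipZ //; last exact: ucontZ.
by rewrite cjM -ip_cj.
Qed.

Lemma ip_sum (I : Type) (s : seq I) (F : I -> G -> R[i]) h :
  (forall i, ucont (F i)) -> ucont h ->
  ip (fun x => \sum_(i <- s) F i x) h = \sum_(i <- s) ip (F i) h.
Proof.
move=> cF ch; rewrite /ip -(quad_sum qL); last by move=> i; exact: cip.
by congr L; apply/funext => x; rewrite mulr_suml.
Qed.

Lemma ip_ge0 f : ucont f -> 0 <= ip f f.
Proof. by move=> cf; apply: (quad_ge0 qL) => [|x]; [exact: cip|exact: mul_cj_ge0]. Qed.

Lemma ip_sqnorm f : ucont f -> ip f f = (sqnorm f)%:C.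
Proof. by move=> cf; rewrite [LHS]complexEE (ger0_Im (ip_ge0 cf)). Qed.

Lemma sqnorm_ge0 f : ucont f -> 0 <= sqnorm f.
Proof. by move=> cf; rewrite -ler0c -ip_sqnorm // ip_ge0. Qed.

Lemma sqnormZ c f : ucont f -> sqnorm (fun x => c * f x) = nm c ^+ 2 * sqnorm f.
Proof.
move=> cf; rewrite /sqnorm ipZ ?ipZr //; last exact: ucontZ.
by rewrite mulrA mul_cj ReZ.
Qed.

Lemma sqnormB f g : ucont f -> ucont g ->
  sqnorm (fun x => f x - g x) = sqnorm f - 2 * complex.Re (ip f g) + sqnorm g.
Proof.
move=> cf cg; have cfg := ucontB cf cg.
rewrite /sqnorm ipB // !ipBr // !ReB (ip_cj cf cg).
have -> : complex.Re (cj (ip f g)) = complex.Re (ip f g) by rewrite Re_cj.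
ring.
Qed.

Lemma sqnorm_le f (b : R) : ucont f -> (forall x, nm (f x) <= b) -> sqnorm f <= b ^+ 2.
Proof.
move=> cf fb; apply: (le_trans (ler_norm _)); apply: (le_trans (nm_Re _)).
apply: (quad_le qL) => [|x]; first exact: cip.
by rewrite nmM nm_cj expr2; apply: ler_pM; rewrite ?nm_ge0.
Qed.

Lemma cauchy_schwarz f g : ucont f -> ucont g ->
  nm (ip f g) ^+ 2 <= sqnorm f * sqnorm g.
Proof.
move=> cf cg; set a := nm (ip f g) ^+ 2.
have key (t : R) : 0 <= sqnorm f - 2 * t * a + t ^+ 2 * a * sqnorm g.
  have ct := ucontZ (t%:C * ip f g) cg.
  have := sqnorm_ge0 (ucontB cf ct); rewrite sqnormB // sqnormZ // ipZr // cjM cj_real.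
  rewrite -(mulrA t%:C) (mulrC (cj (ip f g))) mul_cj -/a -rmorphM nmM nm_real.
  by rewrite exprMn real_normK ?num_real // -/a mulrA.
have a0 : 0 <= a by rewrite exprn_ge0 // nm_ge0.
have := sqnorm_ge0 cg; rewrite le_eqVlt => /orP[/eqP g0|g0].
  rewrite -g0 mulr0; rewrite leNgt; apply/negP => ap.
  have := key ((sqnorm f + 1) / (2 * a)); rewrite -g0 mulr0 addr0.
  have -> : 2 * ((sqnorm f + 1) / (2 * a)) * a = sqnorm f + 1.
    by field; rewrite gt_eqF.
  lra.
have := key (sqnorm g)^-1.
have -> : sqnorm f - 2 * (sqnorm g)^-1 * a + (sqnorm g)^-1 ^+ 2 * a * sqnorm g
  = sqnorm f - a / sqnorm g by field; rewrite gt_eqF.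
by rewrite subr_ge0 ler_pdivrMr.
Qed.

Definition orthonormal n (e : 'I_n -> G -> R[i]) :=
  (forall i, ucont (e i)) /\ forall i j, ip (e i) (e j) = (i == j)%:R.

Definition proj n (e : 'I_n -> G -> R[i]) f : G -> R[i] :=
  fun x => \sum_i ip f (e i) * e i x.

Lemma proj_ucont n (e : 'I_n -> G -> R[i]) f : (forall i, ucont (e i)) ->
  ucont (proj e f).
Proof. by move=> ce; apply: ucont_sum => i; exact: ucontZ. Qed.

Lemma ip_proj n (e : 'I_n -> G -> R[i]) f j : orthonormal e -> ucont f ->
  ip (proj e f) (e j) = ip f (e j).
Proof.
move=> [ce oe] cf; rewrite ip_sum //; last by move=> i; exact: ucontZ.
rewrite (bigD1 j) //= ipZ // oe eqxx mulr1 big1 ?addr0 // => i ij.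
by rewrite ipZ // oe (negbTE ij) mulr0.
Qed.

Lemma sqnorm_proj n (e : 'I_n -> G -> R[i]) f : orthonormal e -> ucont f ->
  sqnorm (fun x => f x - proj e f x) = sqnorm f - \sum_i nm (ip f (e i)) ^+ 2.
Proof.
move=> oe cf; have [ce _] := oe; have cp := proj_ucont f ce.
have ipp h : ucont h -> (forall i, ip h (e i) = ip f (e i)) ->
    ip (proj e f) h = (\sum_i nm (ip f (e i)) ^+ 2)%:C.
  move=> ch hh; rewrite ip_sum //; last by move=> i; exact: ucontZ.
  rewrite rmorph_sum; apply: eq_bigr => i _ /=.
  by rewrite ipZ // (ip_cj ch) // hh mul_cj.
have p1 := ipp f cf (fun i => erefl).
have p2 : sqnorm (proj e f) = \sum_i nm (ip f (e i)) ^+ 2.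
  by rewrite /sqnorm ipp // => i; rewrite ip_proj.
by rewrite sqnormB // p2 ip_cj // p1 cj_real /=; ring.
Qed.

Lemma bessel n (e : 'I_n -> G -> R[i]) f : orthonormal e -> ucont f ->
  \sum_i nm (ip f (e i)) ^+ 2 <= sqnorm f.
Proof.
move=> oe cf; rewrite -subr_ge0 -sqnorm_proj // sqnorm_ge0 //.
by apply: ucontB => //; apply: proj_ucont; case: oe.
Qed.

End InnerProduct.

(** * Convolution operators and the existence of characters *)

Definition character (R : realType) (G : topologicalZmodType) (g : G -> R[i]) :=
  [/\ ucont g, forall x y, g (x + y) = g x * g y & forall x, nm (g x) = 1].

Section Character.
Variables (R : realType) (G : topologicalZmodType).
Implicit Types (g : G -> R[i]).

Lemma char0 g : character g -> g 0 = 1.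
Proof.
case=> _ gM g1; have h := gM 0 0; rewrite addr0 in h.
have g0 : g 0 != 0.
  by apply/eqP => g0; have := g1 0; rewrite g0 nm0 => /eqP; rewrite eq_sym oner_eq0.
by apply: (mulIf g0); rewrite mul1r -h.
Qed.

Lemma charN g x : character g -> g (- x) = cj (g x).
Proof.
move=> cg; have [_ gM g1] := cg.
have gx0 : g x != 0.
  by apply/eqP => g0; have := g1 x; rewrite g0 nm0 => /eqP; rewrite eq_sym oner_eq0.
by apply: (mulfI gx0); rewrite -gM subrr char0 // mul_cj g1 expr1n.
Qed.

End Character.

Section Kernel.
Variables (R : realType) (G : topologicalZmodType).
Hypothesis compactG : compact [set: G].
Variable L : (G -> R[i]) -> R[i].
Hypothesis qL : quadrature L.
Hypothesis invL : forall f a, ucont f -> L (fun x => f (a + x)) = L f.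
Implicit Types (f g h k : G -> R[i]).

Local Notation ip := (ip L).
Local Notation sqnorm := (sqnorm L).

(** Convolution with the density [k]; for hermitian [k] a compact self-adjoint
    operator, diagonalized by characters. *)
Definition kop k f : G -> R[i] := fun x => L (fun y => k (x - y) * f y).

Definition hermitian k := forall x, k (- x) = cj (k x).

Lemma kop_ip k f x : kop k f x = ip f (fun y => cj (k (x - y))).
Proof. by congr L; apply/funext => y; rewrite cjK mulrC. Qed.

Section Operator.
Variable k : G -> R[i].
Hypothesis ck : ucont k.

Let ckx x : ucont (fun y => k (x - y)). Proof. exact: ucont_refl. Qed.

Let ckf f x : ucont f -> ucont (fun y => k (x - y) * f y).
Proof. by move=> cf; apply: ucontM. Qed.

Lemma kop_ucont f : ucont f -> ucont (kop k f).
Proof.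
move=> cf e e0; have [B B0 fB] := ucont_bounded compactG cf.
have eB : 0 < e / B by rewrite divr_gt0.
apply: filterS (ck eB) => u hu x; rewrite /kop -(quadB qL) //; try exact: ckf.
apply: (quad_le qL) => [|y]; first by apply: ucontB; exact: ckf.
rewrite -mulrBl; apply: (nmM_le B0) => //; rewrite addrAC; exact: hu.
Qed.

Lemma kop_lin c f g : ucont f -> ucont g ->
  kop k (fun x => c * f x + g x) = fun x => c * kop k f x + kop k g x.
Proof.
move=> cf cg; apply/funext => x; rewrite /kop -(quad_lin qL); try exact: ckf.
by congr L; apply/funext => y; rewrite mulrDr mulrCA.
Qed.

Lemma kopB f g : ucont f -> ucont g ->
  kop k (fun x => f x - g x) = fun x => kop k f x - kop k g x.
Proof.
move=> cf cg; apply/funext => x; rewrite /kop -(quadB qL); try exact: ckf.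
by congr L; apply/funext => y; rewrite mulrBr.
Qed.

Lemma kopZ c f : ucont f -> kop k (fun x => c * f x) = fun x => c * kop k f x.
Proof.
move=> cf; apply/funext => x; rewrite /kop -(quadZ qL); try exact: ckf.
by congr L; apply/funext => y; rewrite mulrCA.
Qed.

Lemma kop_shift f a : ucont f ->
  kop k (fun x => f (a + x)) = fun x => kop k f (a + x).
Proof.
move=> cf; apply/funext => x; rewrite /kop -[RHS](invL a); last exact: ckf.
by congr L; apply/funext => y; congr (k _ * _); rewrite opprD addrACA subrr add0r.
Qed.

(** A kernel operator maps the quadratic norm to the uniform norm. *)
Lemma kop_sup B f x : ucont f -> (forall y, nm (k y) <= B) ->
  nm (kop k f x) ^+ 2 <= B ^+ 2 * sqnorm f.
Proof.
move=> cf kB; have ckc : ucont (fun y => cj (k (x - y))) by exact: ucont_cj.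
rewrite kop_ip; apply: (le_trans (cauchy_schwarz compactG qL cf ckc)).
rewrite mulrC ler_wpM2r ?(sqnorm_ge0 compactG qL) //.
by apply: (sqnorm_le compactG qL) => // y; rewrite nm_cj.
Qed.

Lemma kop_sqnorm B f : ucont f -> (forall y, nm (k y) <= B) ->
  sqnorm (kop k f) <= B ^+ 2 * sqnorm f.
Proof.
move=> cf kB; have s0 := sqnorm_ge0 compactG qL cf.
have B0 : 0 <= B by apply: le_trans (kB 0); exact: nm_ge0.
rewrite -[B ^+ 2 * sqnorm f]sqr_sqrtr; last by rewrite mulr_ge0 ?exprn_ge0.
apply: (sqnorm_le compactG qL) => [|x]; first exact: kop_ucont.
by rewrite -[leLHS]ger0_norm ?nm_ge0 // -sqrtr_sqr ler_wsqrtr // kop_sup.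
Qed.

Hypothesis hk : hermitian k.

(** Fubini's theorem for the kernel [k (x - y) * f y * cj (g x)]. *)
Lemma kop_selfadj f g : ucont f -> ucont g -> ip (kop k f) g = ip f (kop k g).
Proof.
move=> cf cg.
have [A A0 fA] := ucont_bounded compactG cf.
have [B B0 gB] := ucont_bounded compactG cg.
have [D D0 kD] := ucont_bounded compactG ck.
pose H x y := k (x - y) * f y * cj (g x).
have bnd (e : R) : 0 < e -> \forall u \near nbhs (0 : G),
    (forall x, nm (k (x + u) - k x) <= e) /\ (forall x, nm (k (x - u) - k x) <= e).
  move=> e0; apply: filterI; first exact: ck.
  exact: (opp_nbhs0 (ck e0)).
have -> : ip (kop k f) g = L (fun x => L (H x)).
  congr L; apply/funext => x; rewrite /kop mulrC -(quadZ qL); last exact: ckf.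
  by congr L; apply/funext => y; rewrite mulrC.
have -> : ip f (kop k g) = L (fun y => L (fun x => H x y)).
  congr L; apply/funext => y; rewrite /kop -(quad_cj qL); last exact: ckf.
  rewrite -(quadZ qL); last by apply: ucont_cj; exact: ckf.
  congr L; apply/funext => x; rewrite /H cjM -hk opprB; ring.
apply: (quad_fubini qL qL) => e e0.
  have e2 : 0 < e / 2 by rewrite divr_gt0.
  have e3 : 0 < e / 2 / (A * B) by rewrite divr_gt0 // mulr_gt0.
  have e4 : 0 < e / 2 / (D * A) by rewrite divr_gt0 // mulr_gt0.
  apply: filterS (filterI (bnd _ e3) (cg _ e4)) => u [[hu _] hg] x y.
  rewrite /H; have -> : k (x + u - y) * f y * cj (g (x + u)) - k (x - y) * f y * cj (g x)
    = (k (x + u - y) - k (x - y)) * (f y * cj (g x))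
      + (k (x + u - y) * f y) * cj (g (x + u) - g x).
    by rewrite cjB; ring.
  apply: (le_trans (nmD _ _)); rewrite [leRHS]splitr.
  have h1 := hu (x - y); rewrite addrAC in h1.
  apply: lerD.
    apply: (nmM_le (mulr_gt0 A0 B0)) => //.
    by apply: nmM_le2 => //; rewrite nm_cj.
  rewrite mulrC; apply: (nmM_le (mulr_gt0 D0 A0)); first by rewrite nm_cj.
  exact: nmM_le2.
have e2 : 0 < e / 2 by rewrite divr_gt0.
have e3 : 0 < e / 2 / (A * B) by rewrite divr_gt0 // mulr_gt0.
have e4 : 0 < e / 2 / (D * B) by rewrite divr_gt0 // mulr_gt0.
apply: filterS (filterI (bnd _ e3) (cf _ e4)) => u [[_ hu] hf] x y.
rewrite /H; have -> : k (x - (y + u)) * f (y + u) * cj (g x) - k (x - y) * f y * cj (g x)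
  = (k (x - y - u) - k (x - y)) * (f y * cj (g x))
    + (k (x - y - u) * cj (g x)) * (f (y + u) - f y).
  by rewrite opprD addrA; ring.
apply: (le_trans (nmD _ _)); rewrite [leRHS]splitr.
have h1 := hu (x - y).
apply: lerD.
  apply: (nmM_le (mulr_gt0 A0 B0)) => //.
  by apply: nmM_le2 => //; rewrite nm_cj.
rewrite mulrC; apply: (nmM_le (mulr_gt0 D0 B0)) => //.
by apply: nmM_le2 => //; rewrite nm_cj.
Qed.

Lemma kop_char g : character g -> kop k g = fun x => cj (ip k g) * g x.
Proof.
move=> cg; have [ug gM _] := cg; apply/funext => x.
rewrite /kop -(invL x); last exact: ckf.
rewrite mulrC /ip -(quad_cj qL); last by apply: ucontM => //; exact: ucont_cj.
rewrite -(quadZ qL); last by apply: ucont_cj; apply: ucontM => //; exact: ucont_cj.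
congr L; apply/funext => y; rewrite opprD addrA subrr sub0r hk gM cjM cjK; ring.
Qed.

Lemma ip_char g : character g -> ip g g = 1.
Proof.
case=> ug _ g1; rewrite /ip -[RHS](quad_cst qL 1); congr L.
by apply/funext => x; rewrite mul_cj g1 expr1n.
Qed.

Lemma khat_real g : character g -> cj (ip k g) = ip k g.
Proof.
move=> cg; have [ug _ _] := cg; have := kop_selfadj ug ug.
rewrite kop_char // (ipZ compactG qL) // (ipZr compactG qL) // ip_char //.
by rewrite !mulr1 cjK.
Qed.

End Operator.
End Kernel.

Section TopEigenfunction.
Variables (R : realType) (G : topologicalZmodType).
Hypothesis compactG : compact [set: G].
Variable L : (G -> R[i]) -> R[i].
Hypothesis qL : quadrature L.
Hypothesis invL : forall f a, ucont f -> L (fun x => f (a + x)) = L f.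
Variable k : G -> R[i].
Hypotheses (ck : ucont k) (hk : hermitian k).
Implicit Types (f g h : G -> R[i]).

Local Notation ip := (ip L).
Local Notation sqnorm := (sqnorm L).
Local Notation K := (kop L k).

Let cK f : ucont f -> ucont (K f). Proof. exact: kop_ucont. Qed.

(** If a hermitian convolution operator has norm larger than [d], its square has
    an eigenvalue [S > d ^+ 2]: the supremum of [sqnorm (K f)] over the unit ball.
    The images of a maximizing sequence under the square are equicontinuous and
    have a limit point, which is an eigenfunction. *)
Lemma top_eigenfunction (d : R) f0 : 0 <= d -> ucont f0 ->
  d ^+ 2 * sqnorm f0 < sqnorm (K f0) ->
  exists S, [/\ d ^+ 2 < S & exists g, [/\ ucont g, exists x, g x != 0 &
    forall x, K (K g) x = S%:C * g x]].
Proof.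
move=> d0 cf0 f0d.
have [B B0 kB] := ucont_bounded compactG ck.
have sq0 f : ucont f -> 0 <= sqnorm f by move=> cf; exact: sqnorm_ge0.
have Ksq f : ucont f -> sqnorm (K f) <= B ^+ 2 * sqnorm f by move=> cf; exact: kop_sqnorm.
have Ksup f x : ucont f -> nm (K f x) ^+ 2 <= B ^+ 2 * sqnorm f.
  by move=> cf; exact: kop_sup.
have Kle f b x : ucont f -> (forall y, nm (f y) <= b) -> nm (K f x) <= B * b.
  move=> cf fb; apply: (quad_le qL) => [|y].
    by apply: ucontM => //; exact: ucont_refl.
  exact: nmM_le2.
have KZ c f : ucont f -> K (fun x => c * f x) = fun x => c * K f x.
  by move=> cf; exact: kopZ.
have KB f g : ucont f -> ucont g -> K (fun x => f x - g x) = fun x => K f x - K g x.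
  by move=> cf cg; exact: kopB.
pose E := [set s | exists f, [/\ ucont f, sqnorm f <= 1 & s = sqnorm (K f)]].
have E0 : has_sup E.
  split.
    exists (sqnorm (K (fun=> 0))), (fun=> 0); split => //; first exact: ucont_cst.
    have := @sqnorm_le _ _ compactG L qL (fun=> 0) 1 (@ucont_cst R G 0).
    by rewrite expr1n; apply => _; rewrite nm0.
  exists (B ^+ 2) => _ [f [cf f1 ->]]; apply: (le_trans (Ksq f cf)).
  by rewrite ler_piMr // exprn_ge0 // ltW.
set S := sup E.
have normalize f : ucont f -> 0 < sqnorm f -> sqnorm (K f) <= S * sqnorm f.
  move=> cf fpos; pose c := (Num.sqrt (sqnorm f))^-1.
  have c2 : c ^+ 2 = (sqnorm f)^-1 by rewrite /c exprVn sqr_sqrtr // ltW.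
  have cc : nm c%:C ^+ 2 = (sqnorm f)^-1 by rewrite nm_real real_normK ?num_real.
  rewrite -ler_pdivrMr //; apply: (ub_le_sup E0.2).
  exists (fun x => c%:C * f x); split; first exact: ucontZ.
    by rewrite (sqnormZ compactG qL) // cc mulVf ?gt_eqF.
  by rewrite KZ // (sqnormZ compactG qL) ?cc 1?mulrC //; exact: cK.
have KS f : ucont f -> sqnorm (K f) <= S * sqnorm f.
  move=> cf; have := sq0 f cf; rewrite le_eqVlt => /orP[/eqP f00|]; last exact: normalize.
  by rewrite -f00 mulr0; have := Ksq f cf; rewrite -f00 mulr0.
have dS : d ^+ 2 < S.
  have f00 : 0 < sqnorm f0.
    rewrite lt_neqAle sq0 // andbT; apply/eqP => h.
    by move: f0d; rewrite -h mulr0 ltNge; have := Ksq f0 cf0; rewrite -h mulr0 => ->.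
  by rewrite -(ltr_pM2r f00); apply: (lt_le_trans f0d); exact: KS.
have S0 : 0 < S by apply: le_lt_trans dS; rewrite exprn_ge0.
exists S; split => //.
have /choice[f hf] : forall n : nat, exists f, [/\ ucont f, sqnorm f <= 1 &
    S - n.+1%:R^-1 < sqnorm (K f)].
  move=> n; have n0 : 0 < (n.+1%:R)^-1 :> R by rewrite invr_gt0.
  by have [_ [f [cf f1 ->]] hs] := sup_adherent n0 E0; exists f.
pose psi n := K (K (f n)).
have cf n : ucont (f n) by case: (hf n).
have f1 n : sqnorm (f n) <= 1 by case: (hf n).
have fS n : S - n.+1%:R^-1 < sqnorm (K (f n)) by case: (hf n).
have cpsi n : ucont (psi n) by apply: cK; exact: cK.
have Kf_sq n : sqnorm (K (f n)) <= B ^+ 2.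
  by apply: (le_trans (Ksq _ (cf n))); rewrite ler_piMr // exprn_ge0 // ltW.
have Kf_sup n x : nm (K (f n) x) <= B.
  have h : nm (K (f n) x) ^+ 2 <= B ^+ 2.
    by apply: (le_trans (Ksup _ x (cf n))); rewrite ler_piMr // exprn_ge0 // ltW.
  by move: h; rewrite ler_pXn2r // nnegrE ?nm_ge0 // ltW.
have [g cg hg] : exists2 g, ucont g & forall (e : R) (N : nat), 0 < e ->
    exists2 n, (N <= n)%N & forall x, nm (psi n x - g x) <= e.
  apply: (@ascoli R G compactG psi (B * B)) => [n x|e e0].
    by apply: Kle => //; exact: cK.
  have eB : 0 < e / B by rewrite divr_gt0.
  apply: filterS (ck eB) => u hu n x; rewrite /psi /kop.
  rewrite -(quadB qL); try by apply: ucontM; [|exact: ucont_refl|exact: cK].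
  apply: (quad_le qL) => [|y].
    by apply: ucontB; apply: ucontM => //; by [exact: ucont_refl|exact: cK].
  by rewrite -mulrBl; apply: (nmM_le B0); [rewrite addrAC; exact: hu|exact: Kf_sup].
(* Expanding the square, the defect is at most S ^+ 2 - S * sqnorm (K (f n)), so the
   square of the operator nearly acts as the scalar S on a near-maximizer. *)
have defect n : sqnorm (fun x => psi n x - S%:C * f n x) <= S / n.+1%:R.
  rewrite (sqnormB compactG qL) //; last exact: ucontZ.
  rewrite (ipZr compactG qL) // cj_real ReZ (sqnormZ compactG qL) // nm_real gtr0_norm //.
  rewrite {2}/psi (kop_selfadj compactG qL ck hk) //; last exact: cK.
  have h1 := KS _ (cK (cf n)); have h2 := fS n; have h3 := f1 n.
  rewrite -[complex.Re _]/(sqnorm (K (f n))) -[sqnorm (psi n)]/(sqnorm (K (K (f n)))).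
  have h4 : S ^+ 2 * sqnorm (f n) <= S ^+ 2 by rewrite ler_piMr // exprn_ge0 // ltW.
  have h5 : S * (S - n.+1%:R^-1) <= S * sqnorm (K (f n)) by rewrite ler_pM2l // ltW.
  move: (sqnorm (K (K (f n)))) (sqnorm (K (f n))) (sqnorm (f n)) (n.+1%:R^-1) h1 h4 h5 => a b c i h1 h4 h5. lra.
have eig x : K (K g) x = S%:C * g x.
  apply: nm_small_eq => e e0.
  pose C := B * B + S + 1.
  have BB0 : 0 <= B * B by rewrite mulr_ge0 // ltW.
  have C0 : 0 < C by rewrite /C; lra.
  have eC : 0 < e / 2 / C by rewrite !divr_gt0.
  pose N := Num.bound (B ^+ 2 * S * S / (e / 2) ^+ 2).
  have [n Nn hn] := hg (e / 2 / C) N eC.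
  pose r := fun y => psi n y - S%:C * f n y.
  have cr : ucont r by apply: ucontB => //; exact: ucontZ.
  have h1 : nm (K (K (psi n)) x - S%:C * psi n x) <= e / 2.
    have -> : K (K (psi n)) x - S%:C * psi n x = K (K r) x.
      rewrite /r KB //; last exact: ucontZ.
      rewrite KB; [|exact: cK|by apply: cK; exact: ucontZ].
      rewrite KZ // KZ //; exact: cK.
    have h2 : nm (K (K r) x) ^+ 2 <= (e / 2) ^+ 2.
      apply: (le_trans (Ksup _ x (cK cr))).
      have h3 := le_trans (KS _ cr) (ler_wpM2l (ltW S0) (defect n)).
      apply: (le_trans (ler_wpM2l (exprn_ge0 2 (ltW B0)) h3)).
      have e2 : 0 < (e / 2) ^+ 2 by rewrite exprn_gt0 // divr_gt0.
      rewrite !mulrA ler_pdivrMr // [leRHS]mulrC -ler_pdivrMr //.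
      apply: le_trans (ltW (archi_boundP _)) _.
        by rewrite divr_ge0 ?ltW // !mulr_gt0 // exprn_gt0.
      by rewrite ler_nat; apply: leq_trans Nn _.
    move: h2; rewrite ler_pXn2r // nnegrE ?nm_ge0 //.
    by rewrite divr_ge0 // ltW.
  have cd : ucont (fun y => g y - psi n y) by exact: ucontB.
  have h2 : nm (K (K g) x - K (K (psi n)) x) <= B * (B * (e / 2 / C)).
    have -> : K (K g) x - K (K (psi n)) x = K (K (fun y => g y - psi n y)) x.
      by rewrite KB // KB //; exact: cK.
    by apply: (Kle) => [|y]; [exact: cK|apply: (Kle) => // z; rewrite nm_distC].
  have h3 : nm (S%:C * psi n x - S%:C * g x) <= S * (e / 2 / C).
    rewrite -mulrBr nmM nm_real gtr0_norm // ler_pM2l //.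
  have h4 := nm_dist_tri (K (K (psi n)) x) (K (K g) x) (S%:C * g x).
  have h5 := nm_dist_tri (S%:C * psi n x) (K (K (psi n)) x) (S%:C * g x).
  have h6 : B * (B * (e / 2 / C)) + S * (e / 2 / C) <= e / 2.
    rewrite mulrA -mulrDl -[leRHS](divfK (lt0r_neq0 C0)) mulrC.
    by rewrite ler_pM2l // /C; lra.
  lra.
exists g; split => //.
(* The limit does not vanish: the pairing of psi n with f n is sqnorm (K (f n)),
   which tends to S. *)
apply: contrapT => /forallNP g0.
have gz x : g x = 0 by apply/eqP/negbNE/negP; exact: g0.
have S4 : 0 < S / 4 by rewrite divr_gt0.
have [n Nn hn] := hg (S / 4) (Num.bound (2 / S)) S4.
have pn x : nm (psi n x) <= S / 4 by have := hn x; rewrite gz subr0.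
have h1 : n.+1%:R^-1 <= S / 2.
  rewrite -[S / 2]invrK lef_pV2 ?posrE ?invr_gt0 ?divr_gt0 //.
  rewrite invf_div; apply: le_trans (ltW (archi_boundP _)) _.
    by rewrite divr_ge0 // ltW.
  by rewrite ler_nat; apply: leq_trans Nn _.
have h2 := cauchy_schwarz compactG qL (cpsi n) (cf n).
have h3 : sqnorm (psi n) <= (S / 4) ^+ 2 by exact: sqnorm_le.
have h4 : nm (ip (psi n) (f n)) ^+ 2 <= (S / 4) ^+ 2.
  apply: (le_trans h2); apply: (le_trans _ h3).
  by rewrite ler_piMr // sq0.
have h5 : nm (ip (psi n) (f n)) <= S / 4.
  by move: h4; rewrite ler_pXn2r // nnegrE ?nm_ge0 // ltW.
have h6 := le_trans (ler_norm _) (le_trans (nm_Re _) h5).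
move: h6; rewrite /psi (kop_selfadj compactG qL ck hk) //; last exact: cK.
rewrite -[complex.Re _]/(sqnorm (K (f n))) => h6.
move: (n.+1%:R^-1) (sqnorm (K (f n))) h1 h6 (fS n) => i a h1 h6 h7; lra.
Qed.

End TopEigenfunction.

Section Eigenspace.
Variables (R : realType) (G : topologicalZmodType).
Hypothesis compactG : compact [set: G].
Variable L : (G -> R[i]) -> R[i].
Hypothesis qL : quadrature L.
Hypothesis invL : forall f a, ucont f -> L (fun x => f (a + x)) = L f.
Variable k : G -> R[i].
Hypotheses (ck : ucont k) (hk : hermitian k).
Variable S : R.
Hypothesis S0 : 0 < S.
Implicit Types (f g h : G -> R[i]).

Local Notation ip := (ip L).
Local Notation sqnorm := (sqnorm L).
Local Notation K := (kop L k).

Let cK f : ucont f -> ucont (K f). Proof. exact: kop_ucont. Qed.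

Definition eigenfun g := ucont g /\ forall x, K (K g) x = S%:C * g x.

(** Non-zero translation-invariant subspaces of the eigenspace; the closure
    property under [a * f + g] gives all linear combinations. *)
Definition inv_subspace (V : set (G -> R[i])) :=
  [/\ forall f, V f -> eigenfun f,
      forall a f g, V f -> V g -> V (fun x => a * f x + g x),
      forall a f, V f -> V (fun x => f (a + x)) &
      exists f x, V f /\ f x != 0].

Definition has_orthonormal n (V : set (G -> R[i])) :=
  exists2 e : 'I_n -> G -> R[i], orthonormal L e & forall i, V (e i).

(** Bessel's inequality for the kernel bounds the values of an orthonormal
    family of eigenfunctions, hence, by integration, its size. *)
Lemma eigen_dim : exists N, ~ has_orthonormal N eigenfun.
Proof.
have [B B0 kB] := ucont_bounded compactG ck.
pose C := (B ^+ 2) ^+ 2 / S ^+ 2.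
exists (Num.bound C) => -[e oe eV]; have [ce oee] := oe.
have S2 : 0 < S ^+ 2 by rewrite exprn_gt0.
have pt x : \sum_i nm (e i x) ^+ 2 <= C.
  pose h y := cj (k (x - y)).
  have ch : ucont h by apply: ucont_cj; exact: ucont_refl.
  rewrite ler_pdivlMr // mulr_suml.
  have -> : \sum_i nm (e i x) ^+ 2 * S ^+ 2 = \sum_i nm (ip (K h) (e i)) ^+ 2.
    apply: eq_bigr => i _; rewrite (ip_cj compactG qL) ?nm_cj; [|exact: ce|exact: cK].
    rewrite -(kop_selfadj compactG qL ck hk) //.
    rewrite -[ip _ _]/(ip (K (e i)) (fun y => cj (k (x - y)))) -kop_ip.
    by rewrite (eV i).2 nmM nm_real exprMn gtr0_norm // mulrC.
  apply: (le_trans (bessel compactG qL oe (cK ch))).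
  apply: (le_trans (kop_sqnorm compactG qL ck ch kB)).
  rewrite [leRHS]expr2; apply: ler_wpM2l; first by rewrite exprn_ge0 // ltW.
  by apply: (sqnorm_le compactG qL ch) => y; rewrite nm_cj.
have cee i : ucont (fun x => e i x * cj (e i x)).
  by apply: ucontM => //; exact: ucont_cj.
have : nm (L (fun x => \sum_i e i x * cj (e i x))) <= C.
  apply: (quad_le qL) => [|x]; first exact: ucont_sum.
  have -> : \sum_i e i x * cj (e i x) = (\sum_i nm (e i x) ^+ 2)%:C.
    by rewrite rmorph_sum; apply: eq_bigr => i _; rewrite mul_cj.
  rewrite nm_real ger0_norm // sumr_ge0 // => i _.
  by rewrite exprn_ge0 // nm_ge0.
rewrite (quad_sum qL) //.
have -> : \sum_(i < Num.bound C) L (fun x => e i x * cj (e i x))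
    = ((Num.bound C)%:R : R)%:C.
  rewrite (eq_bigr (fun=> 1)) => [|i _].
    by rewrite sumr_const card_ord rmorph_nat.
  by have := oee i i; rewrite eqxx.
rewrite nm_real ger0_norm // => /le_lt_trans/(_ (archi_boundP _)).
rewrite ltxx => /(_ _) h; apply: notF; apply: h.
by rewrite divr_ge0 ?exprn_ge0 // ltW.
Qed.

(** The residual of the projection would otherwise extend the family: an
    eigenfunction of norm zero vanishes, because the operator smooths. *)
Lemma orthonormal_span n (V : set (G -> R[i])) (e : 'I_n -> G -> R[i]) g :
  inv_subspace V -> orthonormal L e -> (forall i, V (e i)) ->
  ~ has_orthonormal n.+1 V -> V g -> g = proj L e g.
Proof.
move=> [Veig Vlin _ _] oe eV maxn Vg; have [ce oee] := oe.
have [cg _] := Veig _ Vg.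
pose r x := g x - proj L e g x.
have Vr : V r.
  have V0 : V (fun=> 0).
    by have := Vlin (-1) g g Vg Vg; congr V; apply/funext => x; rewrite mulN1r addNr.
  have Vs (s : seq 'I_n) : V (fun x => \sum_(i <- s) ip g (e i) * e i x).
    elim: s => [|i s IH].
      by move: V0; congr V; apply/funext => x; rewrite big_nil.
    have := Vlin (ip g (e i)) _ _ (eV i) IH; congr V.
    by apply/funext => x; rewrite big_cons.
  have := Vlin (-1) _ _ (Vs (index_enum 'I_n)) Vg; congr V.
  by apply/funext => x; rewrite /r mulN1r addrC.
have [cr Kr] := Veig _ Vr.
have [B B0 kB] := ucont_bounded compactG ck.
have := sqnorm_ge0 compactG qL cr; rewrite le_eqVlt => /orP[/eqP r0|r0].
  have rz x : r x = 0.
    have h1 := kop_sup compactG qL ck x (cK cr) kB.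
    have h2 := kop_sqnorm compactG qL ck cr kB; rewrite -r0 mulr0 in h2.
    have : nm (K (K r) x) ^+ 2 == 0.
      rewrite eq_le exprn_ge0 ?nm_ge0 // andbT.
      by apply: (le_trans h1); rewrite mulr_ge0_le0 // exprn_ge0 // ltW.
    rewrite expf_eq0 /= => /eqP/nm_eq0; rewrite Kr => /eqP; rewrite mulf_eq0 => /orP[|/eqP //].
    by rewrite (inj_eq (@complexI R)) gt_eqF.
  by apply/funext => x; apply/eqP; rewrite -subr_eq0; apply/eqP; exact: rz.
case: maxn; pose c := (Num.sqrt (sqnorm r))^-1.
have c2 : c ^+ 2 * sqnorm r = 1.
  by rewrite /c exprVn sqr_sqrtr ?ltW // mulVf ?gt_eqF.
pose r' x := c%:C * r x.
have cr' : ucont r' by exact: ucontZ.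
have rr : ip r' r' = 1.
  rewrite (ip_sqnorm compactG qL) // (sqnormZ compactG qL) // nm_real.
  by rewrite real_normK ?num_real // c2.
have re i : ip r' (e i) = 0.
  rewrite (ipZ compactG qL) // (ipB compactG qL) //; last exact: proj_ucont.
  by rewrite (ip_proj compactG qL) // subrr mulr0.
have er i : ip (e i) r' = 0 by rewrite (ip_cj compactG qL) // re (cj_real (0 : R)).
exists (fun i => if unlift ord_max i is Some j then e j else r').
  split; first by move=> i; case: unliftP.
  move=> i j; case: unliftP => [i' ->|->]; case: unliftP => [j' ->|->].
  - by rewrite oee (inj_eq lift_inj).
  - by rewrite er eq_sym (negbTE (neq_lift _ _)).
  - by rewrite re (negbTE (neq_lift _ _)).
  - by rewrite rr eqxx.
move=> i; case: unliftP => // _.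
have := Vlin c%:C r _ Vr (Vlin (-1) r r Vr Vr); congr V.
by apply/funext => x; rewrite mulN1r addNr addr0.
Qed.

(** A value off the unit circle would have unbounded powers, in one direction or
    the other. *)
Lemma bounded_hom_unimodular (c : G -> R[i]) (B : R) :
  (forall x y, c (x + y) = c x * c y) -> c 0 = 1 -> (forall x, nm (c x) <= B) ->
  forall x, nm (c x) = 1.
Proof.
move=> cM c0 cB.
have le1 x : nm (c x) <= 1.
  rewrite leNgt; apply/negP => lt1; pose d := nm (c x) - 1.
  have d0 : 0 < d by rewrite subr_gt0.
  have B0 : 0 <= B by apply: le_trans (cB 0); exact: nm_ge0.
  have cn n : 1 + n%:R * d <= nm (c (x *+ n)).
    elim: n => [|n IH]; first by rewrite mul0r addr0 mulr0n c0 nm1.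
    rewrite [x *+ _]mulrS cM nmM; have -> : nm (c x) = 1 + d by rewrite addrC subrK.
    apply: le_trans (ler_wpM2l _ IH); last by rewrite addr_ge0 // ltW.
    have : 0 <= n%:R * d * d by rewrite !mulr_ge0 // ltW.
    by rewrite -(natr1 n); move: (n%:R : R) => t; lra.
  have := le_trans (cn (Num.bound (B / d))) (cB _).
  have := archi_boundP (divr_ge0 B0 (ltW d0)); rewrite ltr_pdivrMr //.
  by move: (_ * d) => t; lra.
move=> x; apply/eqP; rewrite eq_le le1 /=.
have := nmM (c x) (c (- x)); rewrite -cM subrr c0 nm1 => h.
by rewrite h ler_piMr // nm_ge0.
Qed.

(** In an invariant subspace of least dimension every translation has an
    eigenvector, whose eigenspace is again invariant: translations act on it by
    scalars, and these scalars form a character. *)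
Lemma eigenspace_character g0 : eigenfun g0 -> (exists x, g0 x != 0) ->
  exists g, [/\ character g & nm (ip k g) ^+ 2 = S].
Proof.
move=> eg0 [x0 g0x].
have invE : inv_subspace eigenfun.
  split => //.
  - move=> a f g [cf Kf] [cg Kg]; split; first by apply: ucontD => //; exact: ucontZ.
    move=> x; rewrite (kop_lin compactG qL ck) // (kop_lin compactG qL ck) ?Kf ?Kg; try exact: cK.
    ring.
  - move=> a f [cf Kf]; split; first exact: ucont_shift.
    by move=> x; rewrite (kop_shift compactG invL ck) // (kop_shift compactG invL ck) ?Kf //; exact: cK.
  - by exists g0, x0.
pose P n := `[< exists2 V, inv_subspace V & ~ has_orthonormal n.+1 V >].
have exP : exists n, P n.
  have [[|N] hN] := eigen_dim.
    by case: hN; exists (fun i : 'I_0 => fun=> 0); [split; case|case].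
  by exists N; apply/asboolP; exists eigenfun.
case: (ex_minnP exP) => n /asboolP[V iV maxV] minn.
have onV W : inv_subspace W -> has_orthonormal n W.
  move=> iW; case: n minn {maxV} => [|n] minn.
    by exists (fun i : 'I_0 => fun=> 0); [split; case|case].
  apply: contrapT => nW; have := minn n; rewrite ltnn => h.
  by apply: notF; apply: h; apply/asboolP; exists W.
have [Veig Vlin Vsh [f1 [x1 [Vf1 f1x]]]] := iV.
have [e oe eV] := onV _ iV; have [ce _] := oe.
have n0 : (0 < n)%N.
  rewrite lt0n; apply/eqP => n0; move: f1x.
  rewrite (orthonormal_span iV oe eV maxV Vf1) /proj.
  by rewrite big1 ?eqxx // => i _; have := ltn_ord i; rewrite {2}n0.
(* Translation by a acts on V by a matrix in the orthonormal basis, which has an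
   eigenvector; its eigenspace inside V has the same dimension as V. *)
have trans a : exists l, forall f, V f -> forall x, f (a + x) = l * f x.
  pose A := \matrix_(i < n, j < n) ip (fun x => e i (a + x)) (e j).
  have [l /eigenvalueP[v vA v0]] := eigenvalue_closed A n0.
  have [j vj] : exists j, v 0 j != 0.
    apply: contrapT => /forallNP h; move/eqP: v0; apply; apply/rowP => j.
    by rewrite mxE; apply/eqP/negbNE/negP; exact: h.
  pose g x := \sum_i v 0 i * e i x.
  have V0 : V (fun=> 0).
    have := Vlin (-1) f1 f1 Vf1 Vf1; congr V.
    by apply/funext => x; rewrite mulN1r addNr.
  have Vg : V g.
    rewrite /g; elim: (index_enum _) => [|i s IH].
      by move: V0; congr V; apply/funext => x; rewrite big_nil.
    have := Vlin (v 0 i) _ _ (eV i) IH; congr V.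
    by apply/funext => x; rewrite big_cons.
  have ge : ip g (e j) = v 0 j.
    rewrite (ip_sum compactG qL) //; last by move=> i; exact: ucontZ.
    rewrite (bigD1 j) //= (ipZ compactG qL) // oe.2 eqxx mulr1 big1 ?addr0 //.
    by move=> i ij; rewrite (ipZ compactG qL) // oe.2 (negbTE ij) mulr0.
  have ga x : g (a + x) = l * g x.
    rewrite /g mulr_sumr.
    transitivity (\sum_i v 0 i * \sum_j A i j * e j x).
      apply: eq_bigr => i _; congr (_ * _).
      have := orthonormal_span iV oe eV maxV (Vsh a _ (eV i)).
      move=> /(congr1 (fun h => h x)) ->.
      by apply: eq_bigr => j' _; rewrite mxE.
    under eq_bigr do rewrite mulr_sumr.
    rewrite exchange_big /=; apply: eq_bigr => j' _.
    move: vA => /(congr1 (fun M : 'rV_n => M 0 j')); rewrite !mxE => vA.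
    by rewrite mulrA -vA mulr_suml; apply: eq_bigr => i _; rewrite mulrA.
  pose W := [set f | V f /\ forall x, f (a + x) = l * f x].
  have iW : inv_subspace W.
    split.
    - by move=> f [Vf _]; exact: Veig.
    - move=> c f h [Vf fa] [Vh ha]; split; first exact: Vlin.
      by move=> x; rewrite fa ha; ring.
    - move=> b f [Vf fa]; split; first exact: Vsh.
      by move=> x; rewrite addrCA fa.
    - exists g; apply: contrapT => /forallNP gx.
      have g00 : g = fun=> 0.
        apply/funext => x; apply/eqP/negbNE/negP => gx0; apply: (gx x).
        by split.
      move: vj; rewrite -ge g00 /ip.
      have -> : (fun x => 0 * cj (e j x)) = (fun x : G => (0 : R[i])).
        by apply/funext => x; rewrite mul0r.
      by rewrite (quad_cst qL) eqxx.
  have [e' oe' eW] := onV _ iW.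
  exists l => f Vf x.
  have fE := orthonormal_span iV oe' (fun i => (eW i).1) maxV Vf.
  rewrite {1}fE [in RHS]fE /proj mulr_sumr; apply: eq_bigr => i _.
  by rewrite (eW i).2 mulrCA.
have [c hc] := choice trans.
have f1c x : f1 x = c x * f1 0 by rewrite -hc // addr0.
have f10 : f1 0 != 0 by apply: contra f1x => /eqP h; rewrite f1c h mulr0.
have cM x y : c (x + y) = c x * c y.
  by apply: (mulIf f10); rewrite -f1c hc // f1c mulrA.
have c0 : c 0 = 1 by apply: (mulIf f10); rewrite -f1c mul1r.
have [cf1 Kf1] := Veig _ Vf1.
have uc : ucont c.
  have := ucontZ (f1 0)^-1 cf1; congr ucont; apply/funext => x.
  by rewrite [f1 x]f1c mulrCA mulVf // mulr1.
have [B _ cB] := ucont_bounded compactG uc.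
have cc : character c by split => //; exact: (bounded_hom_unimodular cM c0 cB).
exists c; split => //.
have f1E : f1 = fun x => f1 0 * c x by apply/funext => x; rewrite f1c mulrC.
have := Kf1 0; rewrite f1E.
have := kop_char compactG qL invL ck hk cc; set lam := cj _ => Kc.
rewrite (kopZ compactG qL ck) // Kc (kopZ compactG qL ck); last exact: ucontZ.
rewrite (kopZ compactG qL ck) // Kc !c0 !mulr1 => h.
have : f1 0 * (lam * lam) = f1 0 * S%:C by rewrite h mulrC.
move/(mulfI f10) => /(congr1 (@nm R)); rewrite nmM nm_real gtr0_norm //.
by rewrite /lam nm_cj expr2.
Qed.

End Eigenspace.

(** * Density of trigonometric polynomials *)

Definition trigpoly (R : realType) (G : topologicalZmodType) n
    (c : 'I_n -> R[i]) (g : 'I_n -> G -> R[i]) : G -> R[i] :=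
  fun x => \sum_i c i * g i x.

Section PeterWeyl.
Variables (R : realType) (G : topologicalZmodType).
Hypotheses (compactG : compact [set: G]) (hausdorffG : hausdorff_space G).
Variable L : (G -> R[i]) -> R[i].
Hypothesis qL : quadrature L.
Hypothesis invL : forall f a, ucont f -> L (fun x => f (a + x)) = L f.
Implicit Types (f g h k : G -> R[i]).

Local Notation ip := (ip L).
Local Notation sqnorm := (sqnorm L).

(** Translation by a point where the characters differ multiplies their inner
    product by a number other than one. *)
Lemma char_orthogonal g g' : character g -> character g' -> g <> g' ->
  ip g g' = 0.
Proof.
move=> cg cg' gg'; have [ug gM g1] := cg; have [ug' gM' g1'] := cg'.
have [a ga] : exists a, g a != g' a.
  apply: contrapT => /forallNP h; apply: gg'; apply/funext => x.
  by apply/eqP/negbNE/negP; exact: h.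
have h : ip g g' = g a * cj (g' a) * ip g g'.
  rewrite {1}/ip -(invL a); last by apply: ucontM => //; exact: ucont_cj.
  rewrite -(quadZ qL); last by apply: ucontM => //; exact: ucont_cj.
  by congr L; apply/funext => x; rewrite gM gM' cjM; ring.
apply/eqP; apply: contraNT ga => ip0.
have : 1 * ip g g' = g a * cj (g' a) * ip g g' by rewrite mul1r.
move/(mulIf ip0) => h1; apply/eqP.
have h2 : g' a * cj (g' a) = 1 by rewrite mul_cj g1' expr1n.
have h3 : cj (g' a) != 0.
  by apply/eqP => h0; move: h2; rewrite h0 mulr0 => /eqP; rewrite eq_sym oner_eq0.
by apply: (mulIf h3); rewrite h2 -h1.
Qed.

(** Approximate identities.  The mean of the bump is not zero because finitely
    many of its translates add up to a function bounded below. *)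
Lemma bump (U : set G) : nbhs (0 : G) U -> exists k,
  [/\ ucont k, forall x, k (- x) = k x, forall x, 0 <= k x,
      forall x, ~ U x -> k x = 0 & L k = 1].
Proof.
move=> oU; have [V [oV V0] VU] : exists2 V : set G, open V /\ V 0 & V `<=` U.
  by move: oU; rewrite nbhsE => -[V [oV V0] VU]; exists V.
have [h [ch h01 h1 h0]] : exists h : G -> R, [/\ continuous h,
    forall x, 0 <= h x <= 1, forall x, [set 0] x -> h x = 1 &
    forall x, ~ V x -> h x = 0].
  by apply: cutoff => //; [exact: compact_set1|move=> x ->].
have uh := ucont_real compactG ch.
pose k1 x := (h x)%:C * (h (0 - x))%:C : R[i].
have uk1 : ucont k1.
  apply: ucontM => //; have := ucont_refl 0 uh.
  by congr ucont; apply/funext => x; rewrite sub0r.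
have k1_ge0 x : 0 <= k1 x.
  by rewrite mulr_ge0 // ler0c; [have /andP[] := h01 x|have /andP[] := h01 (0 - x)].
have k10 : k1 0 = 1 by rewrite /k1 subr0 h1 // mulr1.
have half : 0 < 1 / 2 :> R by rewrite divr_gt0.
have [s hs] := fin_translates compactG (uk1 _ half).
have ks y : ucont (fun x => k1 (- y + x)) by exact: ucont_shift.
have L1 : ((1 / 2)%:C : R[i]) <= (size s)%:R * L k1.
  have -> : (size s)%:R * L k1 = L (fun x => \sum_(y <- s) k1 (- y + x)).
    rewrite (quad_sum qL) // (eq_bigr (fun=> L k1)) => [|y _]; last exact: invL.
    by rewrite big_const_seq count_predT iter_addr_0 mulr_natl.
  have us : ucont (fun x => \sum_(y <- s) k1 (- y + x)) by exact: ucont_sum.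
  have uc := @ucont_cst R G ((1 / 2)%:C).
  have : 0 <= L (fun x => \sum_(y <- s) k1 (- y + x) - (1 / 2)%:C).
    apply: (quad_ge0 qL) => [|x]; first exact: ucontB.
    have [y ys /(_ 0)] := hs x; rewrite add0r k10 => hy.
    rewrite subr_ge0 (big_rem y) //= -[leLHS]addr0; apply: lerD; last first.
      by rewrite sumr_ge0.
    rewrite addrC; have := ger0_Im (k1_ge0 (x - y)).
    rewrite lecE /= => ->; rewrite eqxx /=.
    have := le_trans (nm_Re _) hy; rewrite ReB /= ler_norml => /andP[+ _].
      lra.
  by rewrite (quadB qL) // (quad_cst qL) subr_ge0.
have Lk := quad_ge0 qL uk1 k1_ge0.
have L0 : L k1 != 0.
  apply/eqP => h2; move: L1; rewrite h2 mulr0 lecE /= => /andP[_]; lra.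
exists (fun x => (L k1)^-1 * k1 x); split.
- exact: ucontZ.
- by move=> x; congr (_ * _); rewrite /k1 !sub0r opprK mulrC.
- by move=> x; rewrite mulr_ge0 // invr_ge0.
- by move=> x Ux; rewrite /k1 h0 ?mul0r ?mulr0 // => /VU.
- by rewrite (quadZ qL) // mulVf.
Qed.

Section Truncation.
Variable k : G -> R[i].
Hypotheses (ck : ucont k) (hk : hermitian k).

Local Notation K := (kop L k).

(** Bessel's inequality allows only finitely many large coefficients. *)
Lemma large_coefficients (d : R) : 0 < d -> exists n (e : 'I_n -> G -> R[i]),
  [/\ forall i, character (e i), orthonormal L e &
      forall g, character g -> d <= nm (ip k g) -> exists i, g = e i].
Proof.
move=> d0.
pose P n := `[< exists e : 'I_n -> G -> R[i], [/\ forall i, character (e i),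
   orthonormal L e & forall i, d <= nm (ip k (e i))] >].
have P0 : exists n, P n.
  exists 0%N; apply/asboolP; exists (fun=> fun=> 0).
  by split; [case|split; case|case].
have Pb n : P n -> (n <= Num.bound (sqnorm k / d ^+ 2))%N.
  move=> /asboolP[e [ce oe de]]; rewrite -(ler_nat R).
  apply: le_trans (ltW (archi_boundP _)); last first.
    by rewrite divr_ge0 ?exprn_ge0 ?(sqnorm_ge0 compactG qL) // ltW.
  rewrite ler_pdivlMr ?exprn_gt0 //.
  apply: le_trans (bessel compactG qL oe ck).
  rewrite mulr_natl -[n in leLHS]card_ord -sumr_const; apply: ler_sum => i _.
  by rewrite ler_pXn2r // nnegrE ?nm_ge0 // ltW.
case: (ex_maxnP P0 Pb) => n /asboolP[e [ce oe de]] maxn.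
exists n, e; split => // g cg dg.
apply: contrapT => /forallNP ge; have := maxn n.+1; rewrite ltnn => h.
apply: notF; apply: h; apply/asboolP.
exists (fun i => if unlift ord_max i is Some j then e j else g); split.
- by move=> i; case: unliftP.
- split; first by move=> i; case: unliftP => [j _|_]; [case: (ce j)|case: cg].
  move=> i j; case: unliftP => [i' ->|->]; case: unliftP => [j' ->|->].
  + by rewrite oe.2 (inj_eq lift_inj).
  + rewrite eq_sym (negbTE (neq_lift _ _)) char_orthogonal // => eg.
    by apply: (ge i').
  + by rewrite (negbTE (neq_lift _ _)) char_orthogonal.
  + by rewrite (ip_char qL) // eqxx.
- by move=> i; case: unliftP.
Qed.

(** Removing from the kernel its finitely many large Fourier coefficients leaves
    a kernel [kF] all of whose coefficients are below [d].  Its norm is then at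
    most [d], since a larger norm would come with an eigenspace, and hence with a
    character.  Applying [K] once more turns the quadratic bound into a uniform
    one. *)
Lemma truncation (d : R) f : 0 < d -> ucont f ->
  exists n (c : 'I_n -> R[i]) (e : 'I_n -> G -> R[i]),
    (forall i, character (e i)) /\
    forall B, (forall x, nm (k x) <= B) -> forall x,
      nm (K (K f) x - trigpoly c e x) ^+ 2 <= B ^+ 2 * (d ^+ 2 * sqnorm f).
Proof.
move=> d0 cf; have [n [e [ce oe he]]] := large_coefficients d0.
have ue i : ucont (e i) by case: (ce i).
pose a i := ip k (e i).
have aR i : cj (a i) = a i by apply: (khat_real compactG qL invL ck hk).
exists n, (fun i => a i * (a i * ip f (e i))), e; split=> // B kB x.
pose kF x := k x - proj L e k x.
have cp : ucont (proj L e k) by exact: proj_ucont.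
have ckF : ucont kF by exact: ucontB.
have hkF : hermitian kF.
  move=> y; rewrite /kF /proj cjB hk; congr (_ - _); rewrite cj_sum.
  by apply: eq_bigr => i _; rewrite cjM charN // -/(a i) aR.
have coef g : character g -> nm (ip kF g) < d.
  move=> cg; have [ug _ _] := cg; rewrite (ipB compactG qL) //.
  have [[i ->]|/forallNP gne] := pselect (exists i, g = e i).
    by rewrite (ip_proj compactG qL) // subrr nm0.
  rewrite (ip_sum compactG qL) //; last by move=> i; exact: ucontZ.
  rewrite big1 => [|i _]; last first.
    rewrite (ipZ compactG qL) // (@char_orthogonal (e i) g) ?mulr0 // => eg.
    by apply: (gne i).
  rewrite subr0 ltNge; apply/negP => dg.
  by have [i gi] := he g cg dg; exact: (gne i).
have small h : ucont h -> sqnorm (kop L kF h) <= d ^+ 2 * sqnorm h.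
  move=> ch; rewrite leNgt; apply/negP => big.
  have [S [dS [g [cg gn eg]]]] :=
    top_eigenfunction compactG qL ckF hkF (ltW d0) ch big.
  have S0 : 0 < S by apply: le_lt_trans dS; rewrite exprn_ge0 // ltW.
  have [c [cc hS]] := eigenspace_character compactG qL invL ckF hkF S0 (conj cg eg) gn.
  have := coef _ cc; rewrite ltNge => /negP; apply.
  by rewrite -(ler_pXn2r (n := 2)) ?nnegrE ?nm_ge0 ?hS ?ltW.
have kFf : kop L kF f = fun y => K f y - trigpoly (fun i => a i * ip f (e i)) e y.
  apply/funext => y; rewrite /kop /trigpoly /kF.
  have ckf : ucont (fun z => k (y - z) * f z).
    by apply: ucontM => //; exact: ucont_refl.
  have cef i : ucont (fun z => cj (e i z) * f z).
    by apply: ucontM => //; exact: ucont_cj.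
  transitivity (L (fun z => k (y - z) * f z -
      \sum_i (a i * e i y) * (cj (e i z) * f z))).
    congr L; apply/funext => z; rewrite mulrBl /proj mulr_suml.
    congr (_ - _); apply: eq_bigr => i _; have [_ eM _] := ce i.
    by rewrite eM charN // /a; ring.
  rewrite (quadB qL) //; last by apply: ucont_sum => i; exact: ucontZ.
  congr (_ - _); rewrite (quad_sum qL); last by move=> i; exact: ucontZ.
  apply: eq_bigr => i _; rewrite (quadZ qL) // /ip -!mulrA; congr (_ * _).
  by rewrite mulrC; congr (_ * _); congr L; apply/funext => z; rewrite mulrC.
have -> : K (K f) x - trigpoly (fun i => a i * (a i * ip f (e i))) e x
    = K (kop L kF f) x.
  have ct : ucont (trigpoly (fun i => a i * ip f (e i)) e).
    by apply: ucont_sum => i; exact: ucontZ.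
  have cKf : ucont (K f) by exact: kop_ucont.
  rewrite kFf (kopB compactG qL ck) //; congr (_ - _).
  transitivity (\sum_i (a i * ip f (e i)) * K (e i) x).
    apply: eq_bigr => i _; rewrite (kop_char compactG qL invL ck hk) //.
    by rewrite -/(a i) aR; ring.
  rewrite /kop /trigpoly; have cke i : ucont (fun y => k (x - y) * e i y).
    by apply: ucontM => //; exact: ucont_refl.
  under eq_bigr do rewrite -(quadZ qL) //.
  rewrite -(quad_sum qL) => [|i]; last exact: ucontZ.
  congr L; apply/funext => y; rewrite mulr_sumr; apply: eq_bigr => i _; ring.
apply: (le_trans (kop_sup compactG qL ck x (kop_ucont compactG qL ckF cf) kB)).
by rewrite ler_wpM2l ?small // exprn_ge0 // (le_trans _ (kB 0)) ?nm_ge0.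
Qed.

End Truncation.

(** The Peter-Weyl theorem for a compact abelian group, in the uniform norm: a
    function is close to its double convolution with a narrow density, and the
    latter is close to a trigonometric polynomial by [truncation]. *)
Theorem trigpoly_dense f (e : R) : ucont f -> 0 < e ->
  exists n (c : 'I_n -> R[i]) (g : 'I_n -> G -> R[i]),
    (forall i, character (g i)) /\
    forall x, nm (f x - trigpoly c g x) <= e.
Proof.
move=> cf e0; have e3 : 0 < e / 3 by rewrite divr_gt0.
have [k [ck ek k0 kU Lk1]] := bump (cf _ e3).
have hk : hermitian k.
  move=> x; rewrite ek; have := ger0_Im (k0 x).
  rewrite [k x]complexEE /= => ->; rewrite /cj /= oppr0 //.
pose K := kop L k.
have k1x x : L (fun y => k (x - y)) = 1.
  rewrite -Lk1 -[RHS](invL (- x)) //; congr L; apply/funext => y.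
  by rewrite -ek opprB addrC.
have dom x F a : ucont F -> (forall y, nm (F y) <= a * nm (k (x - y))) -> nm (L F) <= a.
  move=> cF hF; have kr y : (nm (k y))%:C = k y by rewrite -nmE ger0_norm.
  have Ea : (fun y => (a * nm (k (x - y)))%:C) = fun y => a%:C * k (x - y).
    by apply/funext => y; rewrite rmorphM /= kr.
  have ckx : ucont (fun y => k (x - y)) by exact: ucont_refl.
  have := quad_dom qL cF _ hF; rewrite Ea (quadZ qL) // k1x mulr1 /=; apply.
  exact: ucontZ.
have Kle h b x : ucont h -> (forall y, nm (h y) <= b) -> nm (K h x) <= b.
  move=> ch hb; apply: (dom x) => [|y].
    by apply: ucontM => //; exact: ucont_refl.
  by rewrite nmM mulrC ler_wpM2r // nm_ge0.
have Kf x : nm (f x - K f x) <= e / 3.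
  have ckx : ucont (fun y => k (x - y)) by exact: ucont_refl.
  have -> : f x - K f x = L (fun y => k (x - y) * (f x - f y)).
    rewrite -[f x in LHS]mulr1 -(k1x x) -(quadZ qL) // /K /kop -(quadB qL).
    - by congr L; apply/funext => y; ring.
    - exact: ucontZ.
    - exact: ucontM.
  apply: (dom x) => [|y].
    by apply: ucontM => //; apply: ucontB => //; exact: ucont_cst.
  have [Uxy|/kU ->] := pselect (forall z, nm (f (z + (x - y)) - f z) <= e / 3).
    rewrite nmM mulrC ler_wpM2r ?nm_ge0 //.
    by have := Uxy y; rewrite (addrC y) subrK.
  by rewrite mul0r nm0 mulr0.
have [B B0 kB] := ucont_bounded compactG ck.
have s0 := sqnorm_ge0 compactG qL cf.
pose D := B ^+ 2 * (sqnorm f + 1).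
have D0 : 0 < D by rewrite mulr_gt0 ?exprn_gt0 // ltr_wpDl.
pose d := (e / 3) / Num.sqrt D.
have d0 : 0 < d by rewrite divr_gt0 // sqrtr_gt0.
have [n [c [g [cg h]]]] := truncation ck hk d0 cf.
exists n, c, g; split => // x.
have h1 : nm (K (K f) x - trigpoly c g x) <= e / 3.
  have : nm (K (K f) x - trigpoly c g x) ^+ 2 <= (e / 3) ^+ 2.
    apply: (le_trans (h B kB x)).
    have -> : B ^+ 2 * (d ^+ 2 * sqnorm f) = (e / 3) ^+ 2 * ((B ^+ 2 * sqnorm f) / D).
      by rewrite /d expr_div_n sqr_sqrtr ?ltW //; field; rewrite gt_eqF.
    rewrite ler_piMr ?exprn_ge0 ?(ltW e3) // ler_pdivrMr // mul1r /D.
    by rewrite mulrDr mulr1 lerDl exprn_ge0 // ltW.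
  by rewrite ler_pXn2r // nnegrE ?nm_ge0 // ltW.
have cKf : ucont (K f) by exact: kop_ucont.
have h2 : nm (K f x - K (K f) x) <= e / 3.
  have -> : K f x - K (K f) x = K (fun y => f y - K f y) x.
    by rewrite /K (kopB compactG qL ck).
  by apply: Kle => //; exact: ucontB.
have h3 := nm_dist_tri (K f x) (f x) (trigpoly c g x).
have h4 := nm_dist_tri (K (K f) x) (K f x) (trigpoly c g x).
have h5 := Kf x; lra.
Qed.

End PeterWeyl.

(** * Polynomials in a convolution operator *)

Section Calculus.
Variables (R : realType) (G : topologicalZmodType).
Hypothesis compactG : compact [set: G].
Variable L : (G -> R[i]) -> R[i].
Hypothesis qL : quadrature L.
Implicit Types (f g : G -> R[i]) (p q : {poly R[i]}) (z w : R[i]).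

Local Notation T := (cvl L).

Definition act p f : G -> R[i] := fun x => \sum_(k < size p) p`_k * iter k T f x.

Lemma iter_ucont n f : ucont f -> ucont (iter n T f).
Proof. by move=> cf; elim: n => [|n IH] //=; exact: cvl_ucont. Qed.

Lemma act_ucont p f : ucont f -> ucont (act p f).
Proof.
by move=> cf; apply: ucont_sum => k; apply: ucontZ; exact: iter_ucont.
Qed.

Lemma act_widen n p f x : (size p <= n)%N ->
  act p f x = \sum_(k < n) p`_k * iter k T f x.
Proof.
move=> pn; rewrite /act (big_ord_widen_cond n xpredT (fun k => p`_k * iter k T f x)) //.
rewrite [RHS](bigID (fun k : 'I_n => (k < size p)%N)) /= [X in _ = _ + X]big1 ?addr0 //.
by move=> k; rewrite -leqNgt => kp; rewrite nth_default // mul0r.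
Qed.

Lemma actD p q f x : act (p + q) f x = act p f x + act q f x.
Proof.
pose n := maxn (size p) (size q).
rewrite (@act_widen n p) ?leq_maxl // (@act_widen n q) ?leq_maxr //.
rewrite (@act_widen n) ?size_polyD // -big_split /=.
by apply: eq_bigr => k _; rewrite coefD mulrDl.
Qed.

Lemma actZ z p f x : act (z *: p) f x = z * act p f x.
Proof.
rewrite (@act_widen (size p)) ?size_scale_leq // mulr_sumr.
by apply: eq_bigr => k _; rewrite coefZ mulrA.
Qed.

Lemma actC z f x : act z%:P f x = z * f x.
Proof.
by rewrite (@act_widen 1) ?size_polyC ?leq_b1 // big_ord_recl big_ord0 addr0 coefC.
Qed.

Lemma act1 f x : act 1 f x = f x. Proof. by rewrite -polyC1 actC mul1r. Qed.

Lemma actN p f x : act (- p) f x = - act p f x.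
Proof. by rewrite -scaleN1r actZ mulN1r. Qed.

Lemma actB p q f x : act (p - q) f x = act p f x - act q f x.
Proof. by rewrite actD actN. Qed.

Lemma iter_lin n a f g : ucont f -> ucont g ->
  iter n T (fun x => a * f x + g x) = fun x => a * iter n T f x + iter n T g x.
Proof.
move=> cf cg; elim: n => [|n IH] //=.
by rewrite IH (cvl_lin qL) //; exact: iter_ucont.
Qed.

Lemma act_lin p a f g x : ucont f -> ucont g ->
  act p (fun x => a * f x + g x) x = a * act p f x + act p g x.
Proof.
move=> cf cg; rewrite /act mulr_sumr -big_split /=; apply: eq_bigr => k _.
by rewrite iter_lin //; ring.
Qed.

Lemma act_subf p f g x : ucont f -> ucont g ->
  act p (fun x => f x - g x) x = act p f x - act p g x.
Proof.
move=> cf cg; have := act_lin p (-1) x cg cf.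
rewrite mulN1r addrC => <-; congr (act p _ x).
by apply/funext => y; rewrite mulN1r addrC.
Qed.

Lemma act_sum p n (a : 'I_n -> R[i]) (F : 'I_n -> G -> R[i]) x :
  (forall i, ucont (F i)) ->
  act p (fun y => \sum_i a i * F i y) x = \sum_i a i * act p (F i) x.
Proof.
move=> cF; elim: (index_enum _) => [|i s IH].
  have -> : (fun y => \sum_(i <- [::]) a i * F i y) = fun=> -1 * 0 + 0.
    by apply/funext => y; rewrite big_nil mulr0 addr0.
  by rewrite big_nil act_lin ?mulN1r ?addNr //; exact: ucont_cst.
rewrite big_cons -IH -act_lin //; last by apply: ucont_sum => j; exact: ucontZ.
by congr (act p _ x); apply/funext => y; rewrite big_cons.
Qed.

Lemma actMX p f x : act (p * 'X) f x = act p (T f) x.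
Proof.
have [->|p0] := eqVneq p 0.
  by rewrite mul0r /act size_poly0 !big_ord0.
rewrite {1}/act size_mulX // big_ord_recl coefMX eqxx mul0r add0r.
by apply: eq_bigr => k _; rewrite coefMX /= -iterS iterSr.
Qed.

Lemma actXM p f : ucont f -> act ('X * p) f = T (act p f).
Proof.
move=> cf; apply/funext => x; rewrite mulrC actMX /act /cvl (quad_sum qL); last first.
  by move=> k; apply: ucontZ; apply: ucont_shift; exact: iter_ucont.
apply: eq_bigr => k _; rewrite (quadZ qL); last by apply: ucont_shift; exact: iter_ucont.
by rewrite -iterSr.
Qed.

Lemma actM p q f x : ucont f -> act (p * q) f x = act p (act q f) x.
Proof.
move=> cf; elim/poly_ind: p q => [|p c IH] q.
  by rewrite mul0r /act size_poly0 !big_ord0.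
rewrite mulrDl actD [RHS]actD -mulrA IH actC mul_polyC actZ; congr (_ + _).
by rewrite actMX actXM.
Qed.

(** Translating a character multiplies it by a constant, so that it is an
    eigenfunction of averages of translates. *)
Lemma act_char p g x : ucont g -> (forall x y, g (x + y) = g x * g y) ->
  act p g x = p.[L g] * g x.
Proof.
move=> cg gM; rewrite horner_coef mulr_suml; apply: eq_bigr => k _.
rewrite -mulrA; congr (_ * _).
have Tg : T g = fun x => L g * g x.
  apply/funext => y; rewrite /cvl mulrC -(quadZ qL) //.
  by congr L; apply/funext => t; rewrite gM.
elim: (k : nat) x => [|n IH] x /=; first by rewrite expr0 mul1r.
have -> : iter n T g = fun y => L g ^+ n * g y by apply/funext => y; exact: IH.
rewrite /cvl (quadZ qL) ?exprS; last exact: ucont_shift.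
by have /(congr1 (fun h => h x)) := Tg; rewrite /cvl => ->; ring.
Qed.

(** [opnorm_le p c] bounds the operator norm, hence the total variation of the
    corresponding combination of convolution powers; the relation dispenses
    with taking the supremum. *)
Definition opnorm_le p (c : R) := forall f (b : R), ucont f ->
  (forall x, nm (f x) <= b) -> forall x, nm (act p f x) <= c * b.

Lemma opnorm_le_ge0 p c : opnorm_le p c -> 0 <= c.
Proof.
move=> /(_ (fun=> 0) 1 (@ucont_cst R G 0)); rewrite mulr1 => h.
by apply: le_trans (h _ 0); [exact: nm_ge0|move=> x; rewrite nm0].
Qed.

Lemma bound_ge0 f (b : R) : (forall x, nm (f x) <= b) -> 0 <= b.
Proof. by move=> /(_ 0); apply: le_trans; exact: nm_ge0. Qed.

Lemma opnorm_le_mono c p d : opnorm_le p c -> c <= d -> opnorm_le p d.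
Proof.
move=> pc cd f b cf fb x; apply: (le_trans (pc f b cf fb x)).
by rewrite ler_wpM2r // (bound_ge0 fb).
Qed.

Lemma opnorm_leD p q c d : opnorm_le p c -> opnorm_le q d -> opnorm_le (p + q) (c + d).
Proof.
move=> pc qd f b cf fb x; rewrite actD mulrDl.
by apply: (le_trans (nmD _ _)); apply: lerD; [exact: pc|exact: qd].
Qed.

Lemma opnorm_leZ z p c : opnorm_le p c -> opnorm_le (z *: p) (nm z * c).
Proof.
move=> pc f b cf fb x; rewrite actZ nmM -mulrA ler_wpM2l ?nm_ge0 //.
exact: pc.
Qed.

Lemma opnorm_leN p c : opnorm_le p c -> opnorm_le (- p) c.
Proof. by move=> /(opnorm_leZ (-1)); rewrite scaleN1r nmN nm1 mul1r. Qed.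

Lemma opnorm_leB p q c d : opnorm_le p c -> opnorm_le q d -> opnorm_le (p - q) (c + d).
Proof. by move=> pc qd; apply: opnorm_leD => //; exact: opnorm_leN. Qed.

Lemma opnorm_le1 : opnorm_le 1 1.
Proof. by move=> f b cf fb x; rewrite act1 mul1r. Qed.

Lemma opnorm_leM p q c d : opnorm_le p c -> opnorm_le q d -> opnorm_le (p * q) (c * d).
Proof.
move=> pc qd f b cf fb x; rewrite actM // -mulrA.
by apply: pc; [exact: act_ucont|exact: qd].
Qed.

Lemma opnorm_leE p c n : opnorm_le p c -> opnorm_le (p ^+ n) (c ^+ n).
Proof.
by move=> pc; elim: n => [|n IH]; rewrite ?exprS; [exact: opnorm_le1|exact: opnorm_leM].
Qed.

Lemma opnorm_leX : opnorm_le 'X 1.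
Proof.
move=> f b cf fb x; rewrite -[X in act X _ _]mul1r actMX act1 mul1r.
exact: (cvl_le qL).
Qed.

Lemma opnorm_le_ex p : exists2 c, 0 < c & opnorm_le p c.
Proof.
suff [c pc] : exists c, opnorm_le p c.
  exists (c + 1); last by apply: opnorm_le_mono pc _; rewrite lerDl.
  by rewrite ltr_wpDl // (opnorm_le_ge0 pc).
elim/poly_ind: p => [|p z [c pc]].
  exists (1 + 1); rewrite -(subrr 1); exact: (opnorm_leB opnorm_le1 opnorm_le1).
exists (c * 1 + nm z * 1); apply: opnorm_leD; first by apply: opnorm_leM => //; exact: opnorm_leX.
by rewrite -alg_polyC; apply: opnorm_leZ; exact: opnorm_le1.
Qed.

(** The set of [z] such that [z - T] is invertible in the closed algebra
    generated by [T]: by Neumann series, an approximate inverse suffices. *)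
Definition regular z := exists q c, c < 1 /\ opnorm_le (1 - q * (z%:P - 'X)) c.

Lemma expr_small (c e : R) : 0 <= c -> c < 1 -> 0 < e ->
  \forall n \near \oo, c ^+ n <= e.
Proof.
move=> c0 c1 e0; have c1' : `|c| < 1 by rewrite ger0_norm.
have /cvgrPdist_le/(_ e e0) := cvg_expr c1'; apply: filterS => n.
by rewrite sub0r normrN ger0_norm // exprn_ge0.
Qed.

Lemma regular_approx z (e : R) : regular z -> 0 < e ->
  exists q, opnorm_le (1 - q * (z%:P - 'X)) e.
Proof.
move=> [q [c [c1 qc]]] e0; have c0 := opnorm_le_ge0 qc.
have [n _ /(_ n (leqnn n)) hn] := expr_small c0 c1 e0.
pose d := 1 - q * (z%:P - 'X).
exists (q * \sum_(i < n) d ^+ i).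
have -> : 1 - q * (\sum_(i < n) d ^+ i) * (z%:P - 'X) = d ^+ n.
  have : d ^+ n - 1 = (d - 1) * \sum_(i < n) d ^+ i by rewrite subrX1.
  move=> /eqP; rewrite subr_eq => /eqP ->; rewrite /d; ring.
exact: opnorm_le_mono (opnorm_leE n qc) hn.
Qed.

Lemma regular_perturb z w q c d : opnorm_le (1 - q * (z%:P - 'X)) c -> opnorm_le q d ->
  opnorm_le (1 - q * (w%:P - 'X)) (c + nm (z - w) * d).
Proof.
move=> qc qd.
have -> : 1 - q * (w%:P - 'X) = (1 - q * (z%:P - 'X)) + (z - w) *: q.
  by rewrite -mul_polyC polyCB; ring.
by apply: opnorm_leD => //; exact: opnorm_leZ.
Qed.

Lemma regular_open z : regular z ->
  exists2 r, 0 < r & forall w, nm (w - z) <= r -> regular w.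
Proof.
move=> [q [c [c1 qc]]]; have [d d0 qd] := opnorm_le_ex q.
exists ((1 - c) / 2 / d); first by rewrite !divr_gt0 // subr_gt0.
move=> w wz; exists q, (c + nm (z - w) * d); split; last exact: regular_perturb.
have : nm (z - w) * d <= (1 - c) / 2.
  by rewrite -ler_pdivlMr // nm_distC.
lra.
Qed.

Lemma regular_large z : 1 < nm z -> regular z.
Proof.
move=> z1; have z0 : z != 0.
  by apply/eqP => z0; move: z1; rewrite z0 nm0 ltr10.
exists (z^-1)%:P, (nm z^-1); split.
  by rewrite nmV invf_lt1 // (lt_trans ltr01 z1).
have -> : 1 - (z^-1)%:P * (z%:P - 'X) = z^-1 *: 'X.
  by rewrite mulrBr -polyCM mulVf // opprB addrC subrK mul_polyC.
by rewrite -[nm _]mulr1; apply: opnorm_leZ; exact: opnorm_leX.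
Qed.

(** The value of a polynomial at the eigenvalue of a character is bounded by its
    norm, and [1 - q * (z%:P - 'X)] is one at the eigenvalue [z]. *)
Lemma regular_char g : ucont g -> (forall x y, g (x + y) = g x * g y) ->
  (forall x, nm (g x) = 1) -> ~ regular (L g).
Proof.
move=> cg gM g1 [q [c [c1 qc]]].
have g_le1 x : nm (g x) <= 1 by rewrite g1.
have := qc g 1 cg g_le1 0.
rewrite act_char // hornerD hornerC hornerN hornerM !hornerE subrr mulr0 subr0.
by rewrite mul1r g1 leNgt c1.
Qed.

(** An approximate inverse at [z] remains one near [z], which bounds [w - T]
    below locally uniformly in [w]. *)
Lemma regular_lower z : regular z -> exists M r : R, [/\ 0 < M, 0 < r &
  forall w, nm (w - z) <= r -> forall f b, ucont f ->
    (forall x, nm (act (w%:P - 'X) f x) <= b) -> forall x, nm (f x) <= M * b].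
Proof.
move=> rz; have [q hq] := regular_approx rz (divr_gt0 ltr01 (ltr0n R 4)).
have [d d0 qd] := opnorm_le_ex q.
exists (2 * d), (1 / 4 / d); split; [by rewrite mulr_gt0|by rewrite !divr_gt0|].
move=> w wz f b cf fb.
have b0 : 0 <= b by apply: le_trans (fb 0); exact: nm_ge0.
have hw : opnorm_le (1 - q * (w%:P - 'X)) (1 / 2).
  apply: opnorm_le_mono (regular_perturb w hq qd) _.
  have : nm (z - w) * d <= 1 / 4 by rewrite -ler_pdivlMr // nm_distC.
  lra.
have [B B0 fB] := ucont_bounded compactG cf.
pose E := [set nm (f x) | x in [set: G]].
have supE : has_sup E.
  by split; [exists (nm (f 0)), 0|exists B => _ [x _ <-]].
have fs x : nm (f x) <= sup E by apply: ub_le_sup; [exact: supE.2|exists x].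
have : sup E <= d * b + sup E / 2.
  apply: sup_le_ub; first exact: supE.1.
  move=> _ [x _ <-].
  have -> : f x = act q (act (w%:P - 'X) f) x + act (1 - q * (w%:P - 'X)) f x.
    by rewrite actB act1 actM // addrC subrK.
  apply: (le_trans (nmD _ _)); apply: lerD.
    by apply: qd => //; exact: act_ucont.
  by apply: (le_trans (hw f _ cf fs x)); lra.
by move=> h x; have := fs x; lra.
Qed.

End Calculus.

(** * Rational functions without poles in a disc *)

Section Rational.
Variable R : realType.
Implicit Types (z w t b : R[i]).

(** Averaging over the two square roots of [t] squares the poles, and averages of
    values bounded by [A] are bounded by [A]. *)
Lemma root_doubling n (c b : 'I_n -> R[i]) (A : R) :
  (forall i, nm (b i) <> 1) ->
  (forall t, nm t = 1 -> nm (\sum_i c i / (1 - t * b i)) <= A) ->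
  forall k t, nm t = 1 -> nm (\sum_i c i / (1 - t * b i ^+ (2 ^ k))) <= A.
Proof.
move=> b1 hA; elim=> [|k IH] t t1; first by under eq_bigr do rewrite expn0 expr1; exact: hA.
pose s := sqrtc t; have ss : s ^+ 2 = t by exact: sqr_sqrtc.
have s1 : nm s = 1.
  have h : nm s ^+ 2 = 1 by rewrite -nmX ss.
  by apply/eqP; rewrite -(@pexpr_eq1 _ _ 2) ?h ?nm_ge0.
have h1 := IH s s1; have := IH (- s); rewrite nmN => /(_ s1) h2.
have -> : \sum_i c i / (1 - t * b i ^+ (2 ^ k.+1))
    = 2^-1 * ((\sum_i c i / (1 - s * b i ^+ (2 ^ k)))
              + \sum_i c i / (1 - (- s) * b i ^+ (2 ^ k))).
  rewrite -big_split mulr_sumr /=; apply: eq_bigr => i _.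
  rewrite -ss expnS mulnC exprM; set u := b i ^+ (2 ^ k).
  have u1 : nm u != 1.
    by rewrite nmX pexpr_eq1 ?expn_gt0 ?nm_ge0 //; apply/eqP; exact: b1.
  have su (e : R[i]) : nm e = 1 -> 1 - e * u != 0.
    move=> e1; apply: contra u1; rewrite subr_eq0 => /eqP h.
    by have := nm1 R; rewrite h nmM e1 mul1r => ->.
  have h3 := su s s1; have := su (- s); rewrite nmN => /(_ s1) h4.
  have h5 : 1 - s ^+ 2 * u ^+ 2 != 0.
    have -> : 1 - s ^+ 2 * u ^+ 2 = (1 - s * u) * (1 - - s * u) by ring.
    by rewrite mulf_neq0.
  by field; rewrite h4 h3 exprMn h5.
have n2 : nm (2^-1 : R[i]) = 2^-1.
  by rewrite nmV nm_nat.
rewrite nmM n2; have := nmD (\sum_i c i / (1 - s * b i ^+ (2 ^ k)))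
  (\sum_i c i / (1 - (- s) * b i ^+ (2 ^ k))).
move: (nm (_ + _)) => x hx; lra.
Qed.

Lemma pow2_small (c e : R) : 0 <= c -> c < 1 -> 0 < e ->
  \forall k \near \oo, c ^+ (2 ^ k) <= e.
Proof.
move=> c0 c1 e0; apply: filterS (expr_small c0 c1 e0) => k; apply: le_trans.
by rewrite ler_wiXn2l // ?ltW // ltnW // ltn_expl.
Qed.

(** A substitute for Cauchy's integral formula: as the [b i] are squared
    repeatedly, the summands with [nm (b i) < 1] tend to [c i] and the others to
    zero. *)
Lemma circle_residues n (c b : 'I_n -> R[i]) (A : R) :
  (forall i, nm (b i) <> 1) ->
  (forall t, nm t = 1 -> nm (\sum_i c i / (1 - t * b i)) <= A) ->
  nm (\sum_i (if nm (b i) < 1 then c i else 0)) <= A.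
Proof.
move=> b1 hA; apply/ler_addgt0Pr => e e0.
pose S : R := \sum_i nm (c i); have S0 : 0 <= S by rewrite sumr_ge0 // => i _; exact: nm_ge0.
pose d := e / (2 * (S + 1)); have d0 : 0 < d by rewrite divr_gt0 // mulr_gt0 // ltr_wpDl.
pose m := Num.min d (1 / 2); have m0 : 0 < m by rewrite lt_min d0 divr_gt0.
have md : m <= d by rewrite ge_min lexx.
have mh : m <= 1 / 2 by rewrite ge_min lexx orbT.
have tail (u : R[i]) : nm u <= m -> nm (u / (1 - u)) <= 2 * d.
  move=> um; rewrite nmM nmV; have h1 : 1 / 2 <= nm (1 - u).
    have := nmD (1 - u) u; rewrite subrK nm1; lra.
  have h2 : 0 < nm (1 - u) by apply: lt_le_trans h1; rewrite divr_gt0.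
  rewrite ler_pdivrMr //; have := nm_ge0 u; nra.
have [k hk] : exists k, forall i,
    nm (c i / (1 - 1 * b i ^+ (2 ^ k)) - (if nm (b i) < 1 then c i else 0))
      <= nm (c i) * (2 * d).
  suff : \forall k \near \oo, forall i : 'I_n,
      nm (c i / (1 - 1 * b i ^+ (2 ^ k)) - (if nm (b i) < 1 then c i else 0))
      <= nm (c i) * (2 * d) by case=> k _ /(_ k (leqnn k)); exists k.
  apply: filter_forall => i; have [bi|bi] := ltP (nm (b i)) 1.
    apply: filterS (pow2_small (nm_ge0 (b i)) bi m0) => k hk.
    rewrite mul1r; set u := b i ^+ _ in hk *.
    have um : nm u <= m by rewrite nmX.
    have u1 : 1 - u != 0.
      apply/eqP => h; move: um; have -> : u = 1 by move/eqP: h; rewrite subr_eq0 => /eqP <-.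
      by rewrite nm1; lra.
    have -> : c i / (1 - u) - c i = c i * (u / (1 - u)) by field.
    by rewrite nmM ler_wpM2l ?nm_ge0 ?tail.
  have bi1 : 1 < nm (b i) by rewrite lt_neqAle bi andbT eq_sym; apply/eqP; exact: b1.
  have bi0 : (nm (b i))^-1 < 1 by rewrite invf_lt1 // (lt_trans ltr01).
  have bi2 : 0 <= (nm (b i))^-1 by rewrite invr_ge0 nm_ge0.
  apply: filterS (pow2_small bi2 bi0 m0) => k hk.
  rewrite mul1r subr0; set u := b i ^+ _.
  have um : nm (u^-1) <= m by rewrite nmV nmX -exprVn.
  have u0 : u != 0.
    apply/eqP => h; have : nm u = 0 by rewrite h nm0.
    rewrite nmX => /eqP; rewrite expf_eq0 => /andP[_ /eqP h2].
    by move: bi1; rewrite h2 ltr10.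
  have u1 : 1 - u^-1 != 0.
    apply/eqP => h; move: um; have -> : u^-1 = 1 by move/eqP: h; rewrite subr_eq0 => /eqP <-.
    by rewrite nm1; lra.
  have u2 : 1 - u != 0.
    apply: contra u1 => /eqP h; move/eqP: h; rewrite subr_eq0 => /eqP <-.
    by rewrite invr1 subrr.
  have u3 : u - 1 != 0 by rewrite -oppr_eq0 opprB.
  have -> : c i / (1 - u) = - (c i * (u^-1 / (1 - u^-1))).
    by field; rewrite u0 u2 u3.
  by rewrite nmN nmM ler_wpM2l ?nm_ge0 ?tail.
have h1 := root_doubling b1 hA k (nm1 R).
set X := \sum_i _ in h1; set Y := \sum_i _.
have h2 : nm (X - Y) <= e.
  rewrite /X /Y -sumrB; apply: (le_trans (nm_sum _ _ _)).
  apply: (@le_trans _ _ (\sum_i nm (c i) * (2 * d))); first exact: ler_sum.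
  rewrite -mulr_suml -/S /d.
  have -> : S * (2 * (e / (2 * (S + 1)))) = e * (S / (S + 1)).
    by field; rewrite gt_eqF // ltr_wpDl.
  by rewrite ler_piMr ?(ltW e0) // ler_pdivrMr ?ltr_wpDl // mul1r lerDl.
have h3 := nm_dist_tri X Y 0; rewrite !subr0 nm_distC in h3.
lra.
Qed.

(** Cauchy's estimate inside a circle for a rational function with simple poles
    outside of it.  The value at [w] is a residue of the quotient by [z - w],
    which [circle_residues] bounds after mapping the circle to the unit circle. *)
Lemma rational_max n (c a : 'I_n -> R[i]) (m w : R[i]) (r A : R) :
  0 < r -> w != m -> nm (w - m) < r ->
  (forall i, c i = 0 \/ r < nm (a i - m)) ->
  (forall z, nm (z - m) = r -> nm (\sum_i c i / (z - a i)) <= A) ->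
  nm (\sum_i c i / (w - a i)) <= A * (r / (r - nm (w - m))).
Proof.
move=> r0 wm wr ca hA.
have rC : r%:C != 0 :> R[i] by rewrite (inj_eq (@complexI R)) gt_eqF.
pose al i := (a i - m) / r%:C; pose om := (w - m) / r%:C.
have nmr : nm (r%:C : R[i]) = r by rewrite nm_real gtr0_norm.
have om1 : nm om < 1 by rewrite nmM nmV nmr ltr_pdivrMr // mul1r.
have om0 : om != 0 by rewrite mulf_neq0 ?invr_eq0 ?subr_eq0.
have nom0 : 0 < nm om.
  by rewrite lt_neqAle nm_ge0 andbT eq_sym; apply: contra om0 => /eqP/nm_eq0 ->.
have al1 i : c i != 0 -> 1 < nm (al i).
  have [->|h _] := ca i; first by rewrite eqxx.
  by rewrite nmM nmV nmr ltr_pdivlMr // mul1r.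
(* Partial fractions of the rational function divided by z - w, in the variable
   t with z = m + r t; the last index carries the pole at w. *)
pose e i := c i / r%:C / (al i - om).
pose C (i : 'I_n.+1) := if unlift ord_max i is Some j then - e j else \sum_j e j.
pose B (i : 'I_n.+1) : R[i] := if unlift ord_max i is Some j then
   (if c j == 0 then 0 else (al j)^-1) else om^-1.
have splitS (F : 'I_n.+1 -> R[i]) : \sum_i F i = (\sum_j F (lift ord_max j)) + F ord_max.
  rewrite big_ord_recr /=; congr (_ + _); apply: eq_bigr => i _.
  by congr F; apply/val_inj; rewrite [RHS]lift_max.
have Blt j : nm (B (lift ord_max j)) < 1.
  rewrite /B liftK; have [_|cj0] := eqVneq; first by rewrite nm0 ltr01.
  by rewrite nmV invf_lt1 ?al1 // (lt_trans ltr01) // al1.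
have Bgt : 1 < nm (B ord_max).
  by rewrite /B unlift_none nmV invf_gt1.
have B1 i : nm (B i) <> 1.
  have [j ->|->] := unliftP ord_max i; first by apply/eqP; rewrite lt_eqF.
  by apply/eqP; rewrite gt_eqF.
have main t : nm t = 1 -> nm (\sum_i C i / (1 - t * B i)) <= A * (r / (r - nm (w - m))).
  move=> t1; pose z := m + r%:C * t.
  have zm : nm (z - m) = r by rewrite addrC addKr nmM nmr t1 mulr1.
  have tom : t - om != 0.
    by apply/eqP => /eqP; rewrite subr_eq0 => /eqP h; move: om1; rewrite -h t1 ltxx.
  have -> : \sum_i C i / (1 - t * B i) = (\sum_i c i / (z - a i)) * (t / (t - om)).
    rewrite splitS /C /B unlift_none mulr_suml (mulr_suml _ _ _ (1 - t * om^-1)^-1) -big_split /=.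
    apply: eq_bigr => i _; rewrite liftK.
    have [ci|ci] := eqVneq (c i) 0; first by rewrite /e ci !(mul0r, mulr0, oppr0, addr0).
    have al2 := al1 i ci.
    have al0 : al i != 0 by apply/eqP => h; move: al2; rewrite h nm0 ltr10.
    have alom : al i - om != 0.
      apply/eqP => /eqP; rewrite subr_eq0 => /eqP h.
      by move: (lt_trans om1 al2); rewrite h ltxx.
    have tal : t - al i != 0.
      by apply/eqP => /eqP; rewrite subr_eq0 => /eqP h; move: al2; rewrite -h t1 ltxx.
    have tal' : al i - t != 0 by rewrite -oppr_eq0 opprB.
    have tom' : om - t != 0 by rewrite -oppr_eq0 opprB.
    have -> : z - a i = r%:C * (t - al i).
      by rewrite mulrBr /al mulrCA divff // mulr1 /z; ring.
    rewrite /e; field.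
    by rewrite !(rC, al0, alom, tal, tal', tom, tom', om0).
  rewrite nmM; apply: ler_pM; rewrite ?nm_ge0 ?hA //.
  rewrite nmM nmV t1 mul1r -[leRHS]invrK invf_div lef_pV2 ?posrE; last first.
  - by rewrite divr_gt0 // subr_gt0.
  - rewrite lt_neqAle nm_ge0 andbT eq_sym.
    by apply: contra tom => /eqP/nm_eq0 ->.
  have -> : (r - nm (w - m)) / r = 1 - nm om.
    by rewrite mulrBl divff ?gt_eqF // nmM nmV nmr.
  by have := nmD (t - om) om; rewrite subrK t1; lra.
have := circle_residues B1 main; rewrite splitS (ltNge (nm (B ord_max))) (ltW Bgt) addr0.
congr (nm _ <= _); apply: eq_bigr => i _; rewrite Blt /C liftK /e.
have [ci|ci] := eqVneq (c i) 0; first by rewrite ci !mul0r oppr0.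
have wa : w - a i = r%:C * (om - al i).
  by rewrite mulrBr /al /om !(mulrCA r%:C) !divff // !mulr1; ring.
have alom : al i - om != 0.
  apply/eqP => /eqP; rewrite subr_eq0 => /eqP h.
  by move: (lt_trans om1 (al1 i ci)); rewrite h ltxx.
have alom' : om - al i != 0 by rewrite -oppr_eq0 opprB.
by rewrite wa; field; rewrite !(rC, alom, alom').
Qed.

End Rational.

(** * The part of the spectrum inside a circle of regular points *)

Section Circle.
Variables (R : realType) (G : topologicalZmodType).
Hypothesis compactG : compact [set: G].
Variable L : (G -> R[i]) -> R[i].
Hypothesis qL : quadrature L.
Implicit Types (f : G -> R[i]) (m r : R).

Lemma circle_compact m r : compact [set p : R * R | nm ((p.1 +i* p.2) - m%:C) = r].
Proof.
apply: (@subclosed_compact _ _ (`[m - r, m + r] `*` `[- r, r])).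
- rewrite (_ : mkset _ = (fun p : R * R => Num.sqrt ((p.1 - m) * (p.1 - m) + p.2 * p.2)) @^-1` [set r]).
    apply: closed_comp; last exact: closed_eq.
    move=> p _; apply: continuous_comp; last exact: sqrt_continuous.
    by apply: cvgD; apply: cvgM; try exact: cvg_snd;
      apply: cvgB; by [exact: cvg_fst|exact: cvg_cst].
  by apply/seteqP; split => -[a b] /=; rewrite /nm /= oppr0 addr0 !expr2.
- by apply: compact_setX; exact: segment_compact.
- case=> a b h; have {}h : nm ((a +i* b) - m%:C) = r := h.
  split => /=; rewrite in_itv /=.
    have := nm_Re ((a +i* b) - m%:C); rewrite h ReB /= ler_norml => /andP[h1 h2].
    by apply/andP; split; lra.
  have := nm_Im ((a +i* b) - m%:C); rewrite h ImB /= subr0 ler_norml => /andP[h1 h2].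
  by apply/andP; split; lra.
Qed.

(** The local bounds of [regular_lower], made uniform by compactness. *)
Lemma circle_lower m r : (forall z, nm (z - m%:C) = r -> regular L z) ->
  exists2 M, 0 < M & forall z, nm (z - m%:C) = r -> forall f b, ucont f ->
    (forall x, nm (act L (z%:P - 'X) f x) <= b) -> forall x, nm (f x) <= M * b.
Proof.
move=> reg.
pose P M (p : R * R) := forall f b, ucont f ->
    (forall x, nm (act L ((p.1 +i* p.2)%:P - 'X) f x) <= b) ->
    forall x, nm (f x) <= M * b.
have [M0 [M0r hM]] : \forall M \near +oo, [set p : R * R | nm ((p.1 +i* p.2) - m%:C) = r] `<=` P M.
  have cc : near_covering [set p : R * R | nm ((p.1 +i* p.2) - m%:C) = r].
    by apply/compact_near_coveringP; exact: circle_compact.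
  apply: cc.
  move=> [a b] pr.
  have [M [d [Mgt0 d0 h]]] := regular_lower compactG qL (reg (a +i* b) pr).
  exists (ball a (d / 2) `*` ball b (d / 2), [set N | M < N]) => /=.
    split; last by exists M; split => //; exact: num_real.
    have d2 : 0 < d / 2 by rewrite divr_gt0.
    by exists (ball a (d / 2), ball b (d / 2)) => //=; split; exact: nbhsx_ballx.
  case=> -[a' b'] N /= [[ha hb] MN] f e cf fe x.
  apply: (@le_trans _ _ (M * e)).
    apply: (h (a' +i* b')) => //.
    apply: (le_trans (nm_le_ReIm _)); rewrite ReB ImB /= [leRHS]splitr.
    move: ha hb; rewrite -!ball_normE /= => /ltW ha /ltW hb.
    by rewrite distrC [X in _ + X]distrC lerD.
  rewrite ler_wpM2r // ?(ltW MN) //.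
  by apply: le_trans (fe 0); exact: nm_ge0.
pose M := `|M0| + 1.
have MM0 : M0 < M by rewrite /M (le_lt_trans (ler_norm _)) // ltrDl.
exists M; first by rewrite /M ltr_wpDl.
move=> [a b] zr f e cf; exact: (hM M MM0 (a, b) zr f e cf).
Qed.

Variable H : (G -> R[i]) -> R[i].
Hypothesis qH : quadrature H.
Hypothesis invH : forall f a, ucont f -> H (fun x => f (a + x)) = H f.
Hypothesis hausdorffG : hausdorff_space G.

Hypothesis real_spectrum : forall z, complex.Im z != 0 -> regular L z.

(** A Fourier-Stieltjes transform vanishing at infinity takes large values at
    finitely many characters only. *)
Hypothesis vanishing : forall d : R, 0 < d -> exists n (e : 'I_n -> G -> R[i]),
  [/\ forall i, character (e i), orthonormal H e &
      forall g, character g -> d <= nm (L g) -> exists i, g = e i].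

(** If the powers of the measure are singular, subtracting a measure with a
    density from a combination of them can only increase the norm. *)
Hypothesis separated : forall p g (C : R), ucont g ->
  (forall f b, ucont f -> (forall x, nm (f x) <= b) ->
     nm (act L p f 0 - H (fun y => f y * g y)) <= C * b) -> opnorm_le L p C.

Lemma char_real g : character g -> complex.Im (L g) = 0.
Proof.
move=> [cg gM g1]; apply/eqP; apply: contraT => /real_spectrum.
by move/(regular_char qL cg gM g1).
Qed.

Lemma act_trigpoly p n (c : 'I_n -> R[i]) (g : 'I_n -> G -> R[i]) x :
  (forall i, character (g i)) ->
  act L p (trigpoly c g) x = trigpoly (fun i => c i * p.[L (g i)]) g x.
Proof.
move=> cg; rewrite (act_sum qL) => [|i]; last by case: (cg i).
apply: eq_bigr => i _; have [ug gM _] := cg i.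
by rewrite (act_char qL) // mulrA.
Qed.

(** Off the characters with eigenvalue in the disc, resolvents are bounded inside
    the circle by the maximum principle for rational functions.  As zero lies
    outside, those characters are finitely many, and they span functions with
    densities, which do not affect the norm. *)
Lemma spectral_gap m r x : 0 < r -> r < `|m| ->
  (forall z, nm (z - m%:C) = r -> regular L z) ->
  `|x - m| < r -> regular L x%:C.
Proof.
move=> r0 rm reg xr.
have [M0 M00 hM0] := circle_lower reg.
have dpos : 0 < `|m| - r by rewrite subr_gt0.
have [n [e [ce oe he]]] := vanishing dpos.
have ue i : ucont (e i) by case: (ce i).
pose inside (g : G -> R[i]) := nm (L g - m%:C) < r.
have inside_e g : character g -> inside g -> exists i, g = e i.
  move=> cg ig; apply: he => //.
  have := nm_dist_tri (L g) m%:C 0; rewrite !subr0 nm_real nm_distC.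
  by move: ig; rewrite /inside; lra.
pose a i : R[i] := if inside (e i) then 1 else 0.
have a1 i : nm (a i) <= 1 by rewrite /a; case: ifP; rewrite ?nm1 ?nm0 ?ler01.
(* The projection onto the characters with eigenvalue in the disc. *)
pose P f := trigpoly (fun i => a i * ip H f (e i)) e.
have uP f : ucont (P f) by apply: ucont_sum => i; exact: ucontZ.
have ip_le f g b : ucont f -> character g -> (forall y, nm (f y) <= b) -> nm (ip H f g) <= b.
  move=> cf [cg _ g1] fb; apply: (quad_le qH) => [|y].
    by apply: ucontM => //; exact: ucont_cj.
  by rewrite nmM nm_cj g1 mulr1.
have P_le f b y : ucont f -> (forall y, nm (f y) <= b) -> nm (f y - P f y) <= n.+1%:R * b.
  move=> cf fb; apply: (le_trans (nmB _ _)); rewrite -natr1 mulrDl mul1r addrC.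
  apply: lerD => //; apply: (le_trans (nm_sum _ _ _)).
  rewrite mulr_natl -[n in leRHS]card_ord -sumr_const; apply: ler_sum => i _.
  have [_ _ e1] := ce i; rewrite !nmM e1 mulr1 -[leRHS]mul1r.
  by apply: ler_pM; rewrite ?nm_ge0 ?ip_le.
have P_lin f g y : ucont f -> ucont g ->
    P (fun y => f y - g y) y = P f y - P g y.
  move=> cf cg; rewrite /P /trigpoly -sumrB; apply: eq_bigr => i _.
  by rewrite (ipB compactG qH) //; ring.
have P_char g y : character g -> P g y = (if inside g then 1 else 0) * g y.
  move=> cg; have [[i0 gi]|/forallNP gne] := pselect (exists i, g = e i).
    rewrite /P /trigpoly gi (bigD1 i0) //= oe.2 eqxx mulr1 big1 ?addr0 // => i ii.
    by rewrite oe.2 eq_sym (negbTE ii) mulr0 mul0r.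
  rewrite /P /trigpoly big1 => [|i _].
    by case: ifP => [/(inside_e _ cg)[i /gne//]|_]; rewrite mul0r.
  rewrite (@char_orthogonal _ _ compactG H qH invH g (e i)) ?mulr0 ?mul0r //.
pose rho := (`|x - m| + r) / 2.
have rho0 : 0 <= rho by rewrite /rho; have := normr_ge0 (x - m); lra.
have rhor : rho < r by rewrite /rho; lra.
pose C := M0 * 2 * n.+1%:R * (r / (r - rho)).
have C0 : 0 < C by rewrite !mulr_gt0 ?ltr0Sn // ?invr_gt0 subr_gt0.
(* Approximate inverses are uniformly bounded near x.  By separation it suffices
   to bound them on f - P f, where their values are rational functions of w with
   poles outside the circle. *)
have key w q : complex.Im w != 0 -> nm (w - m%:C) <= rho ->
    opnorm_le L (1 - q * (w%:P - 'X)) 1 -> opnorm_le L q C.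
  move=> wi wr hq; have [D D0 qD] := opnorm_le_ex qL q.
  pose g y := \sum_i (a i * q.[L (e i)]) * cj (e i y).
  have ug : ucont g by apply: ucont_sum => i; apply: ucontZ; exact: ucont_cj.
  apply: (@separated q g C ug) => f b cf fb.
  have -> : H (fun y => f y * g y) = act L q (P f) 0.
    rewrite act_trigpoly // /trigpoly.
    transitivity (H (fun y => \sum_i (a i * q.[L (e i)]) * (f y * cj (e i y)))).
      by congr H; apply/funext => y; rewrite mulr_sumr; apply: eq_bigr => i _; ring.
    have cfe i : ucont (fun y => f y * cj (e i y)).
      by apply: ucontM => //; exact: ucont_cj.
    rewrite (quad_sum qH) => [|i]; last exact: ucontZ.
    apply: eq_bigr => i _; rewrite (quadZ qH) // char0 // mulr1 /ip.
    by rewrite mulrAC.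
  rewrite -(act_subf qL) //.
  apply/ler_addgt0Pr => eps eps0.
  pose eta := eps / (C + D * n.+1%:R).
  have CD0 : 0 < C + D * n.+1%:R by rewrite addr_gt0 // mulr_gt0 // ltr0Sn.
  have eta0 : 0 < eta by rewrite divr_gt0.
  have [N [c [h [ch fh]]]] := trigpoly_dense compactG hausdorffG qH invH cf eta0.
  set psi := trigpoly c h in fh.
  have uh i : ucont (h i) by case: (ch i).
  have upsi : ucont psi by apply: ucont_sum => i; exact: ucontZ.
  pose c1 i := (if inside (h i) then 0 else 1) * c i.
  have psi1E y : psi y - P psi y = trigpoly c1 h y.
    have -> : P psi y = \sum_i c i * P (h i) y.
      rewrite /P /trigpoly /psi.
      transitivity (\sum_i \sum_j c j * (a i * ip H (h j) (e i) * e i y)).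
        apply: eq_bigr => i _; rewrite (ip_sum compactG qH) //; last first.
          by move=> j; exact: ucontZ.
        rewrite mulr_sumr mulr_suml; apply: eq_bigr => j _.
        by rewrite (ipZ compactG qH) //; ring.
      by rewrite exchange_big /=; apply: eq_bigr => j _; rewrite mulr_sumr.
    rewrite /psi /trigpoly -sumrB; apply: eq_bigr => i _.
    by rewrite P_char // /c1; case: ifP => _; ring.
  have psib y : nm (psi y) <= b + eta.
    have := nmD (psi y - f y) (f y); rewrite subrK; have := fh y; rewrite nm_distC.
    by have := fb y; lra.
  have trig_bound : nm (act L q (trigpoly c1 h) 0) <= C * (b + eta).
    pose c2 i := c1 i * (q * (w%:P - 'X)).[L (h i)].
    have cu1 : ucont (trigpoly c1 h) by apply: ucont_sum => i; exact: ucontZ.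
    have B1 y : nm (trigpoly c1 h y) <= n.+1%:R * (b + eta).
      by rewrite -psi1E; exact: P_le.
    have B2 y : nm (trigpoly c2 h y) <= 2 * (n.+1%:R * (b + eta)).
      rewrite -act_trigpoly //.
      have := hq _ _ cu1 B1 y; rewrite actB act1 mul1r nm_distC => h1.
      have := nmD (act L (q * (w%:P - 'X)) (trigpoly c1 h) y - trigpoly c1 h y)
        (trigpoly c1 h y); rewrite subrK; have := B1 y; lra.
    have himg i : complex.Im (L (h i)) = 0 by exact: char_real.
    have -> : act L q (trigpoly c1 h) 0 = \sum_i c2 i / (w - L (h i)).
      rewrite act_trigpoly // /trigpoly; apply: eq_bigr => i _.
      rewrite char0 // mulr1 /c2 !(hornerM, hornerD, hornerN, hornerC, hornerX) mulrA mulfK // subr_eq0.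
      by apply: contra wi => /eqP ->; rewrite himg.
    have nm_w : nm (w - m%:C) < r by apply: le_lt_trans rhor.
    have wm : w != m%:C by apply: contra wi => /eqP ->.
    have AB : 0 <= M0 * (2 * (n.+1%:R * (b + eta))).
      have := B2 0; rewrite -(ler_pM2l M00) => /(le_trans _); apply.
      by rewrite mulr_ge0 ?nm_ge0 // ltW.
    have /le_trans-> // : nm (\sum_i c2 i / (w - L (h i)))
        <= M0 * (2 * (n.+1%:R * (b + eta))) * (r / (r - nm (w - m%:C))).
      apply: rational_max => //.
        move=> i; rewrite /c2 /c1 /inside; case: ltP => [_|hi].
          by left; rewrite !mul0r.
        right; rewrite lt_neqAle hi andbT; apply/eqP => hr.
        by have [ui hiM hi1] := ch i; apply: (regular_char qL ui hiM hi1); exact: reg.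
      move=> z zr.
      have zn i : z != L (h i).
        apply/eqP => zh; have [ui hiM hi1] := ch i.
        by apply: (regular_char qL ui hiM hi1); rewrite -zh; exact: reg.
      have cz : ucont (trigpoly (fun i => c2 i / (z - L (h i))) h).
        by apply: ucont_sum => i; exact: ucontZ.
      have := hM0 z zr _ _ cz _ 0.
      rewrite {2}/trigpoly.
      under eq_bigr do rewrite char0 // mulr1; apply => y.
      rewrite act_trigpoly //; have := B2 y; congr (nm _ <= _).
      apply: eq_bigr => i _; rewrite !hornerE divfK // subr_eq0; exact: zn.
    have -> : C * (b + eta) = M0 * (2 * (n.+1%:R * (b + eta))) * (r / (r - rho)).
      by rewrite /C; ring.
    apply: ler_wpM2l => //.
    apply: ler_wpM2l; first exact: ltW.
    by rewrite lef_pV2 ?posrE ?subr_gt0 // lerD2l lerN2.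
  have diff : nm (act L q (fun y => (f y - P f y) - trigpoly c1 h y) 0)
      <= D * (n.+1%:R * eta).
    have -> : (fun y => (f y - P f y) - trigpoly c1 h y)
        = fun y => (f y - psi y) - P (fun y => f y - psi y) y.
      by apply/funext => y; rewrite -psi1E P_lin //; ring.
    apply: qD => [|y]; first by apply: ucontB => //; exact: ucontB.
    by apply: P_le => //; exact: ucontB.
  have cu1 : ucont (trigpoly c1 h) by apply: ucont_sum => i; exact: ucontZ.
  have cuP : ucont (fun y => f y - P f y) by exact: ucontB.
  rewrite (act_subf qL) // in diff.
  have h1 := nmD (act L q (fun y => f y - P f y) 0 - act L q (trigpoly c1 h) 0)
    (act L q (trigpoly c1 h) 0).
  rewrite subrK in h1.
  have h2 : C * eta + D * (n.+1%:R * eta) = eps.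
    by rewrite (mulrA D) -mulrDl /eta mulrCA divff ?mulr1 ?gt_eqF.
  rewrite mulrDr in trig_bound; lra.
(* Just above x the point w is regular, and the bound C makes an approximate
   inverse at w one at x too. *)
pose t := Num.min (rho - `|x - m|) (1 / 4 / C).
have rx : 0 < rho - `|x - m| by rewrite /rho; lra.
have t0 : 0 < t by rewrite lt_min rx !divr_gt0.
have tr : t <= rho - `|x - m| by rewrite ge_min lexx.
have tC : t * C <= 1 / 4 by rewrite -ler_pdivlMr // ge_min lexx orbT.
pose w : R[i] := x +i* t.
have wi : complex.Im w != 0 by rewrite gt_eqF.
have wm : nm (w - m%:C) <= rho.
  apply: (le_trans (nm_le_ReIm _)); rewrite ReB ImB /= subr0 (gtr0_norm t0); lra.
have [q hq] := regular_approx qL (real_spectrum wi) (divr_gt0 ltr01 (ltr0n R 2)).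
have qC : opnorm_le L q C by apply: (key w) => //; apply: opnorm_le_mono hq _; lra.
exists q, (1 / 2 + nm (w - x%:C) * C); split; last exact: regular_perturb.
have -> : nm (w - x%:C) = t.
  by rewrite /nm /= subrr expr0n /= add0r subr0 sqrtr_sqr gtr0_norm.
lra.
Qed.

End Circle.

(** * Integrals of bounded measurable functions *)

Section Bounded.
Context d (T : measurableType d) (R : realType).
Implicit Types (m : {finite_measure set T -> \bar R}) (h k : T -> R).

Definition bmeas h := measurable_fun [set: T] h /\ exists B, forall x, `|h x| <= B.

Lemma bmeas_int m h : bmeas h -> m.-integrable [set: T] (EFin \o h).
Proof.
move=> [mh [B hB]]; apply: measurable_bounded_integrable => //.
  by rewrite ltey_eq fin_num_measure.
exists B; split; first exact: num_real.
by move=> M BM x _; apply: (le_trans (hB x)); exact: ltW.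
Qed.

Lemma bmeasD h k : bmeas h -> bmeas k -> bmeas (fun x => h x + k x).
Proof.
move=> [mh [B hB]] [mk [C kC]]; split; first exact: measurable_funD.
by exists (B + C) => x; apply: (le_trans (ler_normD _ _)); exact: lerD.
Qed.

Lemma bmeas_cst (c : R) : bmeas (fun=> c).
Proof. by split; [exact: measurable_cst|exists `|c|]. Qed.

Lemma bmeasM h k : bmeas h -> bmeas k -> bmeas (fun x => h x * k x).
Proof.
move=> [mh [B hB]] [mk [C kC]]; split; first exact: measurable_funM.
exists (B * C) => x; rewrite normrM; exact: ler_pM.
Qed.

Lemma bmeasZ c h : bmeas h -> bmeas (fun x => c * h x).
Proof. by move=> bh; apply: bmeasM => //; exact: bmeas_cst. Qed.

Lemma bmeasB h k : bmeas h -> bmeas k -> bmeas (fun x => h x - k x).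
Proof.
move=> bh bk; apply: bmeasD => //; have := bmeasZ (-1) bk; congr bmeas.
by apply/funext => x; rewrite mulN1r.
Qed.

Lemma bmeas_indic (A : set T) : measurable A -> bmeas (\1_A : T -> R).
Proof.
move=> mA; split; first exact: measurable_indic.
by exists 1 => x; rewrite indicE; case: (_ \in _); rewrite /= ?normr1 ?normr0 ?ler01.
Qed.

Lemma bmeas_sum (I : Type) (s : seq I) (F : I -> T -> R) :
  (forall i, bmeas (F i)) -> bmeas (fun x => \sum_(i <- s) F i x).
Proof.
move=> bF; elim: s => [|i s IH].
  by have := bmeas_cst 0; congr bmeas; apply/funext => x; rewrite big_nil.
have := bmeasD (bF i) IH; congr bmeas.
by apply/funext => x; rewrite big_cons.
Qed.

Lemma intD m h k : bmeas h -> bmeas k ->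
  \int[m]_x (h x + k x) = \int[m]_x h x + \int[m]_x k x.
Proof. by move=> bh bk; apply: RintegralD => //; exact: bmeas_int. Qed.

Lemma intB m h k : bmeas h -> bmeas k ->
  \int[m]_x (h x - k x) = \int[m]_x h x - \int[m]_x k x.
Proof. by move=> bh bk; apply: RintegralB => //; exact: bmeas_int. Qed.

Lemma intZ m c h : bmeas h -> \int[m]_x (c * h x) = c * \int[m]_x h x.
Proof. by move=> bh; apply: RintegralZl => //; exact: bmeas_int. Qed.

Lemma int_cst m (c : R) : \int[m]_x (fun=> c) x = c * fine (m setT).
Proof. exact: Rintegral_cst. Qed.

Lemma int_indic m (A : set T) : measurable A -> \int[m]_x \1_A x = fine (m A).
Proof. by move=> mA; rewrite /Rintegral integral_indic // setIT. Qed.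

Lemma int_sum m (I : Type) (s : seq I) (F : I -> T -> R) :
  (forall i, bmeas (F i)) ->
  \int[m]_x (\sum_(i <- s) F i x) = \sum_(i <- s) \int[m]_x F i x.
Proof.
move=> bF; elim: s => [|i s IH].
  rewrite big_nil; under eq_Rintegral do rewrite big_nil.
  by rewrite (int_cst m 0) mul0r.
rewrite big_cons -IH -intD //; last exact: bmeas_sum.
by under eq_Rintegral do rewrite big_cons.
Qed.

Lemma le_int m h k : bmeas h -> bmeas k -> (forall x, h x <= k x) ->
  \int[m]_x h x <= \int[m]_x k x.
Proof. by move=> bh bk hk; apply: le_Rintegral => //; exact: bmeas_int. Qed.

Lemma int_le m h (B : R) : bmeas h -> (forall x, `|h x| <= B) ->
  `|\int[m]_x h x| <= B * fine (m setT).
Proof.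
move=> bh hB; rewrite ler_norml; apply/andP; split.
  rewrite -mulNr -(int_cst m (- B)); apply: le_int => //; first exact: bmeas_cst.
  by move=> x; have := hB x; rewrite ler_norml => /andP[].
rewrite -(int_cst m B); apply: le_int => //; first exact: bmeas_cst.
by move=> x; have := hB x; rewrite ler_norml => /andP[].
Qed.

Definition level h n (i : 'I_n) : set T := [set x | i%:R / n%:R < h x].

Lemma level_measurable h n (i : 'I_n) : measurable_fun [set: T] h ->
  measurable (level h i).
Proof.
move=> mh; rewrite /level -[X in measurable X]setTI.
have -> : [set x | i%:R / n%:R < h x] = h @^-1` `]i%:R / n%:R, +oo[.
  by apply/seteqP; split => x /=; rewrite in_itv /= andbT.
exact: mh.
Qed.

Definition steps h n : T -> R := fun x => n%:R^-1 * \sum_(i < n) \1_(level h i) x.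

(** A function with values in the unit interval is an average of indicators of
    its strict upper level sets, up to the width of a level. *)
Lemma steps_close h n x : (0 < n)%N -> 0 <= h x <= 1 ->
  `|h x - steps h n x| <= n%:R^-1.
Proof.
move=> n0 /andP[h0 h1]; have nR : 0 < n%:R :> R by rewrite ltr0n.
pose y := n%:R * h x.
have aux q : (0 <= \sum_(i < q) ((i%:R < y)%R%:R : R) - Num.min y q%:R <= 1) /\
    (q%:R <= y -> \sum_(i < q) ((i%:R < y)%R%:R : R) = q%:R).
  have y0 : 0 <= y by rewrite mulr_ge0 // ltW.
  elim: q => [|q [IH1 IH2]].
    by rewrite big_ord0 min_r // subrr lexx ler01.
  rewrite big_ord_recr /= -natr1; have [qy|yq] := ltP (q%:R) y.
    rewrite (IH2 (ltW qy)); split => //.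
    by rewrite minEle; case: ifP => h2 /=; apply/andP; split; lra.
  split; last by move=> h2; exfalso; lra.
  move: IH1; rewrite addr0 !minEle.
  have -> : y <= q%:R + 1 by lra.
  by rewrite yq.
have [/andP[a1 a2] _] := aux n.
have ym : Num.min y n%:R = y by rewrite minEle /y ler_piMr // ltW.
rewrite ym in a1 a2.
have -> : h x - steps h n x = n%:R^-1 * (y - \sum_(i < n) ((i%:R < y)%R%:R : R)).
  rewrite mulrBr /y mulrA mulVf ?gt_eqF // mul1r /steps; congr (_ - _ * _).
  apply: eq_bigr => i _; rewrite indicE; congr (nat_of_bool _)%:R.
  apply/idP/idP => [|lt]; first by rewrite inE /level /= ltr_pdivrMr // mulrC.
  by rewrite inE /level /= ltr_pdivrMr // mulrC.
rewrite normrM (@ger0_norm _ n%:R^-1) ?invr_ge0 // ler_piMr ?invr_ge0 //.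
by rewrite ler_norml; apply/andP; split; lra.
Qed.

Lemma bmeas_steps h n : measurable_fun [set: T] h -> bmeas (steps h n).
Proof.
move=> mh; apply: bmeasZ; apply: bmeas_sum => i; apply: bmeas_indic.
exact: level_measurable.
Qed.

Lemma int_steps m h n : measurable_fun [set: T] h ->
  \int[m]_x steps h n x = n%:R^-1 * \sum_(i < n) fine (m (level h i)).
Proof.
move=> mh; have bi (i : 'I_n) : bmeas (\1_(level h i) : T -> R).
  by apply: bmeas_indic; exact: level_measurable.
rewrite intZ; last exact: bmeas_sum.
rewrite int_sum //; congr (_ * _); apply: eq_bigr => i _.
by rewrite int_indic //; exact: level_measurable.
Qed.

Lemma int_steps_close m h n : measurable_fun [set: T] h -> (0 < n)%N ->
  (forall x, 0 <= h x <= 1) ->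
  `|\int[m]_x h x - n%:R^-1 * \sum_(i < n) fine (m (level h i))|
    <= n%:R^-1 * fine (m setT).
Proof.
move=> mh n0 h01; rewrite -int_steps // -intB; last exact: bmeas_steps.
- apply: int_le => [|x]; last exact: steps_close.
  apply: bmeasB; last exact: bmeas_steps.
  by split => //; exists 1 => x; rewrite ger0_norm; case/andP : (h01 x).
- by split => //; exists 1 => x; rewrite ger0_norm; case/andP : (h01 x).
Qed.

(** Layer cake: such a function is nearly an average of indicators of level sets,
    so a bound on all sets passes to its integral. *)
Lemma comb_int_le (J : finType) (a : J -> R[i]) (m : J -> {finite_measure set T -> \bar R})
    (s : R) h :
  (forall A, measurable A -> nm (\sum_j a j * (fine (m j A))%:C) <= s) ->
  measurable_fun [set: T] h -> (forall x, 0 <= h x <= 1) ->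
  nm (\sum_j a j * (\int[m j]_x h x)%:C) <= s.
Proof.
move=> hs mh h01; apply/ler_addgt0Pr => e e0.
pose C := \sum_j nm (a j) * fine (m j setT).
have C0 : 0 <= C.
  by rewrite sumr_ge0 // => j _; rewrite mulr_ge0 ?nm_ge0 // fine_ge0.
pose N := (Num.bound (C / e)).+1.
have N0 : 0 < N%:R :> R by rewrite ltr0n.
pose z j := N%:R^-1 * \sum_(i < N) fine (m j (level h i)).
have h1 : nm (\sum_j a j * (\int[m j]_x h x)%:C - \sum_j a j * (z j)%:C) <= e.
  rewrite -sumrB; apply: (le_trans (nm_sum _ _ _)).
  apply: (@le_trans _ _ (N%:R^-1 * C)).
    rewrite /C mulr_sumr; apply: ler_sum => j _.
    rewrite -mulrBr -rmorphB nmM nm_real mulrCA ler_wpM2l ?nm_ge0 //.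
    exact: int_steps_close.
  rewrite mulrC ler_pdivrMr // mulrC -ler_pdivrMr //.
  apply: le_trans (ltW (archi_boundP _)) _; first by rewrite divr_ge0 // ltW.
  by rewrite ler_nat.
have h2 : nm (\sum_j a j * (z j)%:C) <= s.
  have -> : \sum_j a j * (z j)%:C
     = (N%:R^-1)%:C * \sum_(i < N) \sum_j a j * (fine (m j (level h i)))%:C.
    rewrite mulr_sumr; under [RHS]eq_bigr do rewrite mulr_sumr.
    rewrite exchange_big /=; apply: eq_bigr => j _.
    rewrite /z rmorphM rmorph_sum /= mulrCA mulr_sumr mulr_sumr.
    by apply: eq_bigr => i _; ring.
  rewrite nmM nm_real ger0_norm ?invr_ge0 // mulrC ler_pdivrMr //.
  apply: (le_trans (nm_sum _ _ _)).
  apply: (@le_trans _ _ (\sum_(i < N) s)).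
    by apply: ler_sum => i _; apply: hs; exact: level_measurable.
  by rewrite sumr_const card_ord mulr_natr.
by have := nmD (\sum_j a j * (\int[m j]_x h x)%:C - \sum_j a j * (z j)%:C)
  (\sum_j a j * (z j)%:C); rewrite subrK; lra.
Qed.

(** An affine change of variable brings a bounded function into the unit
    interval. *)
Lemma comb_int_eq0 (J : finType) (a : J -> R[i]) (m : J -> {finite_measure set T -> \bar R}) h :
  (forall A, measurable A -> \sum_j a j * (fine (m j A))%:C = 0) ->
  bmeas h -> \sum_j a j * (\int[m j]_x h x)%:C = 0.
Proof.
move=> hs [mh [B hB]]; pose C := `|B| + 1.
have C0 : 0 < C by rewrite ltr_wpDl.
have hC x : `|h x| <= C by rewrite (le_trans (hB x)) // (le_trans (ler_norm _)) // lerDl.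
pose k x := (h x + C) / (2 * C).
have C2 : 0 < 2 * C by rewrite mulr_gt0.
have mk : measurable_fun [set: T] k.
  apply: measurable_funM; last exact: measurable_cst.
  by apply: measurable_funD => //; exact: measurable_cst.
have k01 x : 0 <= k x <= 1.
  have := hC x; rewrite ler_norml => /andP[h1 h2]; rewrite /k.
  apply/andP; split; first by apply: divr_ge0; [lra|exact: ltW].
  by rewrite ler_pdivrMr // mul1r; lra.
have bk : bmeas k.
  by split => //; exists 1 => x; rewrite ger0_norm; case/andP : (k01 x).
have : nm (\sum_j a j * (\int[m j]_x k x)%:C) <= 0.
  by apply: comb_int_le => // A mA; rewrite hs // nm0.
rewrite le_eqVlt ltNge nm_ge0 orbF => /eqP/nm_eq0 k0.
have hk j : \int[m j]_x h x = 2 * C * \int[m j]_x k x - C * fine (m j setT).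
  rewrite -(int_cst (m j)) -intZ // -intB; last exact: bmeas_cst.
  - apply: eq_Rintegral => x _; rewrite /k; field; rewrite gt_eqF //.
  - exact: bmeasZ.
transitivity ((2 * C)%:C * (\sum_j a j * (\int[m j]_x k x)%:C)
   - C%:C * \sum_j a j * (fine (m j setT))%:C).
  rewrite !mulr_sumr -sumrB; apply: eq_bigr => j _.
  by rewrite hk rmorphB !rmorphM /=; ring.
by rewrite k0 hs // !mulr0 subrr.
Qed.

End Bounded.

(** * Regular Borel measures and their translates *)

Section RealMeasure.
Context d (T : measurableType d) (R : realType).
Variable m : {finite_measure set T -> \bar R}.
Implicit Types A B : set T.

(** Finite measures with real values, so that real arithmetic applies. *)
Definition rm A : R := fine (m A).

Lemma rmE A : measurable A -> m A = (rm A)%:E.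
Proof. by move=> mA; rewrite fineK // fin_num_measure. Qed.

Lemma rm_ge0 A : 0 <= rm A. Proof. exact: fine_ge0. Qed.

Lemma rm_le A B : measurable A -> measurable B -> A `<=` B -> rm A <= rm B.
Proof.
move=> mA mB AB; rewrite -lee_fin -!rmE //.
by apply: le_measure => //; rewrite inE.
Qed.

Lemma rmU A B : measurable A -> measurable B -> rm (A `|` B) <= rm A + rm B.
Proof.
move=> mA mB; rewrite -lee_fin EFinD -!rmE //; first exact: measureU2.
exact: measurableU.
Qed.

Lemma rmD A B : measurable A -> measurable B -> B `<=` A ->
  rm (A `\` B) = rm A - rm B.
Proof.
move=> mA mB BA; have : m (A `\` B) = (rm A - rm B)%:E.
  have mfin : (m A < +oo)%E by rewrite rmE // ltry.
  have -> : (m (A `\` B) = m A - m (A `&` B))%E by exact: measureD.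
  by rewrite (setIidr BA) (rmE mA) (rmE mB).
by move=> h; rewrite /rm h.
Qed.

Lemma rm0 : rm set0 = 0. Proof. by rewrite /rm measure0. Qed.

Lemma rm_cvg_bigcap (F : (set T)^nat) (e : R) : (forall n, measurable (F n)) ->
  (forall n k, (n <= k)%N -> F k `<=` F n) -> 0 < e ->
  exists n, rm (F n) < rm (\bigcap_n F n) + e.
Proof.
move=> mF dF e0; have mI : measurable (\bigcap_n F n) by exact: bigcap_measurable.
have mf n : (m (F n) < +oo)%E by rewrite rmE // ltry.
have cv : (m \o F) x @[x --> \oo] --> m (\bigcap_n F n).
  apply: nonincreasing_cvg_mu => //; first exact: mf.
  by move=> n k nk; apply/subsetPset; exact: dF.
have cr : (fun n => rm (F n)) x @[x --> \oo] --> rm (\bigcap_n F n).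
  apply: fine_cvg; rewrite -rmE //; exact: cv.
have /cvgrPdist_lt/(_ e e0)[n _ /(_ n (leqnn n))] := cr.
by rewrite ltr_norml => /andP[h1 h2]; exists n; lra.
Qed.

End RealMeasure.

Section Borel.
Variables (R : realType) (G : topologicalZmodType).
Hypotheses (compactG : compact [set: G]) (hausdorffG : hausdorff_space G).
Implicit Types (A B : set (borel G)) (U K V : set G) (x y : G).
Implicit Types (m P Q : {finite_measure set (borel G) -> \bar R}).

Lemma open_borel U : open U -> measurable (U : set (borel G)).
Proof. by move=> oU; apply: sub_sigma_algebra. Qed.

Lemma closed_borel K : closed K -> measurable (K : set (borel G)).
Proof.
move=> cK; rewrite -(setCK K); apply: measurableC; apply: open_borel.
exact: closed_openC.
Qed.

Lemma compact_borel K : compact K -> measurable (K : set (borel G)).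
Proof. by move=> cK; apply: closed_borel; exact: compact_closed. Qed.

Lemma closed_compactG K : closed K -> compact K.
Proof. by move=> cK; apply: subclosed_compact compactG _. Qed.

Lemma lsc_measurable (h : borel G -> R) :
  (forall c : R, open ([set x | c < h x] : set G)) -> measurable_fun setT h.
Proof.
move=> oh; apply: (measurability _ (RGenOInfty.measurableE R)) => _ [_ [c ->] <-].
rewrite setTI; apply: open_borel.
rewrite (_ : _ @^-1` _ = [set x : G | c < h x]) //.
by apply/seteqP; split => x /=; rewrite in_itv /= andbT.
Qed.

Lemma continuous_borel (h : G -> R) : continuous h ->
  measurable_fun setT (h : borel G -> R).
Proof.
move=> ch; apply: lsc_measurable => c.
have -> : [set x | c < h x] = h @^-1` [set y | c < y].
  by apply/seteqP; split.
by apply: open_comp => //; exact: open_gt.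
Qed.

Definition translate x A : set (borel G) := [set y : G | A (x + y)].

Lemma translate_borel x A : measurable A -> measurable (translate x A).
Proof.
move=> mA.
have : measurable_fun setT (fun y : borel G => (x + (y : G) : borel G)).
  apply: (@measurability _ _ (borel G) (borel G) setT _ (@open G)) => //.
  move=> _ [U oU <-]; rewrite setTI; apply: open_borel.
  by apply: open_comp => // y _; exact: shift_continuous.
by move=> /(_ measurableT _ mA); rewrite setTI.
Qed.

Lemma translateD x A B : translate x (A `\` B) = translate x A `\` translate x B.
Proof. by []. Qed.

Definition radon m := forall A, measurable A -> forall e : R, 0 < e ->
  exists K U, [/\ compact K, open U, K `<=` A, A `<=` U & rm m (U `\` K) < e].

Lemma open_nbhsI U : (forall x, U x -> nbhs x U) -> open U.
Proof. by rewrite openE. Qed.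

Lemma tube K U x : compact K -> open U -> (forall k, K k -> U (x + k)) ->
  \forall x' \near x, forall k, K k -> U (x' + k).
Proof.
move=> cK oU KU; have nc : near_covering K by apply/compact_near_coveringP.
have := nc G (nbhs x) (fun x' k => U (x' + k)) _.
apply=> k Kk.
have /(_ U) := @add_continuous G (x, k); rewrite /continuous_at /=.
have : nbhs (x + k) U by apply: open_nbhs_nbhs; split => //; exact: KU.
move=> nU /(_ nU) [[N1 N2] [/= h1 h2] h3].
by exists (N2, N1) => // -[k' x'] /= [Nk Nx]; exact: (h3 (x', k') (conj Nx Nk)).
Qed.

Section Convolution.
Variable Q : {finite_measure set (borel G) -> \bar R}.
Hypothesis rQ : radon Q.

(** A compact subset of the translate by [x] stays inside the translates by nearby
    points. *)
Lemma translate_lsc U (c : R) : open U -> open ([set x | c < rm Q (translate x U)] : set G).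
Proof.
move=> oU; apply: open_nbhsI => x /= cx.
have mU := translate_borel x (open_borel oU).
have e0 : 0 < rm Q (translate x U) - c by rewrite subr_gt0.
have [K [V [cK oV KU UV h]]] := rQ mU e0.
have mK := compact_borel cK; have mV := open_borel oV.
have cK' : c < rm Q K.
  have h1 : rm Q (translate x U) <= rm Q V by exact: rm_le.
  have h2 := rmD Q mV mK (subset_trans KU UV); lra.
apply: filterS (tube cK oU KU) => x' hx' /=.
apply: (lt_le_trans cK'); apply: rm_le => //; apply: translate_borel; exact: open_borel.
Qed.

(** True for open sets by semicontinuity, hence for Borel sets by Dynkin's
    theorem. *)
Lemma translate_measurable A : measurable A ->
  measurable_fun setT (fun x : borel G => rm Q (translate x A)).
Proof.
pose H := [set A : set (borel G) | measurable A /\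
  measurable_fun setT (fun x : borel G => rm Q (translate x A))].
suff : measurable `<=` H by move=> h /h[].
apply: (@lambda_system_subset _ (@open G) _ setT H) => //.
- by move=> U V; exact: openI.
- split => //.
  + by split => //; exact: (measurable_cst (rm Q setT)).
  + move=> C A' BA [mB fB] [mA fA]; split; first exact: measurableD.
    have -> : (fun x : borel G => rm Q (translate x (C `\` A')))
        = (fun x => rm Q (translate x C)) \- (fun x => rm Q (translate x A')).
      apply/funext => x /=; rewrite translateD rmD //; try exact: translate_borel.
      by move=> y; exact: BA.
    exact: measurable_funB.
  + move=> F' ndF FH'; pose F : nat -> set (borel G) := F'.
    have FH n : H (F n) by exact: FH'.
    change (H (\bigcup_n F n)).
    have mF n : measurable (F n) by case: (FH n).
    split; first exact: bigcup_measurable.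
    apply/measurable_EFinP.
    apply: (@emeasurable_fun_cvg _ (borel G) R setT
      (fun n => EFin \o (fun x => rm Q (translate x (F n))))
      (EFin \o (fun x => rm Q (translate x (\bigcup_n F n))))).
      by move=> n; apply/measurable_EFinP; case: (FH n).
    move=> x _ /=.
    have -> : (rm Q (translate x (\bigcup_n F n)))%:E = Q (\bigcup_n translate x (F n)).
      by rewrite -rmE //; apply: translate_borel; exact: bigcup_measurable.
    have -> : (fun n => (rm Q (translate x (F n)))%:E) = Q \o (fun n => translate x (F n)).
      by apply/funext => n /=; rewrite -rmE //; exact: translate_borel.
    apply: nondecreasing_cvg_mu.
    * by move=> n; exact: translate_borel.
    * by apply: bigcup_measurable => n _; exact: translate_borel.
    * move=> n k nk; apply/subsetPset => y; rewrite /translate /=.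
      by have /subsetPset := ndF _ _ nk; exact.
- move=> U oU; split; first exact: open_borel.
  by apply: lsc_measurable => c; exact: translate_lsc.
Qed.

Lemma bmeas_translate A : measurable A -> bmeas (fun x : borel G => rm Q (translate x A)).
Proof.
move=> mA; split; first exact: translate_measurable.
exists (rm Q setT) => x; rewrite ger0_norm ?rm_ge0 //.
by apply: rm_le => //; exact: translate_borel.
Qed.

Variable P : {finite_measure set (borel G) -> \bar R}.

(** The hypotheses under which the formula defines a measure are arguments, so
    that the instances below can be inferred from the term. *)
Definition convm (_ : compact [set: G]) (_ : hausdorff_space G) (_ : radon Q) A :
  \bar R := (\int[P]_x Q (translate x A))%E.

Local Notation PQ := (convm compactG hausdorffG rQ).

Let mshE A : measurable A ->
  measurable_fun setT (fun x : borel G => Q (translate x A)).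
Proof.
move=> mA; have /measurable_EFinP := translate_measurable mA; congr measurable_fun.
by apply/funext => x /=; rewrite -rmE //; exact: translate_borel.
Qed.

Let PQ0 : PQ set0 = 0%E.
Proof.
rewrite /convm (eq_integral (cst 0%E)) ?integral0 // => x _.
by rewrite (_ : translate x set0 = set0) ?measure0.
Qed.

Let PQ_ge0 A : (0 <= PQ A)%E. Proof. exact: integral_ge0. Qed.

Let PQ_sigma : semi_sigma_additive PQ.
Proof.
move=> F mF tF mUF; have -> : PQ (\bigcup_n F n)
    = (\int[P]_x (\sum_(0 <= n <oo) Q (translate x (F n))))%E.
  apply: eq_integral => x _; apply/esym/cvg_lim => //.
  have -> : translate x (\bigcup_n F n) = \bigcup_n translate x (F n) by [].
  apply: measure_semi_sigma_additive.
  - by move=> n; exact: translate_borel.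
  - apply/trivIsetP => i j _ _ ij; move/trivIsetP : tF => /(_ i j Logic.I Logic.I ij).
    by rewrite -!subset0 => h y [h1 h2]; exact: (h (x + y : G)).
  - by apply: bigcup_measurable => n _; exact: translate_borel.
rewrite integral_nneseries //; last by move=> n; exact: mshE.
by apply: is_cvg_nneseries => n _ _; exact: PQ_ge0.
Qed.

HB.instance Definition _ := isMeasure.Build _ _ _ PQ PQ0 PQ_ge0 PQ_sigma.

Lemma convm_rm A : measurable A -> PQ A = (\int[P]_x rm Q (translate x A))%:E.
Proof.
move=> mA; rewrite /convm /Rintegral fineK; last first.
  by apply: integrable_fin_num => //; apply: bmeas_int; exact: bmeas_translate.
by apply: eq_integral => x _; rewrite -rmE //; exact: translate_borel.
Qed.

Let PQ_fin : fin_num_fun PQ.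
Proof. by move=> A mA; rewrite convm_rm. Qed.

HB.instance Definition _ := Measure_isFinite.Build _ _ _ PQ PQ_fin.

Lemma rm_conv A : measurable A -> fine (PQ A) = \int[P]_x rm Q (translate x A).
Proof. by move=> mA; rewrite convm_rm. Qed.

(** Inner regularity of a convolution on open sets: cut the space into layers
    where the measure of the translate of [U] is nearly constant, and each layer
    down to a compact set; by compactness one compact subset of [U] works for all
    translations by its points. *)
Lemma conv_inner U (e : R) : radon P -> open U -> 0 < e ->
  exists K, [/\ compact K, K `<=` U & fine (PQ (U `\` K)) < e].
Proof.
move=> rP oU e0; have mU := open_borel oU.
pose g x := rm Q (translate x U).
have mg : measurable_fun setT (g : borel G -> R) by exact: translate_measurable.
have g0 x : 0 <= g x by exact: rm_ge0.
have gM x : g x <= rm Q setT by apply: rm_le => //; exact: translate_borel.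
pose p := rm P setT; pose q := rm Q setT.
have p0 : 0 <= p by exact: rm_ge0.
have q0 : 0 <= q by exact: rm_ge0.
pose d := e / (4 * (p + 1)).
have d0 : 0 < d by rewrite divr_gt0 // mulr_gt0 // ltr_wpDl.
pose N := Num.bound (q / d).
have Nq : q < N%:R * d.
  by rewrite -ltr_pdivrMr //; apply: archi_boundP; rewrite divr_ge0 // ltW.
pose E (i : nat) : set (borel G) := [set x | i%:R * d <= g x < i.+1%:R * d].
have mE i : measurable (E i).
  have -> : E i = g @^-1` `[i%:R * d, i.+1%:R * d[.
    by apply/seteqP; split => x /=; rewrite in_itv.
  by rewrite -[X in measurable X]setTI; exact: mg.
have coverE x : exists2 i, (i < N)%N & E i x.
  have /andP[h1 h2] := truncn_itv (divr_ge0 (g0 x) (ltW d0)).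
  exists (Num.truncn (g x / d)).
    rewrite -(ltr_nat R); apply: (le_lt_trans h1).
    by rewrite ltr_pdivrMr // (le_lt_trans (gM x)).
  by rewrite /E /= -ler_pdivlMr // h1 -ltr_pdivrMr.
(* A compact subset of one layer needs only one compact subset of U. *)
have layer (C : set G) i : compact C -> C `<=` E i ->
    exists K, [/\ compact K, K `<=` U & forall x, C x -> rm Q (translate x (U `\` K)) <= 2 * d].
  move=> cC CE.
  have loc x : C x -> exists K, [/\ compact K, K `<=` U &
      \forall x' \near x, i%:R * d - d < rm Q (translate x' K)].
    move=> Cx; have mUx := translate_borel x mU.
    have [K [V [cK oV KU UV h]]] := rQ mUx d0.
    have mK := compact_borel cK; have mV := open_borel oV.
    have hK : i%:R * d - d < rm Q K.
      have h1 : rm Q (translate x U) <= rm Q V by exact: rm_le.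
      have h2 := rmD Q mV mK (subset_trans KU UV).
      by have /andP[h3 _] := CE x Cx; rewrite /g in h3; lra.
    have cKx : compact [set x + k | k in K].
      apply: continuous_compact => //; apply: continuous_subspaceT.
      exact: shift_continuous.
    have KUx : [set x + k | k in K] `<=` U by move=> _ [k Kk <-]; exact: KU.
    (* Enlarge K to a compact set L that contains its small translates. *)
    have [f [cf f01 f1 f0]] := @cutoff R G compactG hausdorffG _ _ cKx oU KUx.
    pose L := f @^-1` [set t | 1 / 2 <= t]; pose O := f @^-1` [set t | 1 / 2 < t].
    have cL : closed L by apply: closed_comp => [y _|]; [exact: cf|exact: closed_ge].
    have oO : open O by apply: open_comp => [y _|]; [exact: cf|exact: open_gt].
    exists L; split.
    - exact: closed_compactG.
    - move=> y Ly; apply: contrapT => /f0 fy; move: Ly.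
      by rewrite /L /= fy; lra.
    - have xO k : K k -> O (x + k).
        by move=> Kk; rewrite /O /= f1; [lra|exists k].
      apply: filterS (tube cK oO xO) => x' hx'.
      apply: (lt_le_trans hK); apply: rm_le => //.
        by apply: translate_borel; exact: closed_borel.
      by move=> k Kk; apply: ltW; exact: hx'.
  pose FF : set_system (set G) := filter_from [set K0 | compact K0 /\ K0 `<=` U]
    (fun K0 => [set K1 | K0 `<=` K1]).
  have FFf : Filter FF.
    apply: filter_from_filter; first by exists set0; split; [exact: compact0|].
    move=> K1 K2 [c1 U1] [c2 U2]; exists (K1 `|` K2).
      by split; [exact: compactU|move=> y [/U1|/U2]].
    by move=> K3 h; split => y Ky; apply: h; [left|right].
  have nc : near_covering C by apply/compact_near_coveringP.
  have [K0 [cK0 K0U] hK0] : \forall K \near FF, C `<=`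
      [set x | compact K -> i%:R * d - d < rm Q (translate x K)].
    apply: (nc _ FF (fun K x => compact K -> i%:R * d - d < rm Q (translate x K)) FFf).
    move=> x /loc[K [cK KU nK]].
    exists ([set x' | i%:R * d - d < rm Q (translate x' K)], [set K1 | K `<=` K1]).
      by split => //=; exists K.
    case=> x' K1 /= [h1 h2] cK1; apply: (lt_le_trans h1).
    apply: rm_le; try (by apply: translate_borel; exact: compact_borel).
    by move=> y; exact: h2.
  exists K0; split => // x Cx.
  have h1 := hK0 K0 (@subset_refl _ K0) x Cx cK0.
  have mK0 := compact_borel cK0.
  rewrite translateD rmD //; try exact: translate_borel.
    have /andP[_ h2] := CE x Cx; rewrite /g -natr1 in h2.
    by move: h1 h2; rewrite mulrDl mul1r; lra.
  by move=> y; exact: K0U.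
have e2 : 0 < e / (4 * (N%:R * q + 1)).
  by rewrite divr_gt0 // mulr_gt0 // ltr_wpDl // mulr_ge0.
have /choice[C hC] : forall i, exists C : set G, [/\ compact C, C `<=` E i &
    rm P (E i `\` C) < e / (4 * (N%:R * q + 1))].
  move=> i; have [C [V [cC oV CE EV h]]] := rP _ (mE i) _ e2.
  exists C; split => //; apply: le_lt_trans h.
  have mC := compact_borel cC; have mV := open_borel oV.
  by apply: rm_le; [exact: measurableD|exact: measurableD|move=> y [h1 h2]; split => //; exact: EV].
have /choice[K hK] : forall i, exists K, [/\ compact K, K `<=` U &
    forall x, C i x -> rm Q (translate x (U `\` K)) <= 2 * d].
  by move=> i; have [cC CE _] := hC i; exact: (layer _ i).
pose KK := \bigcup_(i < N) K i.
have KKE : KK = \big[setU/set0]_(i < N) K i by rewrite /KK bigcup_mkord.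
have cKK : compact KK.
  by rewrite KKE; apply: bigsetU_compact => i _; case: (hK i).
have mKK := compact_borel cKK.
exists KK; split => //; first by move=> y [i _]; case: (hK i) => _ + _; exact.
rewrite rm_conv; last exact: measurableD.
pose bad : borel G -> R := fun x => \sum_(i < N) q * \1_(E i `\` C i) x.
have mEC i : measurable (E i `\` C i).
  by apply: measurableD => //; apply: compact_borel; case: (hC i).
have bbad : bmeas bad.
  by apply: bmeas_sum => i; apply: bmeasZ; exact: bmeas_indic.
have bUK : bmeas (fun x : borel G => rm Q (translate x (U `\` KK))).
  by apply: bmeas_translate; exact: measurableD.
have le1 x : rm Q (translate x (U `\` KK)) <= 2 * d + bad x.
  have [i iN Ex] := coverE x.
  have mono : rm Q (translate x (U `\` KK)) <= rm Q (translate x (U `\` K i)).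
    have mKi : measurable (K i : set (borel G)).
      by apply: compact_borel; case: (hK i).
    apply: rm_le; try by apply: translate_borel; exact: measurableD.
    by move=> y [h1 h2]; split => // Ky; apply: h2; exists i.
  have bad0 : 0 <= bad x.
    by rewrite sumr_ge0 // => j _; rewrite mulr_ge0 // indicE ler0n.
  have [Cx|nCx] := pselect (C i x).
    by have [_ _ /(_ x Cx)] := hK i; lra.
  have : q <= bad x.
    rewrite /bad (bigD1 (Ordinal iN)) //= indicE mem_set; last by split.
    by rewrite mulr1 lerDl sumr_ge0 // => j _; rewrite mulr_ge0 // indicE ler0n.
  have : rm Q (translate x (U `\` KK)) <= q.
    by apply: rm_le => //; apply: translate_borel; exact: measurableD.
  lra.
apply: (@le_lt_trans _ _ (2 * d * p + N%:R * (q * (e / (4 * (N%:R * q + 1)))))).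
  apply: (@le_trans _ _ (\int[P]_x (2 * d + bad x))).
    by apply: le_int => //; apply: bmeasD => //; exact: bmeas_cst.
  rewrite intD //; last exact: bmeas_cst.
  rewrite (int_cst P (2 * d)) lerD2l /bad int_sum; last first.
    by move=> i; apply: bmeasZ; exact: bmeas_indic.
  have -> : N%:R * (q * (e / (4 * (N%:R * q + 1))))
      = \sum_(i < N) q * (e / (4 * (N%:R * q + 1))).
    by rewrite sumr_const card_ord mulr_natl.
  apply: ler_sum => i _; rewrite intZ; last exact: bmeas_indic.
  rewrite int_indic // ler_wpM2l // ltW //.
  by have [_ _ h] := hC i; exact: h.
have h1 : 2 * d * p <= e / 2.
  have -> : 2 * d * p = e / 2 * (p / (p + 1)).
    by rewrite /d; field; rewrite gt_eqF // ltr_wpDl.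
  rewrite ler_piMr ?divr_ge0 // ?(ltW e0) // ler_pdivrMr ?ltr_wpDl // mul1r.
  by rewrite lerDl.
have h2 : N%:R * (q * (e / (4 * (N%:R * q + 1)))) <= e / 4.
  have nq : 0 < N%:R * q + 1 by rewrite ltr_wpDl // mulr_ge0.
  have -> : N%:R * (q * (e / (4 * (N%:R * q + 1)))) = e / 4 * (N%:R * q / (N%:R * q + 1)).
    by field; rewrite gt_eqF.
  rewrite ler_piMr ?divr_ge0 // ?(ltW e0) // ler_pdivrMr // mul1r.
  by rewrite lerDl.
lra.
Qed.

End Convolution.
End Borel.

Section Regular.
Variables (R : realType) (G : topologicalZmodType).
Hypotheses (compactG : compact [set: G]) (hausdorffG : hausdorff_space G).
Implicit Types (A B : set (borel G)) (U K V : set G) (x y : G).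

(** On a compact space the regular sets form a sigma-algebra: complements
    exchange compact and open sets. *)
Lemma radon_open (m : {finite_measure set (borel G) -> \bar R}) :
  (forall U (e : R), open U -> 0 < e ->
    exists K, [/\ compact K, K `<=` U & rm m (U `\` K) < e]) -> radon m.
Proof.
move=> inner.
pose H := [set A : set (borel G) | measurable A /\ forall e : R, 0 < e ->
  exists K U, [/\ compact K, open U, K `<=` A, A `<=` U & rm m (U `\` K) < e]].
suff : measurable `<=` H by move=> h A /h[].
apply: smallest_sub; last first.
  move=> U oU; split; first exact: open_borel.
  by move=> e e0; have [K [cK KU h]] := inner U e oU e0; exists K, U; split.
split.
- split => // e e0; exists set0, set0; split => //.
  + exact: compact0.
  + exact: open0.
  + by rewrite setD0 rm0.
- move=> A [mA hA]; split; first by rewrite setTD; exact: measurableC.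
  move=> e /hA[K [U [cK oU KA AU h]]]; exists (~` U), (~` K); split.
  + by apply: closed_compactG => //; exact: open_closedC.
  + by apply: closed_openC; exact: compact_closed.
  + by move=> y Uy; split => // /AU.
  + by move=> y [_ Ay] /KA.
  + by rewrite setDE setCK setIC -setDE.
- move=> A' hA'; pose A : nat -> set (borel G) := A'.
  have hA n : H (A n) by exact: hA'.
  change (H (\bigcup_n A n)).
  have mA n : measurable (A n) by case: (hA n).
  split; first exact: bigcup_measurable.
  move=> e e0; have e4 : 0 < e / 4 by rewrite divr_gt0.
  have /choice[K /choice[U hKU]] : forall n, exists K, exists U,
      [/\ compact K, open U, K `<=` A n, A n `<=` U &
          rm m (U `\` K) < e / 4 / (2 ^ n.+1)%:R].
    by move=> n; apply: (hA n).2; rewrite divr_gt0 // ltr0n expn_gt0.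
  have mK n : measurable (K n : set (borel G)).
    by apply: compact_borel => //; case: (hKU n).
  have mU n : measurable (U n : set (borel G)).
    by apply: open_borel; case: (hKU n).
  pose UU := \bigcup_n U n.
  have oUU : open UU by apply: bigcup_open => n _; case: (hKU n).
  have mUU : measurable (UU : set (borel G)) by exact: open_borel.
  pose L n := \big[setU/set0]_(i < n) K i.
  have LE n y : L n y <-> exists2 i, (i < n)%N & K i y.
    rewrite /L -bigcup_mkord; split; first by case=> i; exists i.
    by case=> i; exists i.
  have cL n : compact (L n) by apply: bigsetU_compact => i _; case: (hKU i).
  have mL n : measurable (L n : set (borel G)) by exact: compact_borel.
  pose F n : set (borel G) := UU `\` L n.
  have mF n : measurable (F n) by exact: measurableD.
  have dF n k : (n <= k)%N -> F k `<=` F n.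
    move=> nk y [Uy Ly]; split => // /LE[i ni Ki]; apply: Ly.
    by apply/LE; exists i => //; exact: leq_trans nk.
  have [n hn] := rm_cvg_bigcap m mF dF e4.
  have hI : rm m (\bigcap_n F n) <= e / 4.
    have mI : measurable (\bigcap_n F n) by exact: bigcap_measurable.
    rewrite -lee_fin -rmE //.
    have sub : \bigcap_n F n `<=` \bigcup_n (U n `\` K n).
      move=> y hy; have [[i _ Ui] _] := hy 0%N Logic.I.
      exists i => //; split => // Ki; have [_] := hy i.+1 Logic.I; apply.
      by apply/LE; exists i.
    have mUK k : measurable (U k `\` K k : set (borel G)) by exact: measurableD.
    have h1 : (m (\bigcap_n F n) <= \sum_(0 <= i <oo) m (U i `\` K i))%E.
      exact: measure_sigma_subadditive.
    apply: (le_trans h1).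
    apply: (@le_trans _ _ (\sum_(0 <= i <oo) (0 + (e / 4 / (2 ^ i.+1)%:R)%:E))%E).
      apply: lee_nneseries => // k _; rewrite add0e rmE // lee_fin ltW //.
      by case: (hKU k).
    apply: (le_trans (epsilon_trick _ _ (ltW e4))) => //.
    by rewrite eseries0 ?add0e.
  exists (L n), UU; split => //.
  + by move=> y /LE[i _ Ki]; exists i => //; have [_ _ + _ _] := hKU i; exact.
  + by move=> y [i _ Ai]; exists i => //; have [_ _ _ + _] := hKU i; exact.
  + by move: hn; rewrite /F; lra.
Qed.

Lemma radon_conv (P Q : {finite_measure set (borel G) -> \bar R}) (rQ : radon Q) :
  radon P -> radon (convm P compactG hausdorffG rQ : {finite_measure set _ -> \bar R}).
Proof. by move=> rP; apply: radon_open => U e oU e0; exact: conv_inner. Qed.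

Lemma rm_dirac (x : borel G) A :
  rm (dirac x : {finite_measure set (borel G) -> \bar R}) A = (x \in A)%:R.
Proof. by rewrite -[LHS]/(fine (\d_x A : \bar R)) diracE. Qed.

Lemma radon_dirac (x : borel G) :
  radon (dirac x : {finite_measure set (borel G) -> \bar R}).
Proof.
move=> A mA e e0; have [Ax|Ax] := pselect (A x).
  exists [set (x : G)], setT; split => //; first exact: compact_set1.
  - exact: openT.
  - by move=> y ->.
  - rewrite rm_dirac memNset //= => -[_]; exact.
exists set0, (~` [set (x : G)]); split => //.
- exact: compact0.
- apply: closed_openC; apply: compact_closed => //; exact: compact_set1.
- by move=> y Ay yx; apply: Ax; rewrite -yx.
- by rewrite rm_dirac memNset //= => -[h _]; exact: h.
Qed.

Section Powers.
Variable mu : {finite_measure set (borel G) -> \bar R}.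
Hypothesis rmu : radon mu.

(** Bundled, so that convolution powers stay within one type. *)
Record regular_measure := RegularMeasure {
  reg_m :> {finite_measure set (borel G) -> \bar R} ;
  reg_mP : radon reg_m }.

Definition conv_fin (P : {finite_measure set (borel G) -> \bar R})
    (Q : regular_measure) : {finite_measure set (borel G) -> \bar R} :=
  convm P compactG hausdorffG (reg_mP Q).

Definition conv_reg (P Q : regular_measure) :=
  RegularMeasure (radon_conv (reg_mP Q) (reg_mP P) : radon (conv_fin P Q)).

Fixpoint mpow n : regular_measure :=
  if n is n'.+1 then conv_reg (RegularMeasure rmu) (mpow n')
  else RegularMeasure (radon_dirac (0 : G)).

Lemma conv_finE P (Q : regular_measure) A : measurable A ->
  rm (conv_fin P Q) A = \int[P]_x rm Q (translate x A).
Proof. by move=> mA; rewrite /rm /= rm_conv. Qed.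

Lemma conv_regT (P Q : regular_measure) : rm P setT = 1 -> rm Q setT = 1 ->
  rm (conv_reg P Q) setT = 1.
Proof.
move=> P1 Q1; rewrite conv_finE //.
under eq_Rintegral do rewrite (_ : translate _ setT = setT) // Q1.
by rewrite (int_cst P 1) mul1r -/(rm P setT).
Qed.

Lemma mpowT n : rm mu setT = 1 -> rm (mpow n) setT = 1.
Proof.
move=> mu1; elim: n => [|n IH]; first by rewrite /= rm_dirac mem_set.
exact: conv_regT.
Qed.

End Powers.

(** ** Integrals of complex functions *)

Section ComplexIntegral.
Variable m : {finite_measure set (borel G) -> \bar R}.
Implicit Types f g : G -> R[i].

Definition cint f : R[i] :=
  (\int[m]_x complex.Re (f x)) +i* (\int[m]_x complex.Im (f x)).

Lemma ucont_bmeas_Re f : ucont f -> bmeas (fun x : borel G => complex.Re (f x)).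
Proof.
move=> cf; split; first by apply: continuous_borel; exact: ucont_Re.
have [B _ fB] := ucont_bounded compactG cf.
by exists B => x; apply: le_trans (fB x); exact: nm_Re.
Qed.

Lemma ucont_bmeas_Im f : ucont f -> bmeas (fun x : borel G => complex.Im (f x)).
Proof.
move=> cf; split; first by apply: continuous_borel; exact: ucont_Im.
have [B _ fB] := ucont_bounded compactG cf.
by exists B => x; apply: le_trans (fB x); exact: nm_Im.
Qed.

Lemma cint_Re (c : R[i]) f : ucont f ->
  complex.Re (c * cint f) = \int[m]_x complex.Re (c * f x).
Proof.
move=> cf; rewrite ReM /=.
have bR := ucont_bmeas_Re cf; have bI := ucont_bmeas_Im cf.
rewrite -!intZ // -intB; [|exact: bmeasZ|exact: bmeasZ].
by apply: eq_Rintegral => x _; rewrite ReM.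
Qed.

Hypothesis m1 : rm m setT = 1.

(** Real quadrature: sample one point in each part of a finite partition. *)
Lemma int_quadrature V (s : seq G) : open V ->
  exists ws : seq (R * G), [/\ all (fun p => 0 <= p.1) ws,
    \sum_(p <- ws) p.1 = rm m (\bigcup_(y in [set` s]) [set x | V (x - y)]) &
    forall (h : borel G -> R) (e : R), bmeas h ->
      (forall x y, V (x - y) -> `|h x - h y| <= e) ->
      `|\int[m]_x (h x * \1_(\bigcup_(y in [set` s]) [set x | V (x - y)]) x)
        - \sum_(p <- ws) p.1 * h p.2|
      <= e * rm m (\bigcup_(y in [set` s]) [set x | V (x - y)])].
Proof.
move=> oV; pose E y : set (borel G) := [set x : G | V (x - y)].
have mE y : measurable (E y).
  have -> : E y = translate (- y) V by apply/seteqP; split => x; rewrite /E /translate /= addrC.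
  by apply: translate_borel; exact: open_borel.
elim: s => [|y s [ws [w0 w1 wh]]].
  have -> : \bigcup_(y in [set` [::]]) E y = set0.
    by rewrite -subset0 => x [y]; rewrite /= in_nil.
  exists [::]; split => //; rewrite ?big_nil ?rm0 //.
  move=> h e bh hV; rewrite big_nil subr0 mulr0.
  under eq_Rintegral do rewrite indic0 mulr0.
  by rewrite (int_cst m 0) mul0r normr0.
pose A := \bigcup_(y in [set` s]) E y.
have mA : measurable A.
  by apply: fin_bigcup_measurable => //; exact: finite_seq.
have -> : \bigcup_(y0 in [set` y :: s]) E y0 = A `|` (E y `\` A).
  apply/seteqP; split => x.
    case=> z /=; rewrite inE => /orP[/eqP ->|zs] Ex; last by left; exists z.
    by have [Ax|Ax] := pselect (A x); [left|right].
  case=> [[z zs Ez]|[Ey _]]; first by exists z => //=; rewrite inE zs orbT.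
  by exists y => //=; rewrite inE eqxx.
have mEA : measurable (E y `\` A) by exact: measurableD.
have rU : rm m (A `|` (E y `\` A)) = rm m A + rm m (E y `\` A).
  have := rmD m (measurableU _ _ mA mEA) mA (@subsetUl _ _ _).
  have -> : (A `|` (E y `\` A)) `\` A = E y `\` A.
    apply/seteqP; split => x; first by move=> [[|//]] .
    by move=> [Ex nA]; split => //; right.
  move=> ->; ring.
exists ((rm m (E y `\` A), y) :: ws); split.
- by rewrite /= rm_ge0.
- by rewrite big_cons /= w1 rU addrC.
- move=> h e bh hV; have hs := wh h e bh hV; rewrite big_cons /= rU.
  have bA : bmeas (\1_A : borel G -> R) by exact: bmeas_indic.
  have bEA : bmeas (\1_(E y `\` A) : borel G -> R) by exact: bmeas_indic.
  have -> : \int[m]_x (h x * \1_(A `|` (E y `\` A)) x)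
      = \int[m]_x (h x * \1_A x) + \int[m]_x (h x * \1_(E y `\` A) x).
    rewrite -intD; [|exact: bmeasM|exact: bmeasM].
    apply: eq_Rintegral => x _; rewrite -mulrDr; congr (_ * _).
    rewrite !indicE !in_setU in_setD.
    by case: (x \in A) => /=; rewrite ?andbF ?andbT ?addr0 ?add0r.
  have hy : `|\int[m]_x (h x * \1_(E y `\` A) x) - rm m (E y `\` A) * h y|
      <= e * rm m (E y `\` A).
    have bhE : bmeas (fun x : borel G => h x * \1_(E y `\` A) x) by exact: bmeasM.
    have -> : rm m (E y `\` A) * h y = \int[m]_x (h y * \1_(E y `\` A) x).
      by rewrite intZ // int_indic // mulrC.
    have -> : e * rm m (E y `\` A) = \int[m]_x (e * \1_(E y `\` A) x).
      by rewrite intZ // int_indic.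
    rewrite -intB //; last exact: bmeasZ.
    have pt x : `|h x * \1_(E y `\` A) x - h y * \1_(E y `\` A) x|
        <= e * \1_(E y `\` A) x.
      rewrite -mulrBl normrM indicE; case: (boolP (x \in _)) => [|_]; last first.
        by rewrite normr0 !mulr0.
      by rewrite inE => -[Ex _]; rewrite normr1 !mulr1; exact: hV.
    rewrite ler_norml; apply/andP; split.
      rewrite -mulN1r -intZ; last exact: bmeasZ.
      apply: le_int; [by do 2!apply: bmeasZ|by apply: bmeasB => //; exact: bmeasZ|].
      by move=> x; have := pt x; rewrite ler_norml mulN1r => /andP[].
    apply: le_int; [by apply: bmeasB => //; exact: bmeasZ|exact: bmeasZ|].
    by move=> x; have := pt x; rewrite ler_norml => /andP[].
  move: hs hy; rewrite !ler_norml mulrDr -/A => /andP[h1 h2] /andP[h3 h4].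
  by apply/andP; split; lra.
Qed.

(** This brings the calculus of quadrature functionals to bear on probability
    measures. *)
Lemma cint_quadrature : quadrature cint.
Proof.
move=> U nU.
have [V [oV V0] VU] : exists2 V : set G, open V /\ V 0 & V `<=` U.
  by move: nU; rewrite nbhsE => -[V [oV V0] VU]; exists V.
have [s hs] := fin_translates compactG (open_nbhs_nbhs (conj oV V0)).
have [ws [w0 w1 wh]] := int_quadrature s oV.
have ET : \bigcup_(y in [set` s]) [set x | V (x - y)] = setT.
  apply/seteqP; split => // x _; have [y ys Vxy] := hs x.
  by exists y.
rewrite ET in w1 wh.
exists ws; first by rewrite /weights w0 w1 m1 eqxx.
move=> f e cf fU; set z := cint f - qsum ws f.
have [z0|z0] := eqVneq z 0.
  by rewrite z0 nm0; apply: le_trans (fU 0 (VU _ V0) 0); exact: nm_ge0.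
have nz : nm z != 0 by apply: contra z0 => /eqP/nm_eq0 ->.
(* Rotate the error onto the positive axis to reduce to a real integrand. *)
pose t := cj z / (nm z)%:C.
have t1 : nm t = 1 by rewrite nmM nmV nm_cj nm_real ger0_norm ?nm_ge0 // divff.
have -> : nm z = complex.Re (t * z).
  rewrite /t mulrAC (mulrC (cj z)) mul_cj expr2 rmorphM mulfK //.
  by rewrite (inj_eq (@complexI R)).
have utf : ucont (fun x => t * f x) by exact: ucontZ.
have := wh (fun x => complex.Re (t * f x)) e (ucont_bmeas_Re utf) _.
rewrite m1 mulr1 => /(_ _)/le_trans/(_ (lexx _)) h.
rewrite /z mulrBr ReB cint_Re //.
have -> : complex.Re (t * qsum ws f) = \sum_(p <- ws) p.1 * complex.Re (t * f p.2).
  rewrite -qsumZ /qsum; elim: (ws) => [|p s' IH]; first by rewrite !big_nil.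
  by rewrite !big_cons ReD ReZ IH.
apply: le_trans (ler_norm _) _; apply: le_trans (h _).
  rewrite le_eqVlt; apply/orP; left; apply/eqP; congr (`|_ - _|).
  by apply: eq_Rintegral => x _; rewrite indicT mulr1.
move=> x y Vxy; rewrite -ReB -mulrBr; apply: (le_trans (nm_Re _)).
by rewrite nmM t1 mul1r; have := fU _ (VU _ Vxy) y; rewrite (addrC y) subrK.
Qed.

End ComplexIntegral.

End Regular.

Section ConvolutionIntegral.
Variables (R : realType) (G : topologicalZmodType).
Hypotheses (compactG : compact [set: G]) (hausdorffG : hausdorff_space G).
Implicit Types (A B N : set (borel G)) (U K V : set G) (x y : G) (f : G -> R[i]).
Implicit Types (P m : {finite_measure set (borel G) -> \bar R}).

Local Notation conv_fin := (conv_fin compactG hausdorffG).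
Local Notation conv_reg := (conv_reg compactG hausdorffG).

Lemma ucont_bmeas (h : G -> R) : ucont (fun x => (h x)%:C) -> bmeas (h : borel G -> R).
Proof. by move=> uh; exact: (ucont_bmeas_Re compactG uh). Qed.

Lemma ucont_realZ (c : R) (h : G -> R) : ucont (fun x => (h x)%:C) ->
  ucont (fun x => (c * h x)%:C).
Proof.
move=> uh; have := ucontZ c%:C uh; congr ucont.
by apply/funext => x; rewrite rmorphM.
Qed.

Lemma ucont_realD (h k : G -> R) : ucont (fun x => (h x)%:C) ->
  ucont (fun x => (k x)%:C) -> ucont (fun x => (h x + k x)%:C).
Proof.
move=> uh uk; have := ucontD uh uk; congr ucont.
by apply/funext => x; rewrite rmorphD.
Qed.

Section Mass1.
Variable Q : regular_measure R G.
Hypothesis Q1 : rm Q setT = 1.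

Let inner (h : G -> R) : borel G -> R := fun x => \int[Q]_y h ((x : G) + y).

Let inner_bmeas h : ucont (fun x => (h x)%:C) -> bmeas (inner h).
Proof.
move=> uh; have uT := cvl_ucont (cint_quadrature compactG Q1) uh.
by have := ucont_bmeas_Re compactG uT.
Qed.

Let int_conv01 P (h : G -> R) : ucont (fun x => (h x)%:C) ->
  (forall x, 0 <= h x <= 1) ->
  \int[conv_fin P Q]_x h x = \int[P]_x inner h x.
Proof.
move=> uh h01; have bh := ucont_bmeas uh.
apply/eqP; rewrite -subr_eq0 -normr_le0; apply/ler_addgt0Pr => e e0.
rewrite add0r; pose C := rm (conv_fin P Q) setT + rm P setT.
have C0 : 0 <= C by rewrite addr_ge0 ?rm_ge0.
pose N := (Num.bound (C / e)).+1.
have N0 : 0 < N%:R :> R by rewrite ltr0n.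
have h1 := @int_steps_close _ _ _ (conv_fin P Q) h N bh.1 isT h01.
have mL (i : 'I_N) : measurable (level (h : borel G -> R) i).
  by apply: level_measurable; case: bh.
have bsh (i : 'I_N) : bmeas (fun x : borel G => rm Q (translate x (level (h : borel G -> R) i))).
  by apply: bmeas_translate => //; exact: reg_mP.
have h2 : `|\int[P]_x inner h x
    - N%:R^-1 * \sum_(i < N) fine (conv_fin P Q (level (h : borel G -> R) i))|
    <= N%:R^-1 * rm P setT.
  have -> : N%:R^-1 * \sum_(i < N) fine (conv_fin P Q (level (h : borel G -> R) i))
     = \int[P]_x (N%:R^-1 * \sum_(i < N) rm Q (translate x (level (h : borel G -> R) i))).
    rewrite intZ ?int_sum //; last exact: bmeas_sum.
    by congr (_ * _); apply: eq_bigr => i _; rewrite -conv_finE.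
  rewrite -intB; [|exact: inner_bmeas|by apply: bmeasZ; exact: bmeas_sum].
  apply: int_le => [|x].
    by apply: bmeasB; [exact: inner_bmeas|apply: bmeasZ; exact: bmeas_sum].
  have := @int_steps_close _ _ _ Q (fun y => h ((x : G) + y)) N _ isT (fun y => h01 _).
  rewrite -/(rm Q setT) Q1 mulr1; apply.
  by have /ucont_bmeas[] := ucont_shift (x : G) uh.
have h3 : N%:R^-1 * C <= e.
  rewrite mulrC ler_pdivrMr // mulrC -ler_pdivrMr //.
  apply: le_trans (ltW (archi_boundP _)) _; first by rewrite divr_ge0 // ltW.
  by rewrite ler_nat.
move: h1 h2 h3; rewrite -/(rm _ setT) /C mulrDr.
set u := N%:R^-1 * \sum_(i < N) _; move=> h1 h2 h3.
have := ler_distD u (\int[conv_fin P Q]_x h x) (\int[P]_x inner h x).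
rewrite [`|u - _|]distrC; lra.
Qed.

Lemma int_conv P (h : G -> R) : ucont (fun x => (h x)%:C) ->
  \int[conv_fin P Q]_x h x = \int[P]_x \int[Q]_y h (x + y).
Proof.
move=> uh; have [B B0 hB] := ucont_bounded compactG uh.
have hB' x : `|h x| <= B by have := hB x; rewrite nm_real.
pose k x := (2 * B)^-1 * (h x + B).
have B2 : 0 < 2 * B by rewrite mulr_gt0.
have uB : ucont (fun _ : G => (B%:C : R[i])) by exact: ucont_cst.
have uk : ucont (fun x => (k x)%:C) by apply: ucont_realZ; exact: ucont_realD.
have k01 x : 0 <= k x <= 1.
  have := hB' x; rewrite ler_norml => /andP[h1 h2]; rewrite /k.
  apply/andP; split; first by rewrite mulr_ge0 ?invr_ge0 ?(ltW B2) //; lra.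
  by rewrite mulrC ler_pdivrMr // mul1r; lra.
have hk x : h x = 2 * B * k x - B.
  by rewrite /k mulrA divff ?gt_eqF // mul1r addrK.
have bk := ucont_bmeas uk.
have lin m : \int[m]_x h x = 2 * B * \int[m]_x k x - B * rm m setT.
  rewrite -(int_cst m) -intZ // -intB; [|exact: bmeasZ|exact: bmeas_cst].
  by apply: eq_Rintegral => x _; exact: hk.
rewrite lin (int_conv01 P uk k01).
have linQ x : \int[Q]_y h (x + y) = 2 * B * inner k x - B.
  have bs : bmeas (fun y : borel G => k (x + y)).
    by apply: ucont_bmeas; exact: (ucont_shift x uk).
  have cB : \int[Q]_y (fun=> B : R) y = B.
    by rewrite (int_cst Q) -/(rm Q setT) Q1 mulr1.
  rewrite -[X in _ = _ - X]cB /inner -intZ // -intB; [|exact: bmeasZ|exact: bmeas_cst].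
  by apply: eq_Rintegral => y _; exact: hk.
transitivity (\int[P]_x (2 * B * inner k x - B)); last first.
  by apply: eq_Rintegral => x _; rewrite linQ.
have bi := inner_bmeas uk.
rewrite intB; [|exact: bmeasZ|exact: bmeas_cst].
rewrite intZ // (int_cst P); congr (_ - _ * _).
rewrite conv_finE //; under eq_Rintegral do rewrite (_ : translate _ setT = setT) // Q1.
by rewrite (int_cst P 1) mul1r.
Qed.

Lemma cint_conv P f : ucont f ->
  cint (conv_fin P Q) f = cint P (cvl (cint Q) f).
Proof.
move=> cf; rewrite /cint /cvl /=; congr (_ +i* _).
  apply: int_conv; apply: ucont_real => //; exact: ucont_Re.
apply: int_conv; apply: ucont_real => //; exact: ucont_Im.
Qed.

End Mass1.

Lemma cint_dirac (a : borel G) f : ucont f ->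
  cint (dirac a : {finite_measure set (borel G) -> \bar R}) f = f a.
Proof.
move=> cf; rewrite [RHS]complexEE /cint; congr (_ +i* _).
  rewrite /Rintegral integral_dirac ?diracT ?mul1e //.
  by apply/measurable_EFinP; case: (ucont_bmeas_Re compactG cf).
rewrite /Rintegral integral_dirac ?diracT ?mul1e //.
by apply/measurable_EFinP; case: (ucont_bmeas_Im compactG cf).
Qed.

Lemma reg_common n (m : 'I_n -> regular_measure R G) A (d : R) :
  measurable A -> 0 < d -> exists K U, [/\ compact K, open U, K `<=` A,
    A `<=` U & forall j, rm (m j) (U `\` K) <= d].
Proof.
move=> mA d0.
have /choice[K /choice[U hKU]] : forall j, exists K, exists U, [/\ compact K,
    open U, K `<=` A, A `<=` U & rm (m j) (U `\` K) < d].
  by move=> j; exact: reg_mP.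
pose KK := \bigcup_(j in [set: 'I_n]) K j.
pose UU := \bigcap_(j in [set: 'I_n]) U j.
have cKK : compact KK.
  rewrite /KK (_ : \bigcup_(j in _) _ = \big[setU/set0]_(j < n) K j); last first.
    by rewrite -bigcup_seq; apply/seteqP; split => x [j _ Kj]; exists j => //=;
      rewrite mem_index_enum.
  by apply: bigsetU_compact => j _; case: (hKU j).
have oUU : open UU.
  rewrite /UU (_ : \bigcap_(j in _) _ = \big[setI/setT]_(j < n) U j); last first.
    rewrite -bigcap_seq; apply/seteqP; split => x h j _; apply: h => //=.
    by rewrite mem_index_enum.
  by elim/big_ind : _ => [|V W|j _]; [exact: openT|exact: openI|case: (hKU j)].
exists KK, UU; split => //.
- by move=> x [j _ Kj]; have [_ _ + _ _] := hKU j; exact.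
- by move=> x Ax j _; have [_ _ _ + _] := hKU j; exact.
- move=> j; have [cKj oUj _ _ /ltW] := hKU j; apply: le_trans.
  have mU : measurable (U j : set (borel G)) by exact: open_borel.
  have mK : measurable (K j : set (borel G)) by exact: compact_borel.
  have mUU : measurable (UU : set (borel G)) by exact: open_borel.
  have mKK : measurable (KK : set (borel G)) by exact: compact_borel.
  apply: rm_le; [exact: measurableD|exact: measurableD|].
  by move=> x [Ux Kx]; split; [exact: (Ux j)|move=> Kj; apply: Kx; exists j].
Qed.

(** Regularity: a combination of measures is controlled by its values on
    continuous functions. *)
Lemma comb_set_le n (a : 'I_n -> R[i]) (m : 'I_n -> regular_measure R G) (c : R) A :
  (forall f, ucont f -> (forall x, nm (f x) <= 1) ->
    nm (\sum_j a j * cint (m j) f) <= c) -> measurable A ->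
  nm (\sum_j a j * (rm (m j) A)%:C) <= c.
Proof.
move=> hc mA; apply/ler_addgt0Pr => e e0.
pose S := \sum_j nm (a j); have S0 : 0 <= S by rewrite sumr_ge0 // => j _; exact: nm_ge0.
pose d := e / (S + 1); have d0 : 0 < d by rewrite divr_gt0 // ltr_wpDl.
have [K [U [cK oU KA AU KU]]] := reg_common m mA d0.
have [h [ch h01 h1 h0]] := @cutoff R G compactG hausdorffG _ _ cK oU (subset_trans KA AU).
have uh := ucont_real compactG ch; have bh := ucont_bmeas uh.
have mK : measurable (K : set (borel G)) by exact: compact_borel.
have mU : measurable (U : set (borel G)) by exact: open_borel.
have mUK : measurable (U `\` K : set (borel G)) by exact: measurableD.
have cintE j : cint (m j) (fun x => (h x)%:C) = (\int[m j]_x h x)%:C.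
  by rewrite /cint /= (int_cst (m j) 0) mul0r.
have close j : nm ((rm (m j) A)%:C - cint (m j) (fun x => (h x)%:C)) <= d.
  have rE B : measurable B -> rm (m j) B = \int[m j]_x \1_B x by move=> mB; rewrite int_indic.
  rewrite cintE -rmorphB nm_real (rE A mA).
  have bA : bmeas (\1_A : borel G -> R) by exact: bmeas_indic.
  have bUK : bmeas (\1_(U `\` K) : borel G -> R) by exact: bmeas_indic.
  rewrite -intB //; apply: le_trans (KU j).
  rewrite (rE _ mUK).
  have pt x : `|\1_A x - h x| <= \1_(U `\` K) x :> R.
    rewrite !indicE; have /andP[ha hb] := h01 x.
    have [Kx|Kx] := pselect (K x).
      rewrite h1 // mem_set ?subrr ?normr0 ?ler0n //; exact: KA.
    have [Ux|Ux] := pselect (U x).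
      rewrite (@mem_set _ (U `\` K)) //; case: (_ \in _) => /=.
        by rewrite ger0_norm; lra.
      by rewrite sub0r normrN ger0_norm.
    by rewrite h0 // memNset ?subrr ?normr0 ?ler0n // => /AU.
  rewrite ler_norml; apply/andP; split.
    rewrite -mulN1r -intZ //; apply: le_int; [exact: bmeasZ|exact: bmeasB|].
    by move=> x; have := pt x; rewrite ler_norml mulN1r => /andP[].
  apply: le_int => //; first exact: bmeasB.
  by move=> x; have := pt x; rewrite ler_norml => /andP[].
have h1' : nm (\sum_j a j * cint (m j) (fun x => (h x)%:C)) <= c.
  apply: hc => // x; rewrite nm_real.
  by have /andP[ha hb] := h01 x; rewrite ger0_norm.
have h2 : nm (\sum_j a j * (rm (m j) A)%:C - \sum_j a j * cint (m j) (fun x => (h x)%:C))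
    <= e.
  rewrite -sumrB; apply: (le_trans (nm_sum _ _ _)).
  apply: (@le_trans _ _ (\sum_j nm (a j) * d)).
    by apply: ler_sum => j _; rewrite -mulrBr nmM ler_wpM2l ?nm_ge0.
  rewrite -mulr_suml -/S /d mulrA ler_pdivrMr ?ltr_wpDl // mulrC ler_wpM2l ?(ltW e0) //.
  by rewrite lerDl.
have := nmD (\sum_j a j * (rm (m j) A)%:C - \sum_j a j * cint (m j) (fun x => (h x)%:C))
  (\sum_j a j * cint (m j) (fun x => (h x)%:C)).
rewrite subrK; lra.
Qed.

(** Riesz uniqueness. *)
Lemma reg_measure_eq (P Q : regular_measure R G) A : (forall f, ucont f -> cint P f = cint Q f) ->
  measurable A -> rm P A = rm Q A.
Proof.
move=> PQ mA.
pose a (j : 'I_2) : R[i] := if j == ord0 then 1 else -1.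
pose m (j : 'I_2) := if j == ord0 then P else Q.
have sumE (F : regular_measure R G -> R[i]) : \sum_j a j * F (m j) = F P - F Q.
  by rewrite !big_ord_recl big_ord0 /a /m /=; ring.
have := @comb_set_le 2 a m 0 A _ mA.
rewrite (sumE (fun r => (rm r A)%:C)) -rmorphB nm_real => h.
apply/eqP; rewrite -subr_eq0 -normr_le0; apply: h => f cf _.
by rewrite (sumE (fun r => cint r f)) PQ // subrr nm0.
Qed.

End ConvolutionIntegral.

(** * Convolution powers, Haar measure and singularity *)

Section Haar.
Variables (R : realType) (G : topologicalZmodType).
Hypotheses (compactG : compact [set: G]) (hausdorffG : hausdorff_space G).

(** A Haar measure of a compact group is finite; outer regularity of a set and of
    its complement gives regularity in the sense of [radon]. *)
Lemma haar_regular (lambda : {measure set (borel G) -> \bar R}) :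
  haar_measure lambda -> exists m : regular_measure R G,
  [/\ rm m setT = 1,
      forall x A, measurable A -> rm m (translate x A) = rm m A &
      forall A, measurable A -> lambda A = 0%E -> rm m A = 0].
Proof.
case=> lT0 lcomp lout lin linv.
have lTfin : (lambda setT < +oo)%E by exact: lcomp compactG.
pose c := (fine (lambda setT))^-1.
have lT : lambda setT \is a fin_num by rewrite ge0_fin_numE.
have fT : 0 < fine (lambda setT) by rewrite fine_gt0 // lt0e lT0 lTfin measure_ge0.
have c0 : 0 < c by rewrite invr_gt0.
pose l' : {finite_measure set (borel G) -> \bar R} :=
  mnormalize lambda (dirac (0 : borel G) : probability (borel G) R).
have lfin A : measurable A -> lambda A \is a fin_num.
  move=> mA; rewrite ge0_fin_numE //; apply: le_lt_trans lTfin.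
  by apply: le_measure; rewrite ?inE.
have l'E A : measurable A -> rm l' A = fine (lambda A) * c.
  move=> mA; have -> : rm l' A = fine (mnormalize lambda (dirac (0 : borel G) : probability (borel G) R) A) by [].
  rewrite /mnormalize /=.
  by rewrite (negbTE lT0) /= lt_eqF //= fineM // lfin.
have outer (A : set (borel G)) (e : R) : measurable A -> 0 < e ->
    exists U : set G, [/\ open U, A `<=` U & rm l' ((U : set (borel G)) `\` A) < e].
  move=> mA e0; have ec : 0 < e / c by rewrite divr_gt0.
  have inf_fin : ereal_inf [set lambda U | U in [set U : set G | open U /\ A `<=` U]]
      \is a fin_num by rewrite -lout // lfin.
  have [_ [U [oU AU] <-] hU] := lb_ereal_inf_adherent ec inf_fin.
  rewrite -lout // in hU; exists U; split => //.
  have mU := open_borel oU.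
  rewrite rmD // !l'E // -mulrBl -ltr_pdivlMr //.
  rewrite -(fineK (lfin _ mU)) -(fineK (lfin _ mA)) -EFinD lte_fin in hU.
  lra.
have r' : radon l'.
  move=> A mA e e0; have e2 : 0 < e / 2 by rewrite divr_gt0.
  have [U [oU AU hU]] := outer A _ mA e2.
  have mAC : measurable (~` A) by exact: measurableC.
  have [V [oV AV hV]] := outer _ _ mAC e2.
  have mU := open_borel oU; have mV := open_borel oV.
  exists (~` V), U; split => //.
  - by apply: closed_compactG => //; exact: open_closedC.
  - by move=> x Vx; apply: contrapT => Ax; apply: Vx; exact: AV.
  - have h1 := rmU l' (measurableD mU mA) (measurableD mV mAC).
    apply: (@le_lt_trans _ _ (rm l' (((U : set (borel G)) `\` A) `|` ((V : set (borel G)) `\` ~` A)))); last lra.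
    apply: rm_le.
    + by apply: measurableD => //; exact: measurableC.
    + by apply: measurableU; exact: measurableD.
    + move=> x [Ux nVx]; have [Ax|Ax] := pselect (A x); last by left.
      by right; split; [apply: contrapT => Vx; exact: nVx|move=> /(_ Ax)].
exists (RegularMeasure r'); split => /=.
- by rewrite l'E // divff // gt_eqF.
- move=> x A mA; rewrite !l'E //; last exact: translate_borel.
  by rewrite /translate linv.
- by move=> A mA lA; rewrite l'E // lA mul0r.
Qed.

Variable m : regular_measure R G.
Hypothesis m1 : rm m setT = 1.
Hypothesis minv : forall x A, measurable A -> rm m (translate x A) = rm m A.

Lemma cint_inv f a : ucont f -> cint m (fun x : G => f (a + x)) = cint m f.
Proof.
move=> cf; pose da := RegularMeasure (@radon_dirac R G hausdorffG (a : borel G)).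
pose cm := conv_reg compactG hausdorffG da m.
have E A : measurable A -> m A = cm A.
  move=> mA; rewrite !rmE // conv_finE //; congr (_%:E).
  under eq_Rintegral do rewrite minv //.
  have d1 : rm da setT = 1.
    by have := @rm_dirac R G a setT; rewrite mem_set.
  by rewrite (int_cst da (rm m A)) -/(rm da setT) d1 mulr1.
have -> : cint m f = cint cm f.
  rewrite /cint /Rintegral.
  by congr (fine _ +i* fine _); apply: eq_measure_integral => A mA _; exact: E.
by rewrite cint_conv // cint_dirac //; apply: cvl_ucont => //; exact: cint_quadrature.
Qed.

End Haar.

Section Powers.
Variables (R : realType) (G : topologicalZmodType).
Hypotheses (compactG : compact [set: G]) (hausdorffG : hausdorff_space G).
Variable mu : regular_measure R G.
Hypothesis mu1 : rm mu setT = 1.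
Implicit Types (A B : set (borel G)) (f : G -> R[i]) (p q : {poly R[i]}).

Local Notation mpow := (mpow compactG hausdorffG (reg_mP mu)).
Local Notation L := (cint mu).

Let qL : quadrature L. Proof. exact: cint_quadrature. Qed.

Lemma mpow1 n : rm (mpow n) setT = 1. Proof. exact: mpowT. Qed.

(** Integrals against convolution powers are values of powers of one operator,
    so that polynomials in the measure act as polynomials in the operator. *)
Lemma cint_mpow n f x : ucont f ->
  cint (mpow n) (fun y => f (x + y)) = iter n (cvl L) f x.
Proof.
elim: n f x => [|n IH] f x cf /=.
  by rewrite cint_dirac ?addr0 //; exact: ucont_shift.
rewrite (cint_conv compactG hausdorffG (mpow1 n)); last exact: ucont_shift.
have iu := iter_ucont qL n cf.
rewrite {2}/cvl; have -> : cvl (cint (mpow n)) (fun y => f (x + y))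
    = fun y => iter n (cvl L) f (x + y).
  apply/funext => u; rewrite /cvl -IH //; congr cint.
  by apply/funext => y; rewrite addrA.
by [].
Qed.

Lemma cint_mpow0 n f : ucont f -> cint (mpow n) f = iter n (cvl L) f 0.
Proof.
move=> cf; rewrite -cint_mpow //; congr cint.
by apply/funext => y; rewrite add0r.
Qed.

(** The powers are defined with the new factor outside; commutativity, visible on
    continuous functions, allows it inside. *)
Lemma conv_mpow n A : measurable A ->
  \int[mpow n]_x rm mu (translate x A) = rm (mpow n.+1) A.
Proof.
move=> mA; rewrite -(conv_finE compactG hausdorffG (mpow n) mu) //.
apply: (@reg_measure_eq _ _ compactG hausdorffG
  (conv_reg compactG hausdorffG (mpow n) mu) (mpow n.+1)) => // f cf.
rewrite [cint (conv_reg _ _ _ _) f](cint_conv compactG hausdorffG mu1) // !cint_mpow0 //; last exact: cvl_ucont.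
by rewrite iterSr.
Qed.

(** The values of the complex measure obtained from a polynomial by substituting
    the measure for the variable, with convolution as product. *)
Definition pmeas p A : R[i] := \sum_(k < size p) p`_k * (rm (mpow k) A)%:C.

Lemma pmeas_widen n p A : (size p <= n)%N ->
  pmeas p A = \sum_(k < n) p`_k * (rm (mpow k) A)%:C.
Proof.
move=> pn; rewrite /pmeas (big_ord_widen_cond n xpredT (fun k => p`_k * (rm (mpow k) A)%:C)) //.
rewrite [RHS](bigID (fun k : 'I_n => (k < size p)%N)) /= [X in _ = _ + X]big1 ?addr0 //.
by move=> k; rewrite -leqNgt => kp; rewrite nth_default // mul0r.
Qed.

Lemma pmeasD p q A : pmeas (p + q) A = pmeas p A + pmeas q A.
Proof.
pose n := maxn (size p) (size q).
rewrite (@pmeas_widen n p) ?leq_maxl // (@pmeas_widen n q) ?leq_maxr //.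
rewrite (@pmeas_widen n) ?size_polyD // -big_split /=.
by apply: eq_bigr => k _; rewrite coefD mulrDl.
Qed.

Lemma pmeasZ z p A : pmeas (z *: p) A = z * pmeas p A.
Proof.
rewrite (@pmeas_widen (size p)) ?size_scale_leq // mulr_sumr.
by apply: eq_bigr => k _; rewrite coefZ mulrA.
Qed.

Lemma pmeasB p q A : pmeas (p - q) A = pmeas p A - pmeas q A.
Proof. by rewrite -scaleN1r pmeasD pmeasZ mulN1r. Qed.

Lemma pmeasMX p A : measurable A -> pmeas (p * 'X) A =
  \sum_(k < size p) p`_k * (\int[mpow k]_x rm mu (translate x A))%:C.
Proof.
move=> mA; have [->|p0] := eqVneq p 0.
  by rewrite mul0r /pmeas size_poly0 !big_ord0.
rewrite {1}/pmeas size_mulX // big_ord_recl coefMX eqxx mul0r add0r.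
by apply: eq_bigr => k _; rewrite coefMX conv_mpow.
Qed.

Lemma pmeas1 A : pmeas 1 A = (rm (mpow 0) A)%:C.
Proof.
by rewrite /pmeas size_poly1 big_ord_recl big_ord0 addr0 coef1 eqxx mul1r.
Qed.

Lemma act_cint p f : ucont f ->
  act L p f 0 = \sum_(k < size p) p`_k * cint (mpow k) f.
Proof. by move=> cf; apply: eq_bigr => k _; rewrite cint_mpow0. Qed.

(** The operator norm bounds integrals of continuous functions, and values on
    sets by regularity. *)
Lemma opnorm_le_pmeas p c A : opnorm_le L p c -> measurable A -> nm (pmeas p A) <= c.
Proof.
move=> pc mA; apply: (comb_set_le compactG hausdorffG (m := fun k => mpow k)) => // f cf f1.
by rewrite -act_cint // -[leRHS]mulr1; exact: pc.
Qed.

Lemma act_shift p f a x : act L p (fun y => f (a + y)) x = act L p f (a + x).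
Proof.
rewrite /act; apply: eq_bigr => k _; congr (_ * _).
elim: (k : nat) x => [|n IH] x //=.
by rewrite /cvl; congr cint; apply/funext => y; rewrite IH addrA.
Qed.

Variable m : regular_measure R G.
Hypothesis m1 : rm m setT = 1.
Hypothesis sing : forall n, exists N : set (borel G), [/\ measurable N,
  rm m N = 0 & rm (mpow n) (~` N) = 0].

Local Notation H := (cint m).

(** All powers live on one Haar-null set, with a compact subset of nearly full
    mass and an open superset of small Haar measure.  Multiplying a test function
    by a cutoff between the two hardly changes its integrals against the powers,
    and makes its integral against a density small. *)
Lemma mpow_separated p (g : G -> R[i]) (C : R) : ucont g ->
  (forall f b, ucont f -> (forall x, nm (f x) <= b) ->
     nm (act L p f 0 - H (fun y => f y * g y)) <= C * b) -> opnorm_le L p C.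
Proof.
move=> cg hC.
have qH : quadrature H by exact: cint_quadrature.
suff key f b : ucont f -> (forall x, nm (f x) <= b) -> nm (act L p f 0) <= C * b.
  move=> f b cf fb x; have := key (fun y => f (x + y)) b (ucont_shift x cf) (fun y => fb _).
  by rewrite act_shift addr0.
move=> cf fb; apply/ler_addgt0Pr => e e0.
have [B B0 gB] := ucont_bounded compactG cg.
have b0 : 0 <= b by apply: le_trans (fb 0); exact: nm_ge0.
pose S := \sum_(k < size p) nm p`_k.
have S0 : 0 <= S by rewrite sumr_ge0 // => k _; exact: nm_ge0.
pose d := e / (2 * (b * B + S * b + 1)).
have D0 : 0 < b * B + S * b + 1 by rewrite ltr_wpDl // addr_ge0 // mulr_ge0 // ltW.
have d0 : 0 < d by rewrite divr_gt0 // mulr_gt0.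
have /choice[N hN] := sing.
have mN n : measurable (N n) by case: (hN n).
pose NN := \bigcup_n N n.
have mNN : measurable NN by exact: bigcup_measurable.
have NN0 : rm m NN = 0.
  apply/eqP; rewrite eq_le rm_ge0 andbT -lee_fin -rmE //.
  have h : (m NN <= \sum_(0 <= i <oo) m (N i))%E by exact: measure_sigma_subadditive.
  apply: (le_trans h); rewrite eseries0 // => i _ _.
  by rewrite rmE //; case: (hN i) => _ ->.
have [K1 [U [cK1 oU K1N NU hU]]] := reg_mP m mNN d0.
have mU := open_borel oU.
have mUd : rm m U < d.
  have mK1 := compact_borel hausdorffG cK1.
  have h1 := rmD m mU mK1 (subset_trans K1N NU).
  by have h2 := rm_le m mK1 mNN K1N; have h3 := rm_ge0 m K1; lra.
have [K [cK KN hK]] : exists K : set G, [/\ compact K, K `<=` NN &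
    forall k : 'I_(size p), rm (mpow k) (~` (K : set (borel G))) <= d].
  have /choice[K0 hK0] : forall k : nat, exists K0 : set G, [/\ compact K0, K0 `<=` NN &
      rm (mpow k) (~` (K0 : set (borel G))) <= d].
    move=> k; have [K0 [U0 [cK0 oU0 K0N NU0 h0]]] := reg_mP (mpow k) mNN d0.
    exists K0; split => //.
    have mK0 := compact_borel hausdorffG cK0; have mU0 := open_borel oU0.
    have [_ _ hk] := hN k.
    have mC : measurable (~` N k) by exact: measurableC.
    have := rmU (mpow k) mC (measurableD mU0 mK0); rewrite hk add0r => h1.
    apply: le_trans (ltW h0); apply: le_trans h1; apply: rm_le.
    - exact: measurableC.
    - by apply: measurableU => //; exact: measurableD.
    - move=> x K0x; have [Nx|Nx] := pselect (N k x); last by left.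
      by right; split => //; apply: NU0; exists k.
  pose K := \big[setU/set0]_(k < size p) K0 k.
  have KE x : K x <-> exists2 i, (i < size p)%N & K0 i x.
    rewrite /K -bigcup_mkord; split; first by case=> i; exists i.
    by case=> i; exists i.
  have cK : compact K by apply: bigsetU_compact => k _; case: (hK0 k).
  exists K; split => //.
    by move=> x /KE[i _ Kx]; have [_ + _] := hK0 i; exact.
  move=> k; have [ck _] := hK0 k; apply: le_trans.
  have mK0 := compact_borel hausdorffG ck; have mK := compact_borel hausdorffG cK.
  apply: rm_le; [exact: measurableC|exact: measurableC|].
  by move=> x Kx K0x; apply: Kx; apply/KE; exists k.
have [h [ch h01 h1 h0]] := @cutoff R G compactG hausdorffG _ _ cK oU (subset_trans KN NU).
have uh := ucont_real compactG ch.
have cfh : ucont (fun x => f x * (h x)%:C) by exact: ucontM.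
have fhb x : nm (f x * (h x)%:C) <= b.
  rewrite nmM nm_real; have /andP[ha hb] := h01 x; rewrite ger0_norm //.
  by rewrite -[leRHS]mulr1; apply: ler_pM; rewrite ?nm_ge0.
have s1 := hC _ b cfh fhb.
have bh := ucont_bmeas compactG uh.
have s2 : nm (H (fun y => f y * (h y)%:C * g y)) <= b * B * d.
  have uB : ucont (fun x : G => (b * B * h x)%:C : R[i]) by exact: ucont_realZ.
  apply: (le_trans (quad_dom qH _ uB _)).
  - exact: ucontM.
  - move=> x; rewrite nmM nmM nm_real; have /andP[ha hb] := h01 x.
    rewrite ger0_norm // mulrAC; apply: ler_wpM2r => //.
    by apply: ler_pM; rewrite ?nm_ge0.
  rewrite /= intZ //; apply: ler_wpM2l; first by rewrite mulr_ge0 // ltW.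
  apply: le_trans (ltW mUd).
  have mU' : measurable (U : set (borel G)) by [].
  have -> : rm m U = \int[m]_x \1_(U : set (borel G)) x by rewrite int_indic.
  apply: le_int => //; first exact: bmeas_indic.
  move=> x; rewrite indicE; have /andP[ha hb] := h01 x.
  have [Ux|Ux] := pselect (U x); first by rewrite mem_set.
  by rewrite h0 // ler0n.
have s3 : nm (act L p f 0 - act L p (fun x => f x * (h x)%:C) 0) <= S * (b * d).
  rewrite !act_cint // -sumrB; apply: (le_trans (nm_sum _ _ _)).
  rewrite /S mulr_suml; apply: ler_sum => k _; rewrite -mulrBr nmM.
  apply: ler_wpM2l; first exact: nm_ge0.
  have qk := cint_quadrature compactG (mpow1 k).
  rewrite -(quadB qk) //.
  have u1h : ucont (fun x : G => ((1 - h x))%:C : R[i]).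
    have := ucontB (@ucont_cst R G 1) uh; congr ucont; apply/funext => x.
    by rewrite rmorphB.
  have ub : ucont (fun x : G => (b * (1 - h x))%:C : R[i]) by exact: ucont_realZ.
  apply: (le_trans (quad_dom qk _ ub _)).
  - exact: ucontB.
  - move=> x; have /andP[ha hb] := h01 x.
    have -> : f x - f x * (h x)%:C = f x * (1 - h x)%:C by rewrite rmorphB mulrBr mulr1.
    rewrite nmM nm_real ger0_norm ?subr_ge0 //.
    by apply: ler_wpM2r => //; rewrite subr_ge0.
  have b1h := ucont_bmeas compactG u1h.
  rewrite /= intZ //; apply: ler_wpM2l => //; apply: le_trans (hK k).
  have mKC : measurable (~` (K : set (borel G))).
    by apply: measurableC; exact: compact_borel.
  have -> : rm (mpow k) (~` (K : set (borel G))) = \int[mpow k]_x \1_(~` (K : set (borel G))) x.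
    by rewrite int_indic.
  apply: le_int => //; first exact: bmeas_indic.
  move=> x; rewrite indicE; have /andP[ha hb] := h01 x.
  have [Kx|Kx] := pselect (K x); first by rewrite h1 // subrr ler0n.
  by rewrite mem_set //=; lra.
have s4 := nmD (act L p f 0 - act L p (fun x => f x * (h x)%:C) 0)
  (act L p (fun x => f x * (h x)%:C) 0).
rewrite subrK in s4.
have s5 := nmD (act L p (fun x => f x * (h x)%:C) 0
  - H (fun y => f y * (h y)%:C * g y)) (H (fun y => f y * (h y)%:C * g y)).
rewrite subrK in s5.
have s6 : b * B * d + S * (b * d) <= e.
  have -> : b * B * d + S * (b * d) = e / 2 * ((b * B + S * b) / (b * B + S * b + 1)).
    by rewrite /d; field; rewrite gt_eqF.
  have q1 : (b * B + S * b) / (b * B + S * b + 1) <= 1.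
    by rewrite ler_pdivrMr // mul1r lerDl.
  have e2 : 0 <= e / 2 by rewrite divr_ge0 // ltW.
  apply: (le_trans (ler_wpM2l e2 q1)); lra.
lra.
Qed.

End Powers.

(** * Charges: Jordan parts and uniform limits *)

Section LimitCharge.
Context d (T : measurableType d) (R : realType).
Variables (kappa : nat -> set T -> R) (rho : nat -> R).
Hypothesis kU : forall k A B, measurable A -> measurable B -> A `&` B = set0 ->
  kappa k (A `|` B) = kappa k A + kappa k B.
Hypothesis k_cont : forall k (F : (set T)^nat), (forall n, measurable (F n)) ->
  (forall n l, (n <= l)%N -> F l `<=` F n) -> \bigcap_n F n = set0 ->
  forall e : R, 0 < e -> exists n, forall l, (n <= l)%N -> `|kappa k (F l)| <= e.
Hypothesis k_cauchy : forall k l A, measurable A -> (k <= l)%N ->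
  `|kappa l A - kappa k A| <= rho k.
Hypothesis rho0 : forall e : R, 0 < e -> exists k, forall l, (k <= l)%N -> rho l <= e.

Lemma uniform_cauchy_limit (u : nat -> R) :
  (forall k l, (k <= l)%N -> `|u l - u k| <= rho k) ->
  exists z, forall k, `|u k - z| <= rho k.
Proof.
move=> hu; have cu : cvg (u n @[n --> \oo]).
  apply/cauchy_cvgP; apply/cauchy_ballP => e e0.
  have e2 : 0 < e / 4 by rewrite divr_gt0.
  have [k hk] := rho0 e2.
  have near_k : \forall n \near \oo, `|u n - u k| <= e / 4.
    by exists k => // n /= kn; apply: (le_trans (hu k n kn)); exact: hk.
  exists ([set y | `|y - u k| <= e / 4], [set y | `|y - u k| <= e / 4]) => //=.
  move=> [a b] [/= h1 h2]; rewrite -ball_normE /=.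
  have h3 : `|a - u k| <= e / 4 := h1; have h4 : `|b - u k| <= e / 4 := h2.
  have := ler_distD (u k) a b; rewrite [`|u k - b|]distrC; lra.
exists (lim (u n @[n --> \oo])) => k; apply/ler_addgt0Pr => e e0.
have /cvgrPdist_le/(_ e e0)[n _ hn] := cu.
have h1 := hn (maxn n k) (leq_maxl _ _).
have h2 := hu k _ (leq_maxr n k).
set z := lim _ in h1 *.
rewrite distrC in h1; rewrite distrC in h2.
have := ler_distD (u (maxn n k)) (u k) z; lra.
Qed.

(** A uniform limit of charges is a charge: continuity at the empty set survives
    a uniform limit.  The hypotheses state charge-like properties of plain
    functions, to be applied to real and imaginary parts. *)
Lemma limit_charge : exists nu : {charge set T -> \bar R},
  forall k A, measurable A -> `|kappa k A - fine (nu A)| <= rho k.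
Proof.
have /choice[z hz] : forall A : set T, exists z, measurable A ->
    forall k, `|kappa k A - z| <= rho k.
  move=> A; have [mA|nA] := pselect (measurable A); last by exists 0.
  have [z hz] := uniform_cauchy_limit (fun k l => @k_cauchy k l A mA).
  by exists z.
have zU A B : measurable A -> measurable B -> A `&` B = set0 ->
    z (A `|` B) = z A + z B.
  move=> mA mB AB; apply/eqP; rewrite -subr_eq0 -normr_le0.
  apply/ler_addgt0Pr => e e0; rewrite add0r.
  have e3 : 0 < e / 3 by rewrite divr_gt0.
  have [k /(_ k (leqnn k)) hk] := rho0 e3.
  have h1 := le_trans (hz _ (measurableU _ _ mA mB) k) hk.
  have h2 := le_trans (hz _ mA k) hk; have h3 := le_trans (hz _ mB k) hk.
  rewrite kU // in h1; move: h1 h2 h3; rewrite !ler_norml.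
  by move=> /andP[a1 a2] /andP[a3 a4] /andP[a5 a6]; apply/andP; split; lra.
have z0 : z set0 = 0.
  have := zU set0 set0 measurable0 measurable0 (setI0 _); rewrite setU0 => h.
  by apply: (addrI (z set0)); rewrite addr0.
pose nu (A : set T) : \bar R := (z A)%:E.
have nu0 : nu set0 = 0%E by rewrite /nu z0.
have nu_fin A : measurable A -> nu A \is a fin_num by [].
have nu_sigma : semi_sigma_additive nu.
  move=> F mF tF mUF.
  pose U n := \big[setU/set0]_(i < n) F i.
  have mU n : measurable (U n) by exact: bigsetU_measurable.
  have UE n x : U n x <-> exists2 i, (i < n)%N & F i x.
    by rewrite /U -bigcup_mkord; split => -[j]; exists j.
  have sumE n : (\sum_(0 <= i < n) nu (F i))%E = (z (U n))%:E.
    elim: n => [|n IH]; first by rewrite big_geq // /U big_ord0 z0.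
    rewrite big_nat_recr //= IH /U big_ord_recr /= zU //; first exact: mU.
    rewrite -subset0 => x [/UE[i lin Fi] Fn].
    move/trivIsetP : tF => /(_ i n Logic.I Logic.I); rewrite neq_ltn lin => /(_ isT).
    by rewrite -subset0 => h; exact: (h x).
  pose V n := \bigcup_n F n `\` U n.
  have mV n : measurable (V n) by exact: measurableD.
  have zV n : z (\bigcup_n F n) = z (U n) + z (V n).
    rewrite -zU //; last by rewrite /V setDE setICA setICr setI0.
    congr z; rewrite /V; apply/seteqP; split => [x Fx|x [/UE[i _ Fi]|[]//]].
      by have [Ux|Ux] := pselect (U n x); [left|right; split].
    by exists i.
  under eq_fun do rewrite sumE.
  apply/fine_cvgP; split; first by exists 0%N.
  apply/cvgrPdist_le => e e0; have e2 : 0 < e / 2 by rewrite divr_gt0.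
  have [k /(_ k (leqnn k)) hk] := rho0 e2.
  have [||n hn] := @k_cont k V mV _ _ (e / 2) e2.
  - move=> n l nl x [Fx Ux]; split => // /UE[i lin Fi]; apply: Ux.
    by apply/UE; exists i => //; exact: leq_trans nl.
  - rewrite -subset0 => x hx; have [[i _ Fi] _] := hx 0%N Logic.I.
    by have [_] := hx i.+1 Logic.I; apply; apply/UE; exists i.
  exists n => // l /= nl; rewrite (zV l) addrC addKr.
  have h1 := hn l nl; have h2 := le_trans (hz _ (mV l) k) hk.
  have := ler_distD 0 (z (V l)) (kappa k (V l)).
  move: h1 h2; rewrite !ler_norml => /andP[a1 a2] /andP[a3 a4] _.
  by apply/andP; split; lra.
pose nuC : {charge set T -> \bar R} := HB.pack nu (isCharge.Build _ _ _ nu nu0 nu_fin nu_sigma).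
by exists nuC => k A mA; exact: hz.
Qed.

End LimitCharge.

Section JordanParts.
Context d (T : measurableType d) (R : realType).
Variable nu : {charge set T -> \bar R}.
Implicit Types A B : set T.

(** [true] selects the negative part, in agreement with the sign [(-1) ^+ b]. *)
Definition jpart (b : bool) : {finite_measure set T -> \bar R} :=
  if b then (jordan_neg (hahnP nu) : {finite_measure set T -> \bar R})
  else (jordan_pos (hahnP nu) : {finite_measure set T -> \bar R}).

Lemma jpart_decomp A : measurable A ->
  fine (nu A) = fine (jpart false A) - fine (jpart true A).
Proof.
move=> mA; rewrite (jordan_decomp (hahnP nu) mA) /cadd /= cscaleN1.
by rewrite fineD ?fineN // ?fin_numN fin_num_measure.
Qed.

Lemma charge_integralE (h : T -> R) :
  charge_integral nu h = \int[jpart false]_x h x - \int[jpart true]_x h x.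
Proof. by []. Qed.

(** The Jordan parts of [A] are, up to sign, values of the charge on the traces of
    [A] on the Hahn decomposition. *)
Lemma jpart_le A (s : R) b : measurable A ->
  (forall B, measurable B -> B `<=` A -> `|fine (nu B)| <= s) ->
  fine (jpart b A) <= s.
Proof.
move=> mA hs; have [[mP _] [mN _] _ _] := hahnP nu.
case: b => /=.
  have -> : fine (jordan_neg (hahnP nu) A) = - fine (nu (A `&` hahn_neg nu)).
    have -> : jordan_neg (hahnP nu) A = (- nu (A `&` hahn_neg nu))%E.
      by rewrite jordan_negE cjordan_negE /crestr0 mem_set.
    by rewrite fineN.
  apply: (le_trans (ler_norm _)); rewrite normrN; apply: hs.
    exact: measurableI.
  exact: subIsetl.
have -> : jordan_pos (hahnP nu) A = nu (A `&` hahn_pos nu).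
  by rewrite jordan_posE cjordan_posE /crestr0 mem_set.
apply: (le_trans (ler_norm _)); apply: hs; first exact: measurableI.
exact: subIsetl.
Qed.

End JordanParts.

(** * Complex measures as combinations of positive measures *)

Section ComplexMeasures.
Variables (R : realType) (G : topologicalZmodType).
Implicit Types (m : {finite_measure set (borel G) -> \bar R}) (f : borel G -> R[i]).
Implicit Types (A B : set (borel G)) (nu : cmeasure R G).

Definition bmeasC f := bmeas (fun x => complex.Re (f x)) /\
  bmeas (fun x => complex.Im (f x)).

Lemma cintE m f : cint m f =
  (\int[m]_x complex.Re (f x))%:C + 'i%C * (\int[m]_x complex.Im (f x))%:C.
Proof. by rewrite /cint [LHS]complexE. Qed.

Lemma cint_realE m (h : borel G -> R) : cint m (fun x => (h x)%:C) = (\int[m]_x h x)%:C.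
Proof.
by rewrite cintE /= (int_cst m 0) mul0r mulr0 addr0.
Qed.

Lemma comb_cint_eq0 (J : finType) (a : J -> R[i])
    (m : J -> {finite_measure set (borel G) -> \bar R}) f :
  (forall A, measurable A -> \sum_j a j * (rm (m j) A)%:C = 0) ->
  bmeasC f -> \sum_j a j * cint (m j) f = 0.
Proof.
move=> a0 [bR bI].
under eq_bigr do rewrite cintE mulrDr [X in _ + X]mulrCA.
rewrite big_split /= (comb_int_eq0 a0 bR) -mulr_sumr.
by rewrite (comb_int_eq0 a0 bI) mulr0 addr0.
Qed.

(** A complex measure is a combination of four positive measures with these
    coefficients: [j.1] selects the imaginary part and [j.2] the negative one. *)
Definition ccoef (j : bool * bool) : R[i] :=
  (if j.1 then 'i%C else 1) * (if j.2 then -1 else 1).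

Definition cpart nu (j : bool * bool) :=
  if j.1 then jpart (cim nu) j.2 else jpart (cre nu) j.2.

Lemma sum_bool2 (V : nmodType) (F : bool * bool -> V) :
  \sum_j F j = F (false, false) + F (false, true) + (F (true, false) + F (true, true)).
Proof.
rewrite (eq_bigr (fun p => F (p.1, p.2))); last by case.
rewrite -(pair_bigA _ (fun i j => F (i, j))) /= !big_bool /= addrC.
by congr (_ + _); rewrite addrC.
Qed.

Lemma nm_ccoef j : nm (ccoef j) = 1.
Proof.
have i1 : nm ('i%C : R[i]) = 1 by rewrite /nm /= expr0n expr1n add0r sqrtr1.
have n1 : nm (-1 : R[i]) = 1 by rewrite nmN nm1.
rewrite /ccoef nmM; have [n2 n3] : nm (if j.1 then 'i%C else 1 : R[i]) = 1 /\
  nm (if j.2 then -1 else 1 : R[i]) = 1.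
  by split; [case: j.1; [exact: i1|exact: nm1]|case: j.2; [exact: n1|exact: nm1]].
by rewrite n2 n3 mulr1.
Qed.

Lemma cmeasure_parts nu A : measurable A ->
  nu A = \sum_j ccoef j * (rm (cpart nu j) A)%:C.
Proof.
move=> mA; rewrite sum_bool2 /cmeasure_fun (jpart_decomp (cre nu) mA) (jpart_decomp (cim nu) mA) /ccoef /cpart /=.
by rewrite [LHS]complexE /= !rmorphB /= /rm; ring.
Qed.

Lemma cintegral_parts nu f : cintegral nu f = \sum_j ccoef j * cint (cpart nu j) f.
Proof.
rewrite sum_bool2 /cintegral !charge_integralE /ccoef /cpart /=.
rewrite /cint; simpc; congr (_ +i* _); ring.
Qed.

(** Integrals depend on the set function only, and may be computed with any
    representation by finite measures. *)
Lemma cintegral_comb nu (J : finType) (a : J -> R[i])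
    (m : J -> {finite_measure set (borel G) -> \bar R}) f :
  (forall A, measurable A -> nu A = \sum_j a j * (rm (m j) A)%:C) ->
  bmeasC f -> cintegral nu f = \sum_j a j * cint (m j) f.
Proof.
move=> nuE bf; rewrite cintegral_parts; apply/eqP; rewrite -subr_eq0; apply/eqP.
pose b (j : (bool * bool) + J) := match j with inl i => ccoef i | inr i => - a i end.
pose m' (j : (bool * bool) + J) := match j with inl i => cpart nu i | inr i => m i end.
have := @comb_cint_eq0 _ b m' f _ bf.
rewrite big_sumType /= => h; rewrite -[RHS]h.
  by rewrite -sumrN; congr (_ + _); apply: eq_bigr => j _; rewrite mulNr.
move=> A mA; rewrite big_sumType /= -cmeasure_parts // nuE // -big_split /=.
by rewrite big1 // => j _; rewrite mulNr subrr.
Qed.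

Lemma cint_affine m (z : R[i]) (h k : borel G -> R) : bmeas h -> bmeas k ->
  cint m (fun x => z * (h x)%:C - (k x)%:C)
  = z * (\int[m]_x h x)%:C - (\int[m]_x k x)%:C.
Proof.
move=> bh bk; rewrite /cint [RHS]complexEE; congr (_ +i* _).
  rewrite ReB ReM /= mulr0 subr0 -intZ // -intB //; last exact: bmeasZ.
  by apply: eq_Rintegral => x _; rewrite ReB ReM /= mulr0 subr0.
rewrite ImB ImM /= mulr0 add0r subr0 -intZ //.
by apply: eq_Rintegral => x _; rewrite ImB ImM /= mulr0 add0r subr0.
Qed.

(** The partition into the set itself and empty sets. *)
Lemma total_variation_ge (f : set (borel G) -> R[i]) A : measurable A ->
  ((nm (f A))%:E <= Defs.total_variation f A)%E.
Proof.
move=> mA; pose F n := if n is 0%N then A else set0 : set (borel G).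
apply: (@le_trans _ _ (\sum_(0 <= n <oo) (complex.Re `|f (F n)|)%:E)%E).
  apply: le_trans (nneseries_lim_ge 1 _); last by move=> n _ _; rewrite lee_fin nm_ge0.
  by rewrite big_nat1.
apply: ereal_sup_ubound; exists F => //; split.
- by case=> [|n]; [exact: mA|exact: measurable0].
- by apply/trivIsetP => -[|i] [|j] //= _ _ _; rewrite ?setI0 ?set0I.
- apply/seteqP; split => x; first by case=> -[].
  by move=> Ax; exists 0%N.
Qed.

(** With [jpart_le] this bounds the total variation by values of the measure. *)
Lemma total_variation_parts nu A : measurable A ->
  (Defs.total_variation nu A <= \sum_j (rm (cpart nu j) A)%:E)%E.
Proof.
move=> mA; apply: ge_ereal_sup => _ [F [mF tF FA] <-].
apply: (@le_trans _ _ (\sum_(0 <= n <oo) \sum_j (rm (cpart nu j) (F n))%:E)%E).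
  apply: lee_nneseries => n _; first by move=> _; rewrite lee_fin; exact: (nm_ge0 (nu (F n))).
  rewrite sumEFin lee_fin -[complex.Re _]/(nm _) cmeasure_parts //.
  apply: (le_trans (nm_sum _ _ _)); apply: ler_sum => j _.
  by rewrite nmM nm_ccoef mul1r nm_real ger0_norm // rm_ge0.
rewrite nneseries_sum; last by move=> j n _; rewrite lee_fin rm_ge0.
apply: lee_sum => j _; rewrite -rmE // -FA.
have -> : cpart nu j (\bigcup_n F n) = (\sum_(0 <= n <oo) cpart nu j (F n))%E.
  have -> : cpart nu j (\bigcup_n F n) = (\sum_(0 <= n <oo | n \in setT) cpart nu j (F n))%E.
    exact: measure_bigcup.
  by apply: eq_eseriesl => n; rewrite in_setT.
by apply: lee_nneseries => n _; rewrite ?lee_fin ?rm_ge0 // -rmE.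
Qed.

End ComplexMeasures.

(** * The spectrum and approximate inverses *)

Section Spectrum.
Variables (R : realType) (G : topologicalZmodType).
Hypotheses (compactG : compact [set: G]) (hausdorffG : hausdorff_space G).
Variable mu : cmeasure R G.
Variable M : regular_measure R G.
Hypothesis muM : forall A, measurable A -> mu A = (rm M A)%:C.
Hypothesis M1 : rm M setT = 1.
Implicit Types (A B : set (borel G)) (f : G -> R[i]) (p q : {poly R[i]}) (z w : R[i]).

Local Notation mpow := (mpow compactG hausdorffG (reg_mP M)).
Local Notation pmeas := (pmeas compactG hausdorffG M).
Local Notation L := (cint M).

Let qL : quadrature L. Proof. exact: cint_quadrature. Qed.

Lemma cintegral_prob f : bmeasC f -> cintegral mu f = L f.
Proof.
move=> bf; rewrite (@cintegral_comb _ _ mu 'I_1 (fun=> 1) (fun=> M) f _ bf).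
  by rewrite big_ord1 mul1r.
by move=> A mA; rewrite big_ord1 mul1r muM.
Qed.

Lemma bmeasC_real (h : borel G -> R) : bmeas h -> bmeasC (fun x => (h x)%:C).
Proof. by move=> bh; split => //=; exact: bmeas_cst. Qed.

Lemma bmeas_mpow n A : measurable A -> bmeas (fun x : borel G => rm (mpow n) (translate x A)).
Proof. by move=> mA; apply: bmeas_translate => //; exact: reg_mP. Qed.

Lemma convpow_mpow n A : measurable A -> convpow mu n A = (rm (mpow n) A)%:C.
Proof.
elim: n A => [//|n IH] A mA; rewrite -[LHS]/(Defs.conv mu (convpow mu n) A) /Defs.conv.
have -> : (fun x : borel G => convpow mu n [set y : G | A ((x : G) + y)])
    = fun x : borel G => (rm (mpow n) (translate x A))%:C.
  by apply/funext => x; rewrite -/(translate x A) IH //; exact: translate_borel.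
rewrite cintegral_prob; last by apply: bmeasC_real; exact: bmeas_mpow.
by rewrite cint_realE conv_finE.
Qed.

Lemma delta_translate (x : borel G) A : rm (mpow 0) (translate x A) = \1_A x :> R.
Proof.
rewrite /= rm_dirac indicE; congr (nat_of_bool _)%:R.
by apply/idP/idP; rewrite !inE /translate /= addr0.
Qed.

(** The convolution that defines the spectrum, as a combination of values of
    positive measures; [comb_cint_eq0] and [cint_conv] apply to this form. *)
Lemma conv_affine nu z A : measurable A ->
  Defs.conv nu (fun B => z * delta0 R B - mu B) A
  = \sum_j ccoef R j * (z * (rm (cpart nu j) A)%:C
      - (rm (conv_fin compactG hausdorffG (cpart nu j) M) A)%:C).
Proof.
move=> mA; rewrite /Defs.conv cintegral_parts; apply: eq_bigr => j _; congr (_ * _).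
have -> : (fun x : borel G => z * delta0 R [set y : G | A ((x : G) + y)]
    - mu [set y : G | A ((x : G) + y)])
    = fun x => z * (\1_A x)%:C - (rm M (translate x A))%:C.
  apply/funext => x; rewrite -delta_translate -muM //; exact: translate_borel.
rewrite cint_affine; [|exact: bmeas_indic|by apply: bmeas_translate => //; exact: reg_mP].
by rewrite int_indic // conv_finE.
Qed.

Lemma cint_lin (m : {finite_measure set (borel G) -> \bar R}) z f g :
  ucont f -> ucont g -> cint m (fun x => z * f x - g x) = z * cint m f - cint m g.
Proof.
move=> cf cg; have bfR := ucont_bmeas_Re compactG cf; have bfI := ucont_bmeas_Im compactG cf.
have bgR := ucont_bmeas_Re compactG cg; have bgI := ucont_bmeas_Im compactG cg.
have bz a (h : borel G -> R) : bmeas h -> bmeas (fun x => a * h x) by exact: bmeasZ.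
rewrite /cint [RHS]complexEE; congr (_ +i* _).
  rewrite ReB ReM /= -!intZ // -!intB //; try exact: bmeasZ; try by apply: bmeasB; exact: bmeasZ.
  by apply: eq_Rintegral => x _; rewrite ReB ReM.
rewrite ImB ImM /= -!intZ // -intD //; try exact: bmeasZ.
rewrite -intB //; last by apply: bmeasD; exact: bmeasZ.
by apply: eq_Rintegral => x _; rewrite ImB ImM.
Qed.

(** By rotation onto the real axis. *)
Lemma cint_le (m : {finite_measure set (borel G) -> \bar R}) f (b : R) :
  ucont f -> (forall x, nm (f x) <= b) -> nm (cint m f) <= b * rm m setT.
Proof.
move=> cf fb; set v := cint m f; have [v0|v0] := eqVneq (nm v) 0.
  by rewrite v0 mulr_ge0 ?rm_ge0 // (bound_ge0 fb).
have vp : 0 < nm v by rewrite lt0r v0 nm_ge0.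
pose c := cj v / (nm v)%:C.
have nc : nm c = 1.
  by rewrite /c nmM nmV nm_real nm_cj ger0_norm ?nm_ge0 // divff.
have cv : complex.Re (c * v) = nm v.
  have nv0 : (nm v)%:C != 0 :> R[i] by rewrite (inj_eq (@complexI _)).
  rewrite /c mulrAC [cj v * v]mulrC mul_cj expr2 rmorphM mulfK //.
have bR := ucont_bmeas_Re compactG (ucontZ c cf).
rewrite -cv cint_Re //; apply: (le_trans (ler_norm _)); apply: int_le => // x.
by apply: (le_trans (nm_Re _)); rewrite nmM nc mul1r.
Qed.

(** Integrating [z * f - T f] against an inverse of [z - mu] gives [f 0], so the
    mass of the inverse serves as [K]. *)
Lemma spectrum_lower z : ~ spectrum mu z -> exists2 K : R, 0 < K &
  forall f b, ucont f -> (forall x, nm (act L (z%:P - 'X) f x) <= b) ->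
    forall x, nm (f x) <= K * b.
Proof.
move=> /contrapT[nu _ nuI].
pose K := \sum_j rm (cpart nu j) setT + 1.
have K0 : 0 < K by rewrite ltr_wpDl // sumr_ge0 // => j _; exact: rm_ge0.
exists K => //.
have actE f x : ucont f -> act L (z%:P - 'X) f x = z * f x - cvl L f x.
  by move=> cf; rewrite actB actC -[X in act _ X]mul1r actMX act1.
suff key f b : ucont f -> (forall x, nm (act L (z%:P - 'X) f x) <= b) ->
    nm (f 0) <= K * b.
  move=> f b cf fb x; have := key (fun y => f (x + y)) b (ucont_shift x cf).
  rewrite addr0; apply => y; rewrite act_shift //; exact: fb.
move=> cf fb; pose Q j := conv_fin compactG hausdorffG (cpart nu j) M.
(* The identity of set functions that expresses inversion, written as one
   vanishing combination of measures. *)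
pose a (j : bool * bool + (bool * bool + 'I_1)) :=
  match j with inl i => ccoef R i * z | inr (inl i) => - ccoef R i | _ => -1 end.
pose m (j : bool * bool + (bool * bool + 'I_1)) :=
  match j with inl i => cpart nu i | inr (inl i) => Q i | _ => mpow 0 end.
have bf : bmeasC f by split; [exact: ucont_bmeas_Re|exact: ucont_bmeas_Im].
have := @comb_cint_eq0 _ _ _ a m f _ bf.
rewrite !big_sumType /= big_ord1 => h.
have {h} fE : f 0 = \sum_j ccoef R j * cint (cpart nu j) (act L (z%:P - 'X) f).
  have {h} h := h _; rewrite cint_dirac // mulN1r in h.
  have : \sum_j ccoef R j * z * cint (cpart nu j) f
      + (\sum_j - ccoef R j * cint (Q j) f) = f 0.
    apply/eqP; rewrite -subr_eq0 -addrA; apply/eqP; apply: h.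
    move=> A mA; rewrite !big_sumType /= big_ord1 mulN1r addrA -big_split /=.
    rewrite -[X in - X]/(delta0 R A) -(nuI _ mA) conv_affine //.
    by apply/eqP; rewrite subr_eq0; apply/eqP; apply: eq_bigr => j _; ring.
  move=> <-; rewrite -big_split /=; apply: eq_bigr => j _.
  rewrite (cint_conv compactG hausdorffG M1) // mulNr -mulrA -mulrBr; congr (_ * _).
  have cT := cvl_ucont qL cf.
  rewrite (_ : act L (z%:P - 'X) f = fun x => z * f x - cvl L f x); last first.
    by apply/funext => x; exact: actE.
  by rewrite cint_lin.
rewrite fE; apply: (le_trans (nm_sum _ _ _)).
have b0 := bound_ge0 fb.
apply: (@le_trans _ _ (\sum_j b * rm (cpart nu j) setT)).
  apply: ler_sum => j _; rewrite nmM nm_ccoef mul1r.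
  by apply: cint_le => //; exact: act_ucont.
by rewrite -mulr_sumr mulrC ler_wpM2r // lerDl.
Qed.

(** Regularity is closed where lower bounds hold: the lower bound at [z] bounds
    the approximate inverses at a nearby [w], and a bounded approximate inverse at
    [w] is an approximate inverse at [z].  The constant 16 leaves room for both
    absorptions. *)
Lemma regular_close z w (K : R) : 0 < K ->
  (forall f b, ucont f -> (forall x, nm (act L (z%:P - 'X) f x) <= b) ->
    forall x, nm (f x) <= K * b) ->
  regular L w -> nm (z - w) <= 1 / 16 / K -> regular L z.
Proof.
move=> K0 hK rw zw; have [q hq] := regular_approx qL rw (divr_gt0 ltr01 (ltr0n R 4)).
have q4 : opnorm_le L q (4 * K).
  move=> f b cf fb.
  have b0 := bound_ge0 fb; have cqf := act_ucont qL q cf.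
  have [B B0 fB] := ucont_bounded compactG cqf.
  (* The bound for the supremum of the values contains that supremum with a small
     factor, and is solved for it. *)
  pose E := [set nm (act L q f x) | x in [set: G]].
  have supE : has_sup E.
    by split; [exists (nm (act L q f 0)), 0|exists B => _ [x _ <-]].
  have fs x : nm (act L q f x) <= sup E by apply: ub_le_sup; [exact: supE.2|exists x].
  have s0 : 0 <= sup E := bound_ge0 fs.
  have eqzq : (z%:P - 'X) * q = 1 - (1 - q * (w%:P - 'X)) + (z - w) *: q.
    by rewrite -mul_polyC polyCB; ring.
  have hz x : nm (act L (z%:P - 'X) (act L q f) x) <= 5 / 4 * b + nm (z - w) * sup E.
    rewrite -actM // eqzq actD actZ actB act1; apply: (le_trans (nmD _ _)).
    apply: lerD; last by rewrite nmM ler_wpM2l ?nm_ge0.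
    apply: (le_trans (nmB _ _)); have := hq f b cf fb x; have := fb x; lra.
  have h := hK _ _ cqf hz.
  have zK : nm (z - w) * K <= 1 / 16 by rewrite -ler_pdivlMr.
  have : sup E <= K * (5 / 4 * b + nm (z - w) * sup E).
    by apply: sup_le_ub; [exact: supE.1|move=> _ [x _ <-]].
  have -> : K * (5 / 4 * b + nm (z - w) * sup E)
    = 5 / 4 * (K * b) + (nm (z - w) * K) * sup E by ring.
  have Kb : 0 <= K * b by rewrite mulr_ge0 // ltW.
  have : nm (z - w) * K * sup E <= 1 / 16 * sup E by rewrite ler_wpM2r.
  by move=> h1 h2 x; have := fs x; rewrite -mulrA; lra.
exists q, (1 / 4 + nm (w - z) * (4 * K)); split; last exact: regular_perturb.
have zK : nm (z - w) * K <= 1 / 16 by rewrite -ler_pdivlMr.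
by rewrite nm_distC mulrCA; lra.
Qed.

(** Outside the spectrum, [regular_close] makes regularity propagate from
    infinity along a vertical half-line. *)
Lemma spectrum_regular z0 : (forall z, complex.Im z != 0 -> ~ spectrum mu z) ->
  ~ spectrum mu z0 -> regular L z0.
Proof.
move=> nonreal z0S; pose s : R := if 0 <= complex.Im z0 then 1 else -1.
have s2 : s * s = 1 by rewrite /s; case: ifP => _; rewrite ?mulrNN mulr1.
have sI : 0 <= s * complex.Im z0.
  rewrite /s; case: ifP => [|/negbT]; first by rewrite mul1r.
  by rewrite -ltNge mulN1r oppr_ge0 => /ltW.
pose Z (t : R) : R[i] := z0 + 'i%C * (s * t)%:C.
have ImZ t : complex.Im (Z t) = complex.Im z0 + s * t.
  by rewrite /Z ImD ImM /= mul0r add0r mul1r.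
have ZZ t u : nm (Z t - Z u) = `|t - u|.
  have -> : Z t - Z u = 'i%C * (s * (t - u))%:C.
    by rewrite /Z mulrBr rmorphB; ring.
  rewrite nmM nm_real normrM; have -> : nm ('i%C : R[i]) = 1.
    by rewrite /nm /= expr0n expr1n add0r sqrtr1.
  have -> : `|s| = 1 by rewrite /s; case: ifP => _; rewrite ?normrN normr1.
  by rewrite !mul1r.
have ZS t : 0 <= t -> ~ spectrum mu (Z t).
  rewrite le_eqVlt => /orP[/eqP <-|t0].
    by rewrite /Z mulr0 mulr0 addr0.
  apply: nonreal; rewrite ImZ; apply/eqP => h.
  have : s * (complex.Im z0 + s * t) = 0 by rewrite h mulr0.
  rewrite mulrDr mulrA s2 mul1r => h2; lra.
have Zlarge t : 1 < t -> regular L (Z t).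
  move=> t1; apply: regular_large => //; apply: lt_le_trans (nm_Im _).
  have -> : `|complex.Im (Z t)| = `|s * complex.Im (Z t)|.
    have s1 : `|s| = 1 by rewrite /s; case: ifP => _; rewrite ?normrN normr1.
    by rewrite normrM s1 mul1r.
  by rewrite ImZ mulrDr mulrA s2 mul1r ger0_norm; lra.
pose E : set R := [set t | 0 <= t /\ forall u, t < u -> regular L (Z u)].
have E1 : E 1 by split => // u; exact: Zlarge.
have Elb : has_lbound E by exists 0 => t [].
have Einf : has_inf E by split => //; exists 1.
pose t0 := inf E.
have t00 : 0 <= t0 by apply: lb_le_inf => [|t []//]; exists 1.
have above u : t0 < u -> regular L (Z u).
  by move=> tu; have [t [_ ht] /ht] := inf_lt Einf.1 tu.
have at_t0 : regular L (Z t0).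
  have [K K0 hK] := spectrum_lower (ZS _ t00).
  have d0 : 0 < 1 / 16 / K by rewrite !divr_gt0.
  apply: (regular_close K0 hK (above (t0 + 1 / 16 / K) _)); first by rewrite ltrDl.
  by rewrite ZZ opprD addNKr normrN gtr0_norm.
have [t0p|] := ltP 0 t0; last first.
  move=> t0n; have <- : Z 0 = z0 by rewrite /Z !mulr0 addr0.
  by have -> : 0 = t0 by apply/eqP; rewrite eq_le t00.
have [r r0 hr] := regular_open qL at_t0.
pose d := Num.min r t0; have d0 : 0 < d by rewrite lt_min r0.
have dr : d <= r by rewrite ge_min lexx.
have dt : d <= t0 by rewrite ge_min lexx orbT.
have : E (t0 - d).
  split; first by rewrite subr_ge0.
  move=> u ud; have [ut|] := ltP t0 u; first exact: above.
  move=> ut; apply: hr; rewrite ZZ ler_norml; apply/andP; split; lra.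
by move=> /(ge_inf Elb); rewrite -/t0; lra.
Qed.

End Spectrum.

Section RegularSpectrum.
Variables (R : realType) (G : topologicalZmodType).
Hypotheses (compactG : compact [set: G]) (hausdorffG : hausdorff_space G).
Variable mu : cmeasure R G.
Variable M : regular_measure R G.
Hypothesis muM : forall A, measurable A -> mu A = (rm M A)%:C.
Hypothesis M1 : rm M setT = 1.
Implicit Types (A B : set (borel G)) (f : G -> R[i]) (p q : {poly R[i]}) (z w : R[i]).

Local Notation mpow := (mpow compactG hausdorffG (reg_mP M)).
Local Notation pmeas := (pmeas compactG hausdorffG M).
Local Notation L := (cint M).

Let qL : quadrature L. Proof. exact: cint_quadrature. Qed.

Let S p := \sum_(k < size p) nm p`_k.

Lemma pmeas_le p A (e : R) : (forall k : 'I_(size p), rm (mpow k) A <= e) ->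
  nm (pmeas p A) <= S p * e.
Proof.
move=> he; apply: (le_trans (nm_sum _ _ _)); rewrite mulr_suml.
apply: ler_sum => k _; rewrite nmM nm_real ger0_norm ?rm_ge0 //.
by rewrite ler_wpM2l ?nm_ge0.
Qed.

Lemma pmeasU p A B : measurable A -> measurable B -> A `&` B = set0 ->
  pmeas p (A `|` B) = pmeas p A + pmeas p B.
Proof.
move=> mA mB AB; rewrite -big_split /=; apply: eq_bigr => k _.
rewrite -mulrDr -rmorphD; congr (_ * _%:C).
have mU := measurableU _ _ mA mB.
have := rmD (mpow k) mU mA (@subsetUl _ _ _).
have -> : (A `|` B) `\` A = B.
  rewrite setDUl setDv set0U; apply/setDidPl; rewrite setIC //.
by move=> ->; rewrite addrC subrK.
Qed.

Lemma pmeas_continuous p (F : (set (borel G))^nat) (e : R) :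
  (forall n, measurable (F n)) -> (forall n l, (n <= l)%N -> F l `<=` F n) ->
  \bigcap_n F n = set0 -> 0 < e ->
  exists n, forall l, (n <= l)%N -> nm (pmeas p (F l)) <= e.
Proof.
move=> mF dF F0 e0.
have S0 : 0 <= S p by rewrite sumr_ge0 // => k _; exact: nm_ge0.
have S1 : 0 < S p + 1 by rewrite ltr_wpDl.
have d0 : 0 < e / (S p + 1) by rewrite divr_gt0.
have /choice[N hN] : forall k, exists n, rm (mpow k) (F n) <= e / (S p + 1).
  move=> k; have [n] := rm_cvg_bigcap (mpow k) mF dF d0.
  by rewrite F0 rm0 add0r => /ltW; exists n.
exists (\max_(k < size p) N k)%N => l hl.
apply: (@le_trans _ _ (S p * (e / (S p + 1)))).
  apply: pmeas_le => k; apply: le_trans (hN k); apply: rm_le => //.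
  by apply: dF; apply: leq_trans hl; exact: leq_bigmax.
by rewrite mulrCA ger_pMr // ler_pdivrMr // mul1r lerDl.
Qed.

(** The partial sums of a Neumann series converge in operator norm, which by
    [opnorm_le_pmeas] dominates values on sets; [limit_charge] provides the limit. *)
Lemma regular_limit z : regular L z ->
  exists (q : nat -> {poly R[i]}) (rho : nat -> R) (nu : cmeasure R G),
  [/\ forall k A, measurable A -> nm (pmeas (q k) A - nu A) <= rho k,
      forall k, opnorm_le L (1 - q k * (z%:P - 'X)) (rho k) &
      forall e : R, 0 < e -> exists k, rho k <= e].
Proof.
move=> [q [c [c1 qc]]]; have c0 := opnorm_le_ge0 qc.
have [d d0 qd] := opnorm_le_ex qL q.
pose e := 1 - q * (z%:P - 'X).
pose Q k := q * \sum_(i < k) e ^+ i.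
pose rho k := d * c ^+ k / (1 - c).
have c1' : 0 < 1 - c by rewrite subr_gt0.
have QE k : 1 - Q k * (z%:P - 'X) = e ^+ k.
  have : e ^+ k - 1 = (e - 1) * \sum_(i < k) e ^+ i by rewrite subrX1.
  by move=> /eqP; rewrite subr_eq => /eqP ->; rewrite /Q /e; ring.
have rho0 (b : R) : 0 < b -> exists k, forall l, (k <= l)%N -> rho l <= b.
  move=> b0; have b' : 0 < b * (1 - c) / d by rewrite !(divr_gt0, mulr_gt0).
  have [k _ hk] := expr_small c0 c1 b'; exists k => l /hk /=.
  by rewrite ler_pdivlMr // mulrC => h; rewrite /rho ler_pdivrMr.
have geom n : opnorm_le L (\sum_(i < n) e ^+ i) (1 - c)^-1.
  have : opnorm_le L (\sum_(i < n) e ^+ i) (\sum_(i < n) c ^+ i).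
    elim: n => [|n IH]; last by rewrite !big_ord_recr /=; apply: opnorm_leD => //; exact: opnorm_leE.
    by rewrite !big_ord0 => f b _ _ x; rewrite mul0r /act size_poly0 big_ord0 nm0.
  move=> h; apply: opnorm_le_mono h _; rewrite -[leRHS]mul1r ler_pdivlMr //.
  have : c ^+ n - 1 = (c - 1) * \sum_(i < n) c ^+ i by rewrite subrX1.
  have : 0 <= c ^+ n by exact: exprn_ge0.
  by move=> h1 h2; rewrite mulrC -opprB mulNr -h2; lra.
have QB k l : (k <= l)%N -> opnorm_le L (Q l - Q k) (rho k).
  move=> /subnKC <-; have -> : Q (k + (l - k))%N - Q k = q * (e ^+ k * \sum_(i < l - k) e ^+ i).
    rewrite /Q -mulrBr; congr (_ * _); rewrite big_split_ord /=.
    by rewrite [X in X - _]addrC addrK mulr_sumr; apply: eq_bigr => i _; rewrite exprD.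
  by rewrite /rho -mulrA; apply: opnorm_leM => //; apply: opnorm_leM => //; exact: opnorm_leE.
have cauchy k l A : measurable A -> (k <= l)%N -> nm (pmeas (Q l) A - pmeas (Q k) A) <= rho k.
  by move=> mA kl; rewrite -pmeasB; apply: opnorm_le_pmeas => //; exact: QB.
have [nr hr] : exists nu : {charge set (borel G) -> \bar R},
    forall k A, measurable A -> `|complex.Re (pmeas (Q k) A) - fine (nu A)| <= rho k.
  apply: limit_charge => //.
  - by move=> k A B mA mB AB; rewrite pmeasU // ReD.
  - move=> k F mF dF F0 b b0; have [n hn] := pmeas_continuous (Q k) mF dF F0 b0.
    by exists n => l nl; apply: (le_trans (nm_Re _)); exact: hn.
  - move=> k l A mA kl; rewrite -ReB; apply: (le_trans (nm_Re _)); exact: cauchy.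
have [ni hi] : exists nu : {charge set (borel G) -> \bar R},
    forall k A, measurable A -> `|complex.Im (pmeas (Q k) A) - fine (nu A)| <= rho k.
  apply: limit_charge => //.
  - by move=> k A B mA mB AB; rewrite pmeasU // ImD.
  - move=> k F mF dF F0 b b0; have [n hn] := pmeas_continuous (Q k) mF dF F0 b0.
    by exists n => l nl; apply: (le_trans (nm_Im _)); exact: hn.
  - move=> k l A mA kl; rewrite -ImB; apply: (le_trans (nm_Im _)); exact: cauchy.
exists Q, (fun k => 2 * rho k + c ^+ k), (CMeasure nr ni); split.
- move=> k A mA; apply: (le_trans (nm_le_ReIm _)).
  rewrite ReB ImB /=; have := hr k A mA; have := hi k A mA.
  have : 0 <= c ^+ k by exact: exprn_ge0.
  lra.
- move=> k; rewrite QE; apply: opnorm_le_mono (opnorm_leE qL k qc) _.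
  by rewrite lerDr mulr_ge0 // !mulr_ge0 ?invr_ge0 ?exprn_ge0 // ltW.
- move=> b b0; have b4 : 0 < b / 4 by rewrite divr_gt0.
  have [k hk] := rho0 _ b4; have b2 : 0 < b / 2 by rewrite divr_gt0.
  have [l _ hl] := expr_small c0 c1 b2.
  exists (maxn k l); have := hk _ (leq_maxl k l); have := hl _ (leq_maxr k l).
  rewrite /=; lra.
Qed.

(** The limit measure is an inverse: its convolution with [z - mu] is approximated
    uniformly by the measures of [q * (z%:P - 'X)], which are close to the unit
    mass at zero. *)
Lemma regular_spectrum z : regular L z -> ~ spectrum mu z.
Proof.
move=> /regular_limit[q [rho [nu [nuq qz rho0]]]]; apply; exists nu.
  (* Regularity passes to the uniform limit through the Jordan parts. *)
  move=> A mA e e0; have e8 : 0 < e / 16 by rewrite divr_gt0.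
  have [k hk] := rho0 _ e8; pose p := q k.
  have S0 : 0 <= S p by rewrite sumr_ge0 // => i _; exact: nm_ge0.
  have S1 : 0 < S p + 1 by rewrite ltr_wpDl.
  have d0 : 0 < e / 16 / (S p + 1) by rewrite divr_gt0.
  have [K [U [cK oU KA AU hKU]]] :=
    reg_common hausdorffG (fun j : 'I_(size p) => mpow j) mA d0.
  exists K, U; split => //.
  have mK := compact_borel hausdorffG cK; have mU := open_borel oU.
  have mUK : measurable ((U : set (borel G)) `\` K) by exact: measurableD.
  apply: (le_lt_trans (total_variation_parts nu mUK)).
  have small B : measurable B -> B `<=` U `\` K -> nm (nu B) <= e / 8.
    move=> mB BUK.
    have h1 : nm (pmeas p B) <= S p * (e / 16 / (S p + 1)).
      by apply: pmeas_le => j; apply: le_trans (hKU j); exact: rm_le.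
    have h2 : S p * (e / 16 / (S p + 1)) <= e / 16.
      by rewrite mulrCA ger_pMr // ler_pdivrMr // mul1r lerDl.
    have h3 := le_trans (nuq k B mB) hk.
    have := nmB (pmeas p B) (pmeas p B - nu B).
    have -> : pmeas p B - (pmeas p B - nu B) = nu B by ring.
    rewrite -/p in h3; lra.
  have parts j : rm (cpart nu j) ((U : set (borel G)) `\` K) <= e / 8.
    case: j => [[] b]; rewrite /cpart /rm /=; apply: jpart_le => // B mB BUK.
      by apply: le_trans (small B mB BUK); exact: (nm_Im (nu B)).
    by apply: le_trans (small B mB BUK); exact: (nm_Re (nu B)).
  rewrite sumEFin lte_fin sum_bool2.
  have := parts (true, true); have := parts (true, false).
  by have := parts (false, true); have := parts (false, false); lra.
move=> A mA; apply: nm_small_eq => e e0.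
have D0 : 0 < nm z + 2 by rewrite ltr_wpDl // nm_ge0.
have [k hk] := rho0 _ (divr_gt0 e0 D0); pose p := q k.
have bM : bmeas (fun x : borel G => rm M (translate x A)) by apply: bmeas_translate => //; exact: reg_mP.
have close (h : borel G -> R) : bmeas h -> (forall x, 0 <= h x <= 1) ->
    nm (\sum_j ccoef R j * (\int[cpart nu j]_x h x)%:C
      - \sum_(i < size p) p`_i * (\int[mpow i]_x h x)%:C) <= rho k.
  move=> bh h01.
  pose a (j : bool * bool + 'I_(size p)) :=
    match j with inl i => ccoef R i | inr i => - p`_i end.
  pose m (j : bool * bool + 'I_(size p)) :=
    match j with inl i => cpart nu i | inr i => mpow i end.
  have := @comb_int_le _ _ R _ a m (rho k) h.
  rewrite big_sumType /=; under [X in _ + X]eq_bigr do rewrite mulNr.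
  rewrite sumrN; apply => //; last by case: bh.
  move=> B mB; rewrite big_sumType /=; under [X in _ + X]eq_bigr do rewrite mulNr.
  by rewrite sumrN -cmeasure_parts // nm_distC; exact: nuq.
have -> : Defs.conv nu (fun B => z * delta0 R B - mu B) A
    = z * \sum_j ccoef R j * (\int[cpart nu j]_x \1_A x)%:C
      - \sum_j ccoef R j * (\int[cpart nu j]_x rm M (translate x A))%:C.
  rewrite (conv_affine compactG hausdorffG muM) // mulr_sumr -sumrB.
  by apply: eq_bigr => j _; rewrite int_indic // conv_finE // mulrBr; ring.
have -> : delta0 R A = pmeas (1 - p * (z%:P - 'X)) A
    + (z * \sum_(i < size p) p`_i * (\int[mpow i]_x \1_A x)%:C
      - \sum_(i < size p) p`_i * (\int[mpow i]_x rm M (translate x A))%:C).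
  rewrite -pmeasMX //; have -> : \sum_(i < size p) p`_i * (\int[mpow i]_x \1_A x)%:C = pmeas p A.
    by apply: eq_bigr => i _; rewrite int_indic.
  rewrite -pmeasZ -pmeasB -pmeasD -[LHS](pmeas1 compactG hausdorffG M).
  by congr pmeas; rewrite -mul_polyC; ring.
have b1 : bmeas (\1_A : borel G -> R) by exact: bmeas_indic.
have h1 := close _ b1; have h2 := close _ bM.
have i01 x : 0 <= (\1_A x : R) <= 1 by rewrite indicE ler0n lern1 leq_b1.
have s01 x : 0 <= rm M (translate x A) <= 1.
  by rewrite rm_ge0 -M1 rm_le //; exact: translate_borel.
move: (h1 i01) (h2 s01) => {}h1 {}h2.
have h3 := opnorm_le_pmeas compactG hausdorffG M1 (qz k) mA.
set X1 := \sum_j ccoef R j * _ in h1 *; set Y1 := \sum_(i < _) _ in h1 *.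
set X2 := \sum_j ccoef R j * _ in h2 *; set Y2 := \sum_(i < _) _ in h2 *.
have -> : z * X1 - X2 - (pmeas (1 - p * (z%:P - 'X)) A + (z * Y1 - Y2))
   = z * (X1 - Y1) - (X2 - Y2) - pmeas (1 - p * (z%:P - 'X)) A by ring.
apply: (le_trans (nmB _ _)); apply: (@le_trans _ _ ((nm z * rho k + rho k) + rho k)).
  apply: lerD => //; apply: (le_trans (nmB _ _)); apply: lerD => //.
  by rewrite nmM ler_wpM2l ?nm_ge0.
have -> : nm z * rho k + rho k + rho k = rho k * (nm z + 2) by ring.
by rewrite -ler_pdivlMr.
Qed.

End RegularSpectrum.

(** * The dual group *)

Section Dual.
Variables (R : realType) (G : topologicalZmodType).
Hypotheses (compactG : compact [set: G]).
Variable H : (G -> R[i]) -> R[i].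
Hypothesis qH : quadrature H.
Hypothesis invH : forall f a, ucont f -> H (fun x : G => f (a + x)) = H f.

Lemma dual_groupP (g : G -> R[i]) :
  dual_group (g : {compact-open, G -> R[i]^o}) <-> character g.
Proof.
split=> [[cg gM g1]|[cg gM g1]].
  split => //; first exact: continuous_ucont.
  move=> x; have /(congr1 (@complex.Re R)) := g1 x.
  by rewrite nmE.
split => //; first exact: ucont_continuous.
by move=> x; rewrite nmE g1.
Qed.

(** Distinct characters are orthogonal, hence far apart. *)
Lemma character_isolated (f g : G -> R[i]) : character f -> character g ->
  (forall x, nm (f x - g x) <= 1 / 2) -> f = g.
Proof.
move=> cf cg fg; apply: contrapT => ne; have [uf _ f1] := cf; have [ug _ _] := cg.
have cjf := ucont_cj uf.
have : nm (ip H f f - ip H g f) <= 1 / 2.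
  rewrite /ip -(quadB qH); [|exact: ucontM|exact: ucontM].
  apply: quad_le => //; first by apply: ucontB; exact: ucontM.
  by move=> x; rewrite -mulrBl nmM nm_cj f1 mulr1.
rewrite (ip_char qH cf) (char_orthogonal compactG qH invH cg cf); last by move=> h; apply: ne.
by rewrite subr0 nm1; lra.
Qed.

(** The dual of a compact group is discrete: the compact-open topology is that of
    uniform convergence, in which characters are isolated. *)
Lemma compact_dual_finite (K : set {compact-open, G -> R[i]^o}) :
  compact K -> K `<=` @dual_group R G -> finite_set K.
Proof.
move=> cK KD; apply: contrapT => /infiniteP/pcard_leP[u].
have uK n : K (u n) by have := @funS _ _ _ _ u n Logic.I.
have uI : injective u by move=> a b; apply: (@inj _ _ _ u); rewrite inE.
have FK : (u n @[n --> \oo]) K by exists 0%N => // n _; exact: uK.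
have [g [Kg clg]] := cK _ _ FK.
have Dg := KD _ Kg; have [cg gM g1] := Dg.
pose E : set (R[i]^o * R[i]^o) := [set xy | `|xy.1 - xy.2| < (1 / 2)%:C].
have eE : entourage E.
  by rewrite -entourage_ballE; exists (1 / 2)%:C => //=; rewrite ?ltcR //= -ball_normE.
pose V : set {compact-open, G -> R[i]^o} := [set h | forall y, E (g y, h y)].
have nV : nbhs g V.
  have /(compact_open_fam_compactP cg) : {compact-open, (nbhs (g : {compact-open, G -> R[i]^o})) --> g} by exact: cvg_id.
  move=> /fam_cvgP/(_ setT compactG) h.
  apply: h; apply/(@uniform_nbhs G [set: G] R[i]^o g).
  by exists E; split=> // f /= fE y; exact: fE.
have eq_g f : K f -> V f -> f = g.
  move=> Kf Vf; apply/esym; apply: character_isolated.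
  - exact/dual_groupP.
  - by apply/dual_groupP; exact: KD.
  - by move=> x; have := Vf x; rewrite /E /= nmE ltcR => /ltW.
have meet N : exists2 n, (N <= n)%N & u n = g.
  have FN : (u n @[n --> \oo]) [set u n | n in [set n | (N <= n)%N]].
    by exists N => // n /= Nn; exists n.
  have [_ [[n Nn <-] Vn]] := clg _ _ FN nV.
  by exists n => //; exact: eq_g.
have [n _ hn] := meet 0%N; have [l nl hl] := meet n.+1.
have : n = l by apply: uI; rewrite hn hl.
by move=> nE; rewrite nE ltnn in nl.
Qed.

End Dual.

Section HaarNull.
Variables (R : realType) (G : topologicalZmodType).
Hypotheses (compactG : compact [set: G]) (hausdorffG : hausdorff_space G).
Variable m : regular_measure R G.
Hypothesis m1 : rm m setT = 1.
Hypothesis minv : forall x A, measurable A -> rm m (translate x A) = rm m A.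

Lemma nondiscrete_infinite : ~ (forall x : G, open [set x]) ->
  infinite_set [set: borel G].
Proof.
move=> nd finG; apply: nd => x; rewrite -[[set x]]setCK; apply: closed_openC.
apply: compact_closed => //; apply: finite_compact.
exact: sub_finite_set finG.
Qed.

(** All points have the same mass, and there are infinitely many. *)
Lemma haar_null_point : infinite_set [set: borel G] -> rm m [set (0 : G)] = 0.
Proof.
move=> /infiniteP/pcard_leP[u].
have uI : injective u by move=> a b; apply: (@inj _ _ _ u); rewrite inE.
have mpt (x : G) : measurable ([set x] : set (borel G)).
  by apply: compact_borel => //; exact: compact_set1.
pose a := rm m [set (0 : G)].
have ptE (x : G) : rm m [set x] = a.
  rewrite -(minv x (mpt x)); congr (rm m _); apply/seteqP; split => y /=.
    by rewrite /translate /= => h; apply: (@addrI _ x); rewrite addr0.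
  by rewrite /translate /= => ->; rewrite addr0.
pose U n : set (borel G) := [set u k | k in `I_n].
have US n : U n.+1 = U n `|` [set u n].
  apply/seteqP; split => x.
    case=> k /=; rewrite ltnS leq_eqVlt => /orP[/eqP -> <-|kn <-]; [by right|].
    by left; exists k.
  case=> [[k kn <-]|->]; last by exists n => /=.
  by exists k => //=; exact: ltnW.
have mUn n : measurable (U n).
  elim: n => [|n IH]; last by rewrite US; apply: measurableU.
  by rewrite (_ : U 0%N = set0) //; apply/seteqP; split => // x [].
have Ua n : rm m (U n) = n%:R * a.
  elim: n => [|n IH].
    by rewrite (_ : U 0%N = set0) ?rm0 ?mul0r //; apply/seteqP; split => // x [].
  have UD : U n.+1 `\` U n = [set u n].
    rewrite US; apply/seteqP; split => x; first by case=> [[//|//]].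
    move=> ->; split; first by right.
    by case=> k /= kn /uI kE; rewrite kE ltnn in kn.
  have Usub : U n `<=` U n.+1 by rewrite US; exact: subsetUl.
  have := rmD m (mUn n.+1) (mUn n) Usub; rewrite UD ptE IH => h.
  by rewrite -natr1 mulrDl mul1r; lra.
apply/eqP; rewrite eq_le rm_ge0 andbT leNgt; apply/negP; rewrite -/a => a0.
have := Num.Theory.archi_boundP (ltW (divr_gt0 ltr01 a0)).
set n := Num.bound _ => hn; have := rm_le m (mUn n) measurableT (@subsetT _ _).
rewrite Ua m1 -ler_pdivlMr //; move: hn; lra.
Qed.

End HaarNull.

(** * The shape of the spectrum *)

Section RealInterval.
Variables (R : realType) (reg : R[i] -> Prop).
Hypothesis reg_open : forall z, reg z -> exists2 r : R, 0 < r & forall w, nm (w - z) <= r -> reg w.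
Hypothesis reg_large : forall z, 1 < nm z -> reg z.
Hypothesis reg_nonreal : forall z, complex.Im z != 0 -> reg z.
Hypothesis nreg1 : ~ reg 1.
Hypothesis gap : forall m r x : R, 0 < r -> r < `|m| ->
  (forall z : R[i], nm (z - m%:C) = r -> reg z) -> `|x - m| < r -> reg x%:C.

(** The real points of a circle with real centre are its two end points. *)
Let reg_circle (m r : R) : reg (m - r)%:C -> reg (m + r)%:C ->
  forall z : R[i], nm (z - m%:C) = r -> reg z.
Proof.
move=> r1 r2 z; have [zI|zI _] := eqVneq (complex.Im z) 0; last exact: reg_nonreal.
have -> : z = (complex.Re z)%:C by rewrite {1}(complexEE z) zI.
rewrite -rmorphB nm_real => h.
have [h1|h1] := leP 0 (complex.Re z - m).
  by move: h; rewrite ger0_norm // => h; have -> : complex.Re z = m + r by lra.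
by move: h; rewrite ltr0_norm // => h; have -> : complex.Re z = m - r by lra.
Qed.

(** If [x] were regular with [0 < x < 1], the circle with diameter from [x] to
    [x + 4] would consist of regular points and enclose 1 but not 0, so that 1
    would be regular.  Likewise on the left, with the least non-regular point in
    the place of 1 and the diameter from [x - 4] to [x]. *)
Lemma nonregular_interval : exists2 c : R, 0 <= c <= 1 &
  [set z | ~ reg z] = [set x%:C | x in `[- c, 1]].
Proof.
have large x : 1 < `|x| -> reg x%:C by move=> x1; apply: reg_large; rewrite nm_real.
have pos x : 0 < x <= 1 -> ~ reg x%:C.
  move=> /andP[x0]; rewrite le_eqVlt => /orP[/eqP -> //|x1] rx.
  apply: nreg1; apply: (@gap (x + 2) 2 1) => //.
  - by rewrite ger0_norm; lra.
  - apply: reg_circle; first by have -> : x + 2 - 2 = x by lra.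
    by apply: large; rewrite ger0_norm; lra.
  - by rewrite ltr_norml; lra.
pose E : set R := [set x | ~ reg x%:C].
have E1 : E 1 by exact: nreg1.
have Elb : lbound E (-1).
  move=> x Ex; rewrite leNgt; apply/negP => x1; apply: Ex; apply: large.
  by rewrite ltr0_norm; lra.
have Einf : has_inf E by split; [exists 1|exists (-1)].
pose a := inf E.
have a1 : -1 <= a by apply: lb_le_inf => //; exists 1.
have ax x : E x -> a <= x by move=> Ex; apply: ge_inf => //; exists (-1).
have a0 : a <= 0.
  apply/ler_addgt0Pr => e e0; rewrite add0r.
  have [e1|e1] := leP e 1; first by apply: ax; apply: pos; rewrite e0 e1.
  by apply: le_trans (ltW e1); exact: ax.
have Ea : E a.
  move=> ra; have [r r0 hr] := reg_open ra.
  have ar : a < a + r by rewrite ltrDl.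
  have [x Ex xr] := inf_lt Einf.1 ar.
  apply: (Ex); apply: hr; rewrite -rmorphB nm_real ger0_norm; have := ax _ Ex; lra.
have E0 : E 0.
  move=> r0; have [r rp hr] := reg_open r0; pose d := Num.min r 1.
  have d0 : 0 < d by rewrite lt_min rp ltr01.
  have dr : d <= r by rewrite ge_min lexx.
  have d1 : d <= 1 by rewrite ge_min lexx orbT.
  apply: (pos d); first by rewrite d0 d1.
  by apply: hr; rewrite subr0 nm_real gtr0_norm.
have neg x : a < x < 0 -> E x.
  move=> /andP[xa x0] rx; apply: Ea; apply: (@gap (x - 2) 2 a) => //.
  - by rewrite ltr0_norm; lra.
  - apply: reg_circle; last by have -> : x - 2 + 2 = x by lra.
    by apply: large; rewrite ltr0_norm; lra.
  - by rewrite ltr_norml; lra.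
exists (- a); first by apply/andP; split; lra.
apply/seteqP; split => z /=.
  have [zI|zI] := eqVneq (complex.Im z) 0; last by case; exact: reg_nonreal.
  have zE : z = (complex.Re z)%:C by rewrite {1}(complexEE z) zI.
  rewrite zE => Ez; exists (complex.Re z) => //=.
  rewrite in_itv /= opprK ax //= leNgt; apply/negP => z1.
  by apply: Ez; apply: large; rewrite ger0_norm; lra.
move=> [x /=]; rewrite in_itv /= opprK => /andP[xa x1] <-.
have [x0|x0|->] := ltrgtP x 0; last exact: E0.
  by move: xa; rewrite le_eqVlt => /orP[/eqP <- //|xa]; apply: neg; rewrite xa.
by apply: pos; rewrite x0.
Qed.

End RealInterval.

Section Parreau.
Variables (R : realType) (G : topologicalZmodType).
Hypotheses (compactG : compact [set: G]) (hausdorffG : hausdorff_space G).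
Variable mu : cmeasure R G.

(** For a positive measure the total variation of a set is at least its mass. *)
Lemma MG_regular (P : {finite_measure set (borel G) -> \bar R}) : MG mu ->
  (forall A, measurable A -> mu A = (fine (P A))%:C) -> radon P.
Proof.
move=> Mmu muP A mA e e0; have [K [U [cK oU KA AU hKU]]] := Mmu A mA e e0.
exists K, U; split => //.
have mUK : measurable ((U : set (borel G)) `\` K).
  by apply: measurableD; [exact: open_borel|exact: compact_borel].
have := le_lt_trans (total_variation_ge mu mUK) hKU.
by rewrite lte_fin muP // nm_real ger0_norm // fine_ge0.
Qed.

Variable M : regular_measure R G.
Hypothesis muM : forall A, measurable A -> mu A = (rm M A)%:C.
Hypothesis M1 : rm M setT = 1.

Local Notation L := (cint M).

(** The transform is defined with the reflected character, whence the
    conjugation. *)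
Lemma fourier_character (g : G -> R[i]) : character g ->
  fourier_stieltjes mu (fun x => cj (g x) : R[i]^o) = L g.
Proof.
move=> cg; have [ug _ _] := cg; rewrite /fourier_stieltjes.
have -> : (fun x : borel G => cj (g (- (x : G)))) = g.
  by apply/funext => x; rewrite (charN _ cg) cjK.
apply: (cintegral_prob muM); split; [exact: ucont_bmeas_Re|exact: ucont_bmeas_Im].
Qed.

Lemma character_cj (g : G -> R[i]) : character g -> character (fun x => cj (g x)).
Proof.
case=> ug gM g1; split; first exact: ucont_cj.
  by move=> x y; rewrite gM cjM.
by move=> x; rewrite nm_cj.
Qed.

Lemma vanishing_enumeration (H : (G -> R[i]) -> R[i]) : quadrature H ->
  (forall f a, ucont f -> H (fun x : G => f (a + x)) = H f) ->
  M0G mu -> forall d : R, 0 < d -> exists n (e : 'I_n -> G -> R[i]),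
  [/\ forall i, character (e i), orthonormal H e &
      forall g, character g -> d <= nm (L g) -> exists i, g = e i].
Proof.
move=> qH invH [_ van] d d0; have [K [cK KD hK]] := van d d0.
pose X : set (G -> R[i]) := [set g | character g /\ d <= nm (L g)].
have finX : finite_set X.
  have finK := compact_dual_finite compactG qH invH cK KD.
  apply: (sub_finite_set _ (finite_image (fun g x => cj (g x)) finK)) => g [cg dg].
  exists (fun x => cj (g x)); last by apply/funext => x; rewrite cjK.
  apply: contrapT => nK; have := hK _ _ nK.
  rewrite fourier_character // nmE ltcR ltNge dg => /(_ _)/negP; apply=> //.
  by apply/(dual_groupP compactG); exact: character_cj.
have [s Xs] := (@finite_seqP (G -> R[i]) X).1 finX.
have XE g : X g <-> g \in undup s by rewrite mem_undup Xs.
pose e (i : 'I_(size (undup s))) := nth (fun=> 0) (undup s) i.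
have Xe i : X (e i) by apply/XE; exact: mem_nth.
have ce i : character (e i) by case: (Xe i).
exists _, e; split => //.
  split; first by move=> i; case: (ce i).
  move=> i j; have [->|ij] := eqVneq i j; first by rewrite (ip_char qH).
  rewrite (char_orthogonal compactG qH invH) // => /eqP.
  by rewrite /e nth_uniq ?undup_uniq // => /eqP h; case/eqP: ij; exact: val_inj.
move=> g cg dg; have /XE gs : X g by [].
have il : (index g (undup s) < size (undup s))%N by rewrite index_mem.
by exists (Ordinal il); rewrite /e /= nth_index.
Qed.

End Parreau.

Theorem theorem4p3 (R : realType) (G : topologicalZmodType)
    (compactG : compact [set: G]) (hausdorffG : hausdorff_space G)
    (nondiscreteG : ~ (forall x : G, open [set x]))
    (lambda : {measure set (borel G) -> \bar R}) (haar : haar_measure lambda)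
    (mu : cmeasure R G) (mu0 : M0G mu) (parreau_mu : parreau lambda mu) :
  exists2 c : R, 0 <= c <= 1 & exists2 S : set R, finite_set S &
    spectrum mu = [set x%:C | x in `[- c, 1] `|` S] \/
    spectrum mu = [set x%:C | x in `[- 1, c] `|` S].
Proof.
have [Mmu [P muP] realS sing] := parreau_mu.
have [m [m1 minv mnull]] := haar_regular compactG haar.
pose M : regular_measure R G := RegularMeasure (MG_regular hausdorffG Mmu muP).
have muM A : measurable A -> mu A = (rm M A)%:C by exact: muP.
have M1 : rm M setT = 1 by rewrite /rm /= probability_setT.
have qL : quadrature (cint M) by exact: cint_quadrature.
have qH : quadrature (cint m) by exact: cint_quadrature.
have invH f a : ucont f -> cint m (fun x : G => f (a + x)) = cint m f.
  exact: cint_inv.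
have nonreal z : complex.Im z != 0 -> ~ spectrum mu z.
  by move=> /eqP zI /realS.
have regularP z : spectrum mu z <-> ~ regular (cint M) z.
  split=> [Sz rz|nr]; first exact: (regular_spectrum compactG hausdorffG muM M1 rz).
  apply: contrapT => nS; apply: nr.
  exact: (spectrum_regular compactG hausdorffG muM M1 nonreal nS).
have reg_nonreal z : complex.Im z != 0 -> regular (cint M) z.
  by move=> /nonreal; exact: (spectrum_regular compactG hausdorffG muM M1).
have powers_singular n : exists N : set (borel G), [/\ measurable N, rm m N = 0 &
    rm (mpow compactG hausdorffG (reg_mP M) n) (~` N) = 0].
  case: n => [|n].
    (* The zeroth power is the unit mass at zero, carried by a Haar-null point. *)
    exists [set (0 : G)]; split.
    - by apply: compact_borel => //; exact: compact_set1.
    - by apply: haar_null_point => //; exact: nondiscrete_infinite.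
    - by rewrite /= rm_dirac memNset //=; apply.
  have [N [mN N0 hN]] := sing n.+1 isT; exists N; split => //; first exact: mnull.
  have mNC : measurable (~` N) by exact: measurableC.
  have := hN _ mNC (@subset_refl _ _).
  by rewrite (convpow_mpow compactG hausdorffG muM) // => /(congr1 (@complex.Re R)).
have separated := mpow_separated M1 m1 powers_singular.
have vanishing := vanishing_enumeration compactG muM qH invH mu0.
have gap := spectral_gap compactG qL qH invH hausdorffG reg_nonreal vanishing separated.
have nreg1 : ~ regular (cint M) 1.
  have := @regular_char R G (cint M) qL (fun=> 1) (@ucont_cst R G 1).
  rewrite quad_cst //; apply => [x y|x]; first by rewrite mulr1.
  exact: nm1.
have [c c01 Ec] := nonregular_interval (regular_open qL) (regular_large qL)
  reg_nonreal nreg1 gap.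
exists c => //; exists set0; first exact: finite_set0.
left; rewrite setU0 -Ec; apply/seteqP.
by split => z /=; rewrite regularP.
Qed.
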